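(* Let $\mathcal F$ and $\mathcal F'$ be two transvergent front diagrams which coincide outside a disk symmetric with respect to the $x$-axis, and such that inside the disk $\mathcal F$ is the $S$-configuration and $\mathcal F'$ is the $T$-configuration. Then $\mathcal F$ and $\mathcal F'$ represent strongly invertible Legendrian links which are not equivalent to each other (as strongly invertible Legendrian links). In particular, if $(\mathcal K,p)$ is a strongly invertible Legendrian knot with a distinguished $\tau$-fixed point $p\in\mathcal K$, then $S(\mathcal K,p)$ and $T(\mathcal K,p)$ are not equivalent.
   Context: Basic setting. Let $\tau:\mathbb R^3\to\mathbb R^3$, $\tau(x,y,z)=(x,-y,-z)$, and $\xi_{\rm st}=\ker(dz-y\,dx)$. A link is a finite collection of disjoint smoothly embedded circles. A link $L$ is strongly invertible if $\tau(L_i)=L_i$ for each component $L_i$ and $\tau|_{L_i}$ has exactly two fixed points. A strongly invertible Legendrian link is a strongly invertible link everywhere tangent to $\xi_{\rm st}$; two of them are equivalent if they are connected by a smooth family of strongly invertible Legendrian links. All links are unoriented. The front of a Legendrian link is its image under $\pi(x,y,z)=(x,z)$. It is generic (a front diagram) if its only singularities are semicubical cusps and transverse double points (crossings). A front determines the Legendrian link via $y=dz/dx$; at a crossing the strand of smaller slope is the over-strand. The $xz$-plane is drawn with the $x$-axis horizontal pointing right and the $z$-axis pointing up. A transvergent front diagram is a generic front of a strongly invertible Legendrian link (it is preserved by $(x,z)\mapsto(x,-z)$). The $\tau$-fixed points of the link correspond exactly to the cusps on the $x$-axis (''the axis''). A cusp is right-pointing (resp. left-pointing) if both of its branches leave the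 tip towards the left (resp. right). $S$-configuration: in the disk there is an arc, symmetric with respect to the axis, with both ends on the left side of the disk; its upper half enters from the left above the axis, goes rightwards above the axis to a right-pointing cusp lying above the axis, and then turns back leftwards and downwards to a left-pointing cusp on the axis; the lower half is the mirror image; there are no crossings in the disk. $T$-configuration: in the disk there is an arc, symmetric with respect to the axis, with the same ends on the left side of the disk; the half entering from the upper left descends across the axis and then, staying below the axis, goes rightwards to a right-pointing cusp on the axis; the other half is the mirror image; there is exactly one crossing in the disk, on the axis and to the left of the cusp. Stabilizations. Let $\mathcal F$ be a transvergent front diagram and $c\in\mathcal F$ a cusp on the axis. If $c$ is right-pointing, $S(\mathcal F,c)$ (resp. $T(\mathcal F,c)$) is obtained by replacing $\mathcal F$ with the $S$-configuration (resp. $T$-configuration) in a small symmetric disk meeting $\mathcal F$ only in the two branches of $c$; if $c$ is left-pointing, one uses instead the local pictures rotated by $(x,z)\mapsto(-x,-z)$. Each component of a transvergent front diagram has exactly two cusps on the axis, a left one (smaller $x$-coordinate) and a right one. A cusp $c$ on the axis is in standard form if it is a left-pointing left cusp or a right-pointing right cusp. Given a strongly invertible Legendrian link $\mathcal L$, a point $p=\tau(p)\in\mathcal L$, a transvergent front diagram $\mathcal F$ representing $\mathcal L$ and the cusp $c$ on the axis corresponding to $p$: the link $S(\mathcal L,p)$ is determined (up to equivalence) by $S(\mathcal F,c)$ if $c$ is in standard form and by $T(\mathcal F,c)$ otherwise; the link $T(\mathcal L,p)$ is determined by $T(\mathcal F,c)$ if $c$ is in standard form and by $S(\mathcal F,c)$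 otherwise. *)

(* Defs.v *)
From Stdlib Require Import Reals ZArith.
From Coquelicot Require Import Coquelicot.
Open Scope R_scope.

Definition R2 : Type := (R * R)%type.
Definition R3 : Type := (R * R * R)%type.

Definition px (P : R3) : R := fst (fst P).
Definition py (P : R3) : R := snd (fst P).
Definition pz (P : R3) : R := snd P.

Definition tau (P : R3) : R3 := (px P, - py P, - pz P).

Definition front_proj (P : R3) : R2 := (px P, pz P).

(** * Smooth maps *)

Definition smooth (f : R -> R) : Prop :=
  forall (n : nat) (s : R), ex_derive_n f n s.

Definition smooth_curve (a : R -> R3) : Prop :=
  smooth (fun s => px (a s)) /\ smooth (fun s => py (a s)) /\
  smooth (fun s => pz (a s)).

Fixpoint of_class_C (k : nat) (f : R -> R -> R) : Prop :=
  (forall t s, continuity_2d_pt f t s) /\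
  match k with
  | O => True
  | S k' =>
      (forall t s, ex_derive (fun t' => f t' s) t /\
                   ex_derive (fun s' => f t s') s) /\
      of_class_C k' (fun t s => Derive (fun t' => f t' s) t) /\
      of_class_C k' (fun t s => Derive (fun s' => f t s') s)
  end.

Definition smooth2 (f : R -> R -> R) : Prop := forall k, of_class_C k f.

Definition smooth_family (g : R -> R -> R3) : Prop :=
  smooth2 (fun t s => px (g t s)) /\ smooth2 (fun t s => py (g t s)) /\
  smooth2 (fun t s => pz (g t s)).

(** * Strongly invertible Legendrian links *)

Definition immersed_at (a : R -> R3) (s : R) : Prop :=
  ~ (Derive (fun u => px (a u)) s = 0 /\
     Derive (fun u => py (a u)) s = 0 /\
     Derive (fun u => pz (a u)) s = 0).

(* The velocity lies in the kernel of dz - y dx. *)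
Definition legendrian_at (a : R -> R3) (s : R) : Prop :=
  Derive (fun u => pz (a u)) s = py (a s) * Derive (fun u => px (a u)) s.

(* A smoothly embedded circle, parametrized by R / Z. *)
Definition embedded_circle (a : R -> R3) : Prop :=
  smooth_curve a /\
  (forall s, a (s + 1) = a s) /\
  (forall s, immersed_at a s) /\
  (forall s t, a s = a t -> exists k : Z, t = s + IZR k).

Definition on_curve (a : R -> R3) (P : R3) : Prop := exists s, a s = P.

Definition strongly_invertible (a : R -> R3) : Prop :=
  (forall P, on_curve a P <-> on_curve a (tau P)) /\
  exists P Q, P <> Q /\
    forall A, (on_curve a A /\ tau A = A) <-> (A = P \/ A = Q).

(* [g 0, ..., g (n - 1)] parametrize the components; the values [g i] for
   [n <= i] are irrelevant. *)
Definition si_legendrian (n : nat) (g : nat -> R -> R3) : Prop :=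
  (forall i, (i < n)%nat ->
     embedded_circle (g i) /\ (forall s, legendrian_at (g i) s) /\
     strongly_invertible (g i)) /\
  (forall i j s t, (i < n)%nat -> (j < n)%nat -> i <> j -> g i s <> g j t).

(* Links are unoriented and without an order of the components: a link is the
   subset of R^3 swept out by its parametrized components. *)
Definition parametrizes (n : nat) (g : nat -> R -> R3) (L : R3 -> Prop) : Prop :=
  si_legendrian n g /\
  forall P, L P <-> exists i, (i < n)%nat /\ on_curve (g i) P.

Definition si_legendrian_link (L : R3 -> Prop) : Prop :=
  exists n g, parametrizes n g L.

Definition si_legendrian_knot (K : R3 -> Prop) : Prop :=
  exists g, parametrizes 1 g K.

(* Only the times t in [0, 1] carry links; smoothness on [0, 1] x R is smoothness
   of an extension to all times. *)
Definition isotopy (n : nat) (g : nat -> R -> R -> R3) (L L' : R3 -> Prop) : Prop :=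
  (forall i, (i < n)%nat -> smooth_family (g i)) /\
  (forall t, 0 <= t <= 1 -> si_legendrian n (fun i => g i t)) /\
  parametrizes n (fun i => g i 0) L /\
  parametrizes n (fun i => g i 1) L'.

Definition equivalent (L L' : R3 -> Prop) : Prop :=
  exists n g, isotopy n g L L'.

(* Equivalence of links with a distinguished fixed point of [tau]. *)
Definition pointed_equivalent (L : R3 -> Prop) (p : R3)
    (L' : R3 -> Prop) (p' : R3) : Prop :=
  exists n g (q : R -> R3),
    isotopy n g L L' /\ smooth_curve q /\ q 0 = p /\ q 1 = p' /\
    forall t, 0 <= t <= 1 ->
      tau (q t) = q t /\ exists i, (i < n)%nat /\ on_curve (g i t) (q t).

(** * Transvergent front diagrams *)

Definition front (L : R3 -> Prop) (q : R2) : Prop :=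
  exists P, L P /\ front_proj P = q.

Definition singular (a : R -> R3) (s : R) : Prop :=
  Derive (fun u => px (a u)) s = 0 /\ Derive (fun u => pz (a u)) s = 0.

(* A singular point of a plane curve is a semicubical cusp if and only if the
   second and third derivatives are linearly independent there. *)
Definition semicubical (a : R -> R3) (s : R) : Prop :=
  Derive_n (fun u => px (a u)) 2 s * Derive_n (fun u => pz (a u)) 3 s -
  Derive_n (fun u => px (a u)) 3 s * Derive_n (fun u => pz (a u)) 2 s <> 0.

(* In particular, the two branches of a crossing are regular. *)
Definition transverse (a : R -> R3) (s : R) (b : R -> R3) (t : R) : Prop :=
  Derive (fun u => px (a u)) s * Derive (fun u => pz (b u)) t -
  Derive (fun u => pz (a u)) s * Derive (fun u => px (b u)) t <> 0.

Definition generic_front (n : nat) (g : nat -> R -> R3) : Prop :=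
  (forall i s, (i < n)%nat -> singular (g i) s -> semicubical (g i) s) /\
  (forall i j s t, (i < n)%nat -> (j < n)%nat ->
     g i s <> g j t -> front_proj (g i s) = front_proj (g j t) ->
     transverse (g i) s (g j) t /\
     forall k u, (k < n)%nat -> front_proj (g k u) = front_proj (g i s) ->
       g k u = g i s \/ g k u = g j t).

Definition represents (F : R2 -> Prop) (L : R3 -> Prop) : Prop :=
  (exists n g, parametrizes n g L /\ generic_front n g) /\
  (forall q, F q <-> front L q).

Definition transvergent_front (F : R2 -> Prop) : Prop :=
  exists L, represents F L.

(** * Symmetric disks *)

Definition closed_unit_disk (u : R2) : Prop := fst u ^ 2 + snd u ^ 2 <= 1.
Definition open_unit_disk (u : R2) : Prop := fst u ^ 2 + snd u ^ 2 < 1.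

(* A disk symmetric with respect to the x-axis is the image of the closed unit
   disk under an equivariant topological embedding; the embedding is normalized
   to respect the left and right ends of the disk on the axis. *)
Definition symmetric_disk (Phi : R2 -> R2) : Prop :=
  continuous_on closed_unit_disk Phi /\
  (forall u v, closed_unit_disk u -> closed_unit_disk v -> Phi u = Phi v -> u = v) /\
  (forall u, closed_unit_disk u ->
     Phi (fst u, - snd u) = (fst (Phi u), - snd (Phi u))) /\
  fst (Phi (-1, 0)) < fst (Phi (1, 0)).

Definition in_disk (Phi : R2 -> R2) (q : R2) : Prop :=
  exists u, closed_unit_disk u /\ Phi u = q.

Definition inside_disk (Phi : R2 -> R2) (q : R2) : Prop :=
  exists u, open_unit_disk u /\ Phi u = q.

Definition on_left_side (Phi : R2 -> R2) (q : R2) : Prop :=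
  exists u, fst u ^ 2 + snd u ^ 2 = 1 /\ fst u < 0 /\ Phi u = q.

Definition coincide_outside (Phi : R2 -> R2) (F F' : R2 -> Prop) : Prop :=
  forall q, ~ in_disk Phi q -> (F q <-> F' q).

(** * The local configurations *)

(* The part of the diagram [F] in the disk is the front of a symmetric Legendrian
   arc [a : [-1, 1] -> R^3] which runs from one point of the left side of the
   disk to the mirror point. The half [0, 1] starts on the axis and ends at [e]. *)
Definition symmetric_arc (Phi : R2 -> R2) (e : R2) (F : R2 -> Prop)
    (a : R -> R3) : Prop :=
  smooth_curve a /\
  (forall s, -1 <= s <= 1 ->
     immersed_at a s /\ legendrian_at a s /\ a (- s) = tau (a s)) /\
  (forall s u, -1 <= s <= 1 -> -1 <= u <= 1 -> a s = a u -> s = u) /\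
  (exists L, represents F L /\
     forall P, (L P /\ in_disk Phi (front_proj P)) <->
               exists s, -1 <= s <= 1 /\ a s = P) /\
  (forall s, -1 < s < 1 -> inside_disk Phi (front_proj (a s))) /\
  front_proj (a 1) = e /\ on_left_side Phi e /\ 0 < snd e.

Definition no_crossings (a : R -> R3) : Prop :=
  forall s u, -1 <= s <= 1 -> -1 <= u <= 1 ->
    front_proj (a s) = front_proj (a u) -> s = u.

(* The only cusp in the disk is the right-pointing cusp [c] on the axis. *)
Definition cusp_configuration (Phi : R2 -> R2) (c e : R2) (F : R2 -> Prop) : Prop :=
  exists a, symmetric_arc Phi e F a /\ no_crossings a /\
    front_proj (a 0) = c /\
    (forall s, 0 < s <= 1 -> Derive (fun u => px (a u)) s < 0) /\
    (forall s, 0 < s <= 1 -> 0 < pz (a s)).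

(* Read backwards from [e], the upper half goes rightwards on [r, 1], turns at the
   right-pointing cusp [r], and returns leftwards on [0, r], below the strand by
   which it entered, to the left-pointing cusp [0] on the axis. *)
Definition S_configuration (Phi : R2 -> R2) (e : R2) (F : R2 -> Prop) : Prop :=
  exists a r, symmetric_arc Phi e F a /\ no_crossings a /\ 0 < r < 1 /\
    (forall s, 0 < s < r -> 0 < Derive (fun u => px (a u)) s) /\
    Derive (fun u => px (a u)) r = 0 /\
    (forall s, r < s <= 1 -> Derive (fun u => px (a u)) s < 0) /\
    (forall s, 0 < s <= 1 -> 0 < pz (a s)) /\
    (forall s u, 0 < s < r -> r < u <= 1 -> px (a s) = px (a u) ->
       pz (a s) < pz (a u)).

(* Read backwards from [e], one half goes rightwards, crosses the axis at
   parameter [r], and continues below it to the right-pointing cusp [0]. *)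
Definition T_configuration (Phi : R2 -> R2) (e : R2) (F : R2 -> Prop) : Prop :=
  exists a r, symmetric_arc Phi e F a /\ 0 < r < 1 /\
    (forall s, 0 < s <= 1 -> Derive (fun u => px (a u)) s < 0) /\
    (forall s, 0 < s < r -> pz (a s) < 0) /\
    pz (a r) = 0 /\
    (forall s, r < s <= 1 -> 0 < pz (a s)) /\
    (forall s u, -1 <= s <= 1 -> -1 <= u <= 1 -> s <> u ->
       (front_proj (a s) = front_proj (a u) <->
        ((s = r /\ u = - r) \/ (s = - r /\ u = r)))).

(** * Stabilizations *)

Definition rot (q : R2) : R2 := (- fst q, - snd q).
Definition rot_front (F : R2 -> Prop) (q : R2) : Prop := F (rot q).

Definition right_pointing (F : R2 -> Prop) (c : R2) : Prop :=
  locally c (fun q => F q -> q <> c -> fst q < fst c).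
Definition left_pointing (F : R2 -> Prop) (c : R2) : Prop :=
  locally c (fun q => F q -> q <> c -> fst c < fst q).

(* [G] is obtained from [F] by replacing a small disk around the right-pointing
   cusp [c] with the configuration [config]. *)
Definition replace_cusp (config : (R2 -> R2) -> R2 -> (R2 -> Prop) -> Prop)
    (F : R2 -> Prop) (c : R2) (G : R2 -> Prop) : Prop :=
  exists Phi e, symmetric_disk Phi /\ cusp_configuration Phi c e F /\
    coincide_outside Phi F G /\ config Phi e G.

Definition modify_cusp (config : (R2 -> R2) -> R2 -> (R2 -> Prop) -> Prop)
    (F : R2 -> Prop) (c : R2) (G : R2 -> Prop) : Prop :=
  (right_pointing F c /\ replace_cusp config F c G) \/
  (left_pointing F c /\ replace_cusp config (rot_front F) (rot c) (rot_front G)).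

(* [S_front F c G] : the diagram [G] is S(F, c); similarly for [T_front]. *)
Definition S_front := modify_cusp S_configuration.
Definition T_front := modify_cusp T_configuration.

Definition same_component (L : R3 -> Prop) (p q : R3) : Prop :=
  exists n g i, parametrizes n g L /\ (i < n)%nat /\
    on_curve (g i) p /\ on_curve (g i) q.

(* [p] is the left, resp. right, fixed point of its component. *)
Definition left_fixed_point (L : R3 -> Prop) (p : R3) : Prop :=
  tau p = p /\ exists q, same_component L p q /\ tau q = q /\ px p < px q.
Definition right_fixed_point (L : R3 -> Prop) (p : R3) : Prop :=
  tau p = p /\ exists q, same_component L p q /\ tau q = q /\ px q < px p.

Definition standard_form (F : R2 -> Prop) (L : R3 -> Prop) (p : R3) : Prop :=
  (left_pointing F (front_proj p) /\ left_fixed_point L p) \/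
  (right_pointing F (front_proj p) /\ right_fixed_point L p).

(* [S_link L p M] : the link [M] belongs to the equivalence class S(L, p), as
   computed from some front diagram [F] representing [(L, p)]; similarly for
   [T_link]. *)
Definition S_link (L : R3 -> Prop) (p : R3) (M : R3 -> Prop) : Prop :=
  exists L0 p0 F G M0,
    pointed_equivalent L p L0 p0 /\ represents F L0 /\
    ((standard_form F L0 p0 /\ S_front F (front_proj p0) G) \/
     (~ standard_form F L0 p0 /\ T_front F (front_proj p0) G)) /\
    represents G M0 /\ equivalent M0 M.

Definition T_link (L : R3 -> Prop) (p : R3) (M : R3 -> Prop) : Prop :=
  exists L0 p0 F G M0,
    pointed_equivalent L p L0 p0 /\ represents F L0 /\
    ((standard_form F L0 p0 /\ T_front F (front_proj p0) G) \/
     (~ standard_form F L0 p0 /\ S_front F (front_proj p0) G)) /\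
    represents G M0 /\ equivalent M0 M.

(* Main.v *)
Require Import Defs.
From Stdlib Require Import Reals.
From Coquelicot Require Import Coquelicot.
From Stdlib Require Import Lra Lia ZArith List FinFun Permutation.
From Stdlib Require Import Classical ClassicalEpsilon IndefiniteDescription.
Open Scope R_scope.

(* The velocity of a Legendrian curve is determined by (x', y'), a nonvanishing plane
   vector, which is vertical at the fixed points of tau.  Orienting a component by
   the direction of increasing y at one of its fixed points, the rotation number of
   (x', y') becomes an integer attached to this fixed point.  During an isotopy the
   fixed points move continuously along the x-axis without meeting, and both their
   order and their integers are constant.  Two diagrams that differ in a disk have the
   same fixed points to the left and to the right of the disk, and the same Legendrian
   curves outside the disk, as the slope of the front is y; hence their integers at the
   fixed points in the disk differ by the difference of the total angles of the arcs.
   Starting upwards, half of the S-arc turns by an angle in (-2 pi, -pi), half of the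
   T-arc by an angle in (0, pi), so that the integers differ by 2.  For a cusp, which
   starts downwards, the angle lies in (-pi, 0); consequently S and T change the
   integer k of a right-pointing cusp to -k - 1 and -k + 1, and the rotation of the
   plane exchanges these values for left-pointing cusps. *)

(** * Real functions *)

(** Two features of the setting shape the argument. A link is a bare subset of space, so an integer
    read off from one parametrization must be shown to depend on the subset alone: any Legendrian
    path inside the link that meets a component is lifted through that component by a monotone
    change of parameter. Moreover, diagrams are only subsets of the plane, so agreement of two links
    off the disk has to be recovered from slopes, including at cusps. Fixed points are matched
    across an isotopy, or across a change in the disk, by counting the fixed points to their left;
    components are never matched. In the disk nothing is known about the direction at the end of an
    arc except the sign of x', so each half arc has only an open range of angles. Doubling the range
    by symmetry gives open intervals in which integrality pins down the change at a cusp, while for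
    S against T the interval (-3, -1) excludes 0. Angles are measured in turns, so that they share
    the period 1 of the parametrizations. *)

Lemma continuity_pt_eps (f : R -> R) (x : R) :
  continuity_pt f x <->
  forall eps, 0 < eps -> exists del, 0 < del /\
    forall y, Rabs (y - x) < del -> Rabs (f y - f x) < eps.
Proof.
  unfold continuity_pt, continue_in, limit1_in, limit_in, D_x, no_cond; simpl.
  unfold Rdist. split; intros H eps He.
  - destruct (H eps He) as [d [Hd H1]]. exists d; split; auto.
    intros y Hy. destruct (Req_dec x y) as [->|Hne].
    + rewrite Rminus_diag, Rabs_R0; auto.
    + apply H1; repeat split; auto.
  - destruct (H eps He) as [d [Hd H1]]. exists d; split; auto.
    intros y [_ Hy]; auto.
Qed.

Lemma lipschitz_continuity (f : R -> R) :
  (forall x y, Rabs (f y - f x) <= Rabs (y - x)) -> continuity f.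
Proof.
  intros H x. apply continuity_pt_eps. intros eps He. exists eps; split; auto.
  intros y Hy. specialize (H x y). lra.
Qed.

Definition clamp (p q t : R) : R := Rmax p (Rmin q t).

Lemma clamp_continuity (p q : R) : continuity (clamp p q).
Proof.
  apply lipschitz_continuity. intros x y. unfold clamp, Rmax, Rmin.
  repeat destruct Rle_dec; unfold Rabs; repeat destruct Rcase_abs; lra.
Qed.

Lemma clamp_in (p q t : R) : p <= q -> p <= clamp p q t <= q.
Proof.
  intros H. unfold clamp, Rmax, Rmin. repeat destruct Rle_dec; lra.
Qed.

Lemma clamp_id (p q t : R) : p <= t <= q -> clamp p q t = t.
Proof.
  intros H. unfold clamp, Rmax, Rmin. repeat destruct Rle_dec; lra.
Qed.

Lemma continuity_comp_fun (f g : R -> R) :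
  continuity f -> continuity g -> continuity (fun x => f (g x)).
Proof. intros Hf Hg. exact (continuity_comp g f Hg Hf). Qed.

Lemma continuity_affine (c d : R) : continuity (fun x => c * x + d).
Proof.
  apply continuity_plus with (f1 := fun x => c * x) (f2 := fun _ => d).
  - apply continuity_scal. exact (derivable_continuous _ derivable_id).
  - intros x. apply continuity_pt_const. intros u v; reflexivity.
Qed.

Lemma ivt (f : R -> R) (p q y : R) :
  continuity f -> p <= q -> (f p <= y <= f q \/ f q <= y <= f p) ->
  exists t, p <= t <= q /\ f t = y.
Proof.
  intros Hf Hpq Hy. destruct (IVT_gen f p q y Hf) as [t [Ht1 Ht2]].
  - unfold Rmin, Rmax. repeat destruct Rle_dec; lra.
  - exists t. split; auto. revert Ht1. unfold Rmin, Rmax.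
    repeat destruct Rle_dec; lra.
Qed.

Lemma nonvanishing_positive (f : R -> R) (p q t0 : R) :
  continuity f -> (forall t, p <= t <= q -> f t <> 0) ->
  p <= t0 <= q -> 0 < f t0 -> forall t, p <= t <= q -> 0 < f t.
Proof.
  intros Hf Hn Ht0 H0 t Ht. apply Rnot_le_lt. intros Hle.
  assert (E : exists u, Rmin t t0 <= u <= Rmax t t0 /\ f u = 0).
  { destruct (Rle_dec t t0).
    - rewrite Rmin_left, Rmax_right by lra. apply ivt; auto. lra.
    - rewrite Rmin_right, Rmax_left by lra. apply ivt; auto; lra. }
  destruct E as [u [Hu E]]. apply (Hn u); auto.
  revert Hu; unfold Rmin, Rmax; repeat destruct Rle_dec; lra.
Qed.

Lemma integer_valued_constant (f : R -> R) (p q : R) :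
  continuity f -> p <= q ->
  (forall t, p <= t <= q -> exists k : Z, f t = IZR k) -> f p = f q.
Proof.
  intros Hf Hpq Hk.
  destruct (Hk p) as [a Ha]; [lra|]. destruct (Hk q) as [b Hb]; [lra|].
  destruct (Z.lt_trichotomy a b) as [H|[H|H]].
  - assert (IZR a + 1 <= IZR b) by (rewrite <- plus_IZR; apply IZR_le; lia).
    destruct (ivt f p q (IZR a + / 2)) as [t [Ht E]]; auto; [lra|].
    destruct (Hk t Ht) as [k Hk']. rewrite Hk' in E.
    assert (H1 : IZR (2 * k) = IZR (2 * a + 1)) by (rewrite plus_IZR, !mult_IZR; lra).
    apply eq_IZR in H1. lia.
  - subst; lra.
  - assert (IZR b + 1 <= IZR a) by (rewrite <- plus_IZR; apply IZR_le; lia).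
    destruct (ivt f p q (IZR b + / 2)) as [t [Ht E]]; auto; [lra|].
    destruct (Hk t Ht) as [k Hk']. rewrite Hk' in E.
    assert (H1 : IZR (2 * k) = IZR (2 * b + 1)) by (rewrite plus_IZR, !mult_IZR; lra).
    apply eq_IZR in H1. lia.
Qed.

(** The indicator of [Q t a] is locally constant, hence continuous, and the intermediate value
    theorem forbids it to drop from 1 to 0. The value type is arbitrary, which covers integers,
    truth values and indices of fixed points. *)
Lemma locally_constant_connected {A : Type} (Q : R -> A -> Prop) :
  (forall t a a', 0 <= t <= 1 -> Q t a -> Q t a' -> a = a') ->
  (forall t0, 0 <= t0 <= 1 -> exists a del, 0 < del /\
     forall t, 0 <= t <= 1 -> Rabs (t - t0) < del -> Q t a) ->
  forall a, Q 0 a -> Q 1 a.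
Proof.
  intros Hu Hl a H0. apply NNPP. intros H1.
  set (f := fun t => if excluded_middle_informative (Q (clamp 0 1 t) a) then 1 else 0).
  assert (Hf : continuity f).
  { intros t0. apply continuity_pt_eps. intros eps He.
    destruct (Hl (clamp 0 1 t0)) as [b [d [Hd Hb]]]; [apply clamp_in; lra|].
    pose proof (clamp_continuity 0 1 t0) as Hc. rewrite continuity_pt_eps in Hc.
    destruct (Hc d Hd) as [d' [Hd' Hc']]. exists d'; split; auto.
    intros t Ht. specialize (Hc' t Ht).
    assert (B1 : Q (clamp 0 1 t) b) by (apply Hb; auto; apply clamp_in; lra).
    assert (B0 : Q (clamp 0 1 t0) b).
    { apply Hb; [apply clamp_in; lra|]. rewrite Rminus_diag, Rabs_R0; auto. }
    replace (f t - f t0) with 0; [rewrite Rabs_R0; auto|]. unfold f.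
    do 2 destruct excluded_middle_informative as [?|?]; try lra; exfalso.
    - apply n. assert (b = a) by (apply (Hu (clamp 0 1 t)); auto; apply clamp_in; lra).
      subst; auto.
    - apply n. assert (b = a) by (apply (Hu (clamp 0 1 t0)); auto; apply clamp_in; lra).
      subst; auto. }
  destruct (ivt f 0 1 (/ 2)) as [t [Ht E]]; auto; [lra| |].
  - right. unfold f. rewrite !clamp_id by lra.
    do 2 destruct excluded_middle_informative as [?|?]; try tauto; lra.
  - unfold f in E. destruct excluded_middle_informative; lra.
Qed.

Lemma locally_constant_prop (Q : R -> Prop) :
  (forall t0, 0 <= t0 <= 1 -> exists del, 0 < del /\
     forall t, 0 <= t <= 1 -> Rabs (t - t0) < del -> (Q t <-> Q t0)) ->
  Q 0 -> Q 1.
Proof.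
  intros H H0.
  apply (locally_constant_connected (fun t b => b = true <-> Q t)) with (a := true).
  - intros t [|] [|]; intuition congruence.
  - intros t0 Ht0. destruct (H t0 Ht0) as [d [Hd Hd']].
    destruct (classic (Q t0)) as [Hq|Hq].
    + exists true, d. split; auto. intros t Ht1 Ht2. specialize (Hd' t Ht1 Ht2). tauto.
    + exists false, d. split; auto. intros t Ht1 Ht2. specialize (Hd' t Ht1 Ht2).
      intuition congruence.
  - tauto.
  - reflexivity.
Qed.

(** A Lebesgue number argument: the local radii form a gauge on the interval, and compactness
    provides one size below the radius of some nearby point for every [s]. Such a statement lets [Q]
    carry any further quantifiers, so uniformity in several variables is obtained by nesting. *)
Lemma compact_uniform (a b : R) (Q : R -> R -> Prop) :
  (forall s d d', 0 < d' <= d -> Q s d -> Q s d') ->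
  (forall s, a <= s <= b -> exists rho, 0 < rho /\
     forall s', Rabs (s' - s) < rho -> Q s' rho) ->
  exists del, 0 < del /\ forall s, a <= s <= b -> Q s del.
Proof.
  intros Hm Hl.
  assert (C : forall s, exists rho : posreal, a <= s <= b ->
     forall s', Rabs (s' - s) < rho -> Q s' rho).
  { intros s. destruct (classic (a <= s <= b)) as [Hs|Hs].
    - destruct (Hl s Hs) as [r [Hr H]]. exists (mkposreal r Hr). auto.
    - exists (mkposreal 1 Rlt_0_1). tauto. }
  apply functional_choice in C. destruct C as [del C].
  destruct (compactness_value_1d a b del) as [d Hd].
  exists d. split; [apply cond_pos|]. intros s Hs. apply NNPP. intros Hn.
  apply (Hd s Hs). intros [t [Ht [H1 H2]]]. apply Hn.
  apply Hm with (d := del t); [split; [apply cond_pos|auto]|]. apply C; auto.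
Qed.

Lemma finite_uniform {A : Type} (l : list A) (Q : A -> R -> Prop) :
  (forall a d d', 0 < d' <= d -> Q a d -> Q a d') ->
  (forall a, In a l -> exists d, 0 < d /\ Q a d) ->
  exists d, 0 < d /\ forall a, In a l -> Q a d.
Proof.
  intros Hm. induction l as [|a l IH]; intros H.
  - exists 1; split; [lra|intros ? []].
  - destruct IH as [d [Hd IH]]; [intros; apply H; simpl; auto|].
    destruct (H a) as [d' [Hd' Ha]]; [simpl; auto|].
    exists (Rmin d d'). split; [apply Rmin_glb_lt; auto|].
    assert (0 < Rmin d d') by (apply Rmin_glb_lt; auto).
    intros b [->|Hb].
    + apply Hm with d'; auto. split; auto. apply Rmin_r.
    + apply Hm with d; auto. split; auto. apply Rmin_l.
Qed.

(** * Calculus of smooth functions *)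

Lemma smooth_ex_derive (f : R -> R) (s : R) : smooth f -> ex_derive f s.
Proof. intros H. exact (H 1%nat s). Qed.

Lemma ex_derive_continuity (f : R -> R) : (forall s, ex_derive f s) -> continuity f.
Proof.
  intros H s. apply continuity_pt_filterlim. apply (ex_derive_continuous f s (H s)).
Qed.

Lemma smooth_continuity (f : R -> R) : smooth f -> continuity f.
Proof. intros H. apply ex_derive_continuity. intros s; apply smooth_ex_derive; auto. Qed.

Lemma smooth_Derive (f : R -> R) : smooth f -> smooth (Derive f).
Proof.
  intros H n s. assert (E : forall k u, Derive_n (Derive f) k u = Derive_n f (S k) u).
  { intros k. induction k as [|k IH]; intros u; simpl; auto.
    apply Derive_ext. intros v. apply IH. }
  destruct n as [|n]; simpl; auto.
  apply ex_derive_ext with (f := Derive_n f (S n)); [intros; symmetry; apply E|].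
  exact (H (S (S n)) s).
Qed.

Lemma smooth_comp_affine (f : R -> R) (c d : R) : smooth f -> smooth (fun s => f (c * s + d)).
Proof.
  intros H n. revert f H.
  assert (E : forall k f, smooth f -> forall u,
    Derive_n (fun s => f (c * s + d)) k u = c ^ k * Derive_n f k (c * u + d)).
  { intros k. induction k as [|k IH]; intros f H u; simpl; [ring|].
    rewrite (Derive_ext _ (fun s => c ^ k * Derive_n f k (c * s + d))) by (intros; apply IH; auto).
    rewrite Derive_scal.
    rewrite (Derive_comp (Derive_n f k) (fun s => c * s + d)).
    - replace (Derive (fun s => c * s + d) u) with c; [ring|].
      symmetry. apply is_derive_unique. auto_derive; auto; ring.
    - exact (H (S k) _).
    - auto_derive; auto. }
  intros f H s. destruct n as [|n]; simpl; auto.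
  apply ex_derive_ext with (f := fun s => c ^ n * Derive_n f n (c * s + d)).
  { intros; symmetry; apply E; auto. }
  apply ex_derive_scal. apply (ex_derive_comp (Derive_n f n) (fun s => c * s + d)).
  - exact (H (S n) _).
  - auto_derive; auto.
Qed.

Lemma Derive_comp_affine (f : R -> R) (c d s : R) :
  smooth f -> Derive (fun u => f (c * u + d)) s = c * Derive f (c * s + d).
Proof.
  intros H. rewrite (Derive_comp f (fun s => c * s + d)).
  - f_equal. apply is_derive_unique. auto_derive; auto; ring.
  - apply smooth_ex_derive; auto.
  - auto_derive; auto.
Qed.

Lemma mvt (f : R -> R) (a b : R) :
  (forall s, ex_derive f s) -> a < b ->
  exists c, a < c < b /\ f b - f a = Derive f c * (b - a).
Proof.
  intros H Hab. destruct (MVT_cor2 f (Derive f) a b Hab) as [c [E Hc]].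
  - intros c _. apply is_derive_Reals. apply Derive_correct. auto.
  - exists c; auto.
Qed.

Lemma Derive_eps (f : R -> R) (x : R) :
  ex_derive f x -> forall eps, 0 < eps -> exists del, 0 < del /\
    forall h, Rabs h < del -> Rabs (f (x + h) - f x - Derive f x * h) <= eps * Rabs h.
Proof.
  intros H eps He. apply Derive_correct, is_derive_Reals in H.
  destruct (H eps He) as [d Hd]. exists d. split; [apply cond_pos|].
  intros h Hh. destruct (Req_dec h 0) as [->|Hne].
  - rewrite Rplus_0_r, Rmult_0_r, Rabs_R0.
    replace (f x - f x - 0) with 0 by ring. rewrite Rabs_R0; lra.
  - specialize (Hd h Hne Hh).
    replace (f (x + h) - f x - Derive f x * h)
      with (((f (x + h) - f x) / h - Derive f x) * h) by (field; auto).
    rewrite Rabs_mult. apply Rmult_le_compat_r; [apply Rabs_pos|lra].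
Qed.

(** * Angles in turns *)

Definition tcos (th : R) : R := cos (2 * PI * th).
Definition tsin (th : R) : R := sin (2 * PI * th).

Lemma tcos2_tsin2 (th : R) : tcos th * tcos th + tsin th * tsin th = 1.
Proof. pose proof (sin2_cos2 (2 * PI * th)) as H. unfold Rsqr in H. unfold tcos, tsin. lra. Qed.

Lemma tsin_plus (a b : R) : tsin (a + b) = tsin a * tcos b + tcos a * tsin b.
Proof. unfold tsin, tcos. rewrite Rmult_plus_distr_l. apply sin_plus. Qed.

Lemma tcos_plus (a b : R) : tcos (a + b) = tcos a * tcos b - tsin a * tsin b.
Proof. unfold tsin, tcos. rewrite Rmult_plus_distr_l. apply cos_plus. Qed.

Lemma tsin_opp (a : R) : tsin (- a) = - tsin a.
Proof. unfold tsin. rewrite <- sin_neg. f_equal; ring. Qed.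

Lemma tcos_opp (a : R) : tcos (- a) = tcos a.
Proof. unfold tcos. rewrite <- cos_neg. f_equal; ring. Qed.

Lemma tsin_0 : tsin 0 = 0.
Proof. unfold tsin. rewrite Rmult_0_r. apply sin_0. Qed.

Lemma tcos_half : tcos (/ 2) = -1.
Proof. unfold tcos. replace (2 * PI * / 2) with PI by field. apply cos_PI. Qed.

Lemma tsin_half : tsin (/ 2) = 0.
Proof. unfold tsin. replace (2 * PI * / 2) with PI by field. apply sin_PI. Qed.

Lemma tsin_pos (a : R) : 0 < a < / 2 -> 0 < tsin a.
Proof.
  intros H. pose proof PI_RGT_0. unfold tsin. apply sin_gt_0; nra.
Qed.

Lemma tsin_IZR (k : Z) : tsin (IZR k) = 0.
Proof.
  unfold tsin. apply sin_eq_0_1. exists (2 * k)%Z. rewrite mult_IZR. ring.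
Qed.

Lemma tcos_IZR (k : Z) : tcos (IZR k) = 1.
Proof.
  unfold tcos. replace (2 * PI * IZR k) with (2 * (PI * IZR k)) by ring.
  rewrite cos_2a_sin.
  replace (sin (PI * IZR k)) with 0; [ring|].
  symmetry. apply sin_eq_0_1. exists k. ring.
Qed.

Lemma tcos_1_integer (a : R) : tcos a = 1 -> exists k : Z, a = IZR k.
Proof.
  unfold tcos. replace (2 * PI * a) with (2 * (PI * a)) by ring.
  rewrite cos_2a_sin. intros H. assert (E : sin (PI * a) = 0) by nra.
  destruct (sin_eq_0_0 _ E) as [k Hk]. exists k. pose proof PI_RGT_0. nra.
Qed.

Lemma tcos_continuity : continuity tcos.
Proof.
  apply (continuity_comp_fun cos (fun x => 2 * PI * x)); [apply continuity_cos|].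
  apply continuity_scal. exact (derivable_continuous _ derivable_id).
Qed.

Lemma tsin_continuity : continuity tsin.
Proof.
  apply (continuity_comp_fun sin (fun x => 2 * PI * x)); [apply continuity_sin|].
  apply continuity_scal. exact (derivable_continuous _ derivable_id).
Qed.

(* [ang X Y th] : the vector (X, Y) is a positive multiple of
   (cos (2 pi th), sin (2 pi th)). *)
Definition ang (X Y th : R) : Prop :=
  X * tsin th = Y * tcos th /\ 0 < X * tcos th + Y * tsin th.

Lemma ang_polar (X Y th : R) :
  ang X Y th -> exists r, 0 < r /\ X = r * tcos th /\ Y = r * tsin th.
Proof.
  intros [H1 H2]. exists (X * tcos th + Y * tsin th).
  pose proof (tcos2_tsin2 th) as E. split; [|split]; auto.
  - replace ((X * tcos th + Y * tsin th) * tcos th)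
      with (X * (tcos th * tcos th) + (Y * tcos th) * tsin th) by ring.
    rewrite <- H1. replace X with (X * 1) at 1 by ring. rewrite <- E. ring.
  - replace ((X * tcos th + Y * tsin th) * tsin th)
      with ((X * tsin th) * tcos th + Y * (tsin th * tsin th)) by ring.
    rewrite H1. replace Y with (Y * 1) at 1 by ring. rewrite <- E. ring.
Qed.

Lemma polar_ang (r th : R) : 0 < r -> ang (r * tcos th) (r * tsin th) th.
Proof. intros H. pose proof (tcos2_tsin2 th). split; nra. Qed.

Lemma ang_unique (X Y a b : R) : ang X Y a -> ang X Y b -> exists k : Z, b - a = IZR k.
Proof.
  intros Ha Hb. apply ang_polar in Ha, Hb.
  destruct Ha as [r [Hr [-> ->]]]. destruct Hb as [r' [Hr' [H1 H2]]].
  apply tcos_1_integer. replace (b - a) with (b + - a) by ring.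
  rewrite tcos_plus, tcos_opp, tsin_opp.
  pose proof (tcos2_tsin2 a). pose proof (tcos2_tsin2 b).
  assert (Er : r * r = r' * r').
  { replace (r * r) with (r * r * 1) by ring. replace (r' * r') with (r' * r' * 1) by ring.
    rewrite <- H at 1. rewrite <- H0.
    transitivity ((r * tcos a) * (r * tcos a) + (r * tsin a) * (r * tsin a)); [ring|].
    rewrite H1, H2. ring. }
  assert (r = r') by nra. subst r'.
  apply Rmult_eq_reg_l in H1; [|lra]. apply Rmult_eq_reg_l in H2; [|lra].
  rewrite <- H1, <- H2. lra.
Qed.

Lemma ang_opp (X Y th : R) : ang X Y th -> ang (- X) (- Y) (th + / 2).
Proof.
  intros [H1 H2]. unfold ang. rewrite tsin_plus, tcos_plus, tcos_half, tsin_half. split; nra.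
Qed.

(** This reflection in the vertical axis is how velocities change both under the symmetry of an arc
    about its midpoint and under the rotation of the front plane. *)
Lemma ang_reflect (X Y th : R) : ang X Y th -> ang (- X) Y (/ 2 - th).
Proof.
  intros [H1 H2]. unfold ang. unfold Rminus.
  rewrite tsin_plus, tcos_plus, tcos_half, tsin_half, tsin_opp, tcos_opp. split; nra.
Qed.

Lemma ang_exists (X Y : R) : X * X + Y * Y <> 0 -> exists th, ang X Y th.
Proof.
  intros Hn. assert (Hp : 0 < X * X + Y * Y) by nra.
  set (r := sqrt (X * X + Y * Y)). assert (Hr : 0 < r) by (apply sqrt_lt_R0; auto).
  assert (Hrr : r * r = X * X + Y * Y) by (apply sqrt_sqrt; lra).
  pose proof PI_RGT_0 as Hpi.
  set (c := X / r). assert (Hc : X = r * c) by (unfold c; field; lra).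
  assert (Hc2 : c * c <= 1) by (apply Rmult_le_reg_l with (r * r); nra).
  assert (Hc1 : -1 <= c <= 1) by nra.
  assert (Hs : sqrt (1 - c²) * sqrt (1 - c²) = 1 - c * c).
  { replace (1 - c * c) with (1 - c²) by (unfold Rsqr; ring). apply sqrt_sqrt.
    unfold Rsqr; nra. }
  pose proof (sqrt_pos (1 - c²)) as Hs0. set (s := sqrt (1 - c²)) in *.
  assert (HY : Y * Y = (r * s) * (r * s)) by nra.
  assert (E : tcos (acos c / (2 * PI)) = c /\ tsin (acos c / (2 * PI)) = s).
  { unfold tcos, tsin.
    replace (2 * PI * (acos c / (2 * PI))) with (acos c) by (field; lra).
    split; [apply cos_acos; auto|apply sin_acos; auto]. }
  destruct E as [E1 E2].
  destruct (Rle_dec 0 Y) as [HY0|HY0].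
  - exists (acos c / (2 * PI)).
    replace X with (r * tcos (acos c / (2 * PI))) by (rewrite E1; auto).
    replace Y with (r * tsin (acos c / (2 * PI))) by (rewrite E2; apply Rsqr_inj; unfold Rsqr; nra).
    apply polar_ang; auto.
  - exists (- (acos c / (2 * PI))).
    replace X with (r * tcos (- (acos c / (2 * PI)))) by (rewrite tcos_opp, E1; auto).
    replace Y with (r * tsin (- (acos c / (2 * PI)))) by (rewrite tsin_opp, E2; apply Ropp_eq_reg; apply Rsqr_inj; unfold Rsqr; nra).
    apply polar_ang; auto.
Qed.

(** Vanishing cross product and positive dot product characterize positive multiples, in a form that
    passes to limits of velocities. *)
Lemma ang_eq_of_cross (X Y X' Y' th : R) :
  ang X Y th -> X * Y' = Y * X' -> 0 < X * X' + Y * Y' -> ang X' Y' th.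
Proof.
  intros Ha H1 H2. apply ang_polar in Ha. destruct Ha as [r [Hr [-> ->]]].
  pose proof (tcos2_tsin2 th). split.
  - apply Rmult_eq_reg_l with r; lra.
  - apply Rmult_lt_reg_l with r; lra.
Qed.

(** * Closed curves in space *)

Definition near (d : R) (P Q : R3) : Prop :=
  Rabs (px P - px Q) < d /\ Rabs (py P - py Q) < d /\ Rabs (pz P - pz Q) < d.

Lemma R3_ext (P Q : R3) : px P = px Q -> py P = py Q -> pz P = pz Q -> P = Q.
Proof.
  destruct P as [[a b] c], Q as [[a' b'] c']. unfold px, py, pz. simpl. congruence.
Qed.

Lemma near_sym (d : R) (P Q : R3) : near d P Q -> near d Q P.
Proof. unfold near. rewrite (Rabs_minus_sym (px P)), (Rabs_minus_sym (py P)), (Rabs_minus_sym (pz P)). auto. Qed.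

Lemma near_trans (d e : R) (P Q S : R3) : near d P Q -> near e Q S -> near (d + e) P S.
Proof.
  unfold near. intros (H1 & H2 & H3) (H4 & H5 & H6).
  repeat split;
  match goal with |- Rabs (?f P - ?f S) < _ =>
    replace (f P - f S) with ((f P - f Q) + (f Q - f S)) by ring end;
  eapply Rle_lt_trans; try apply Rabs_triang; lra.
Qed.

Lemma near_weaken (d e : R) (P Q : R3) : d <= e -> near d P Q -> near e P Q.
Proof. unfold near. intros. lra. Qed.

Lemma near_separate (P Q : R3) : P <> Q -> exists d, 0 < d /\ ~ near d P Q.
Proof.
  intros H.
  destruct (Req_dec (px P) (px Q)) as [E1|E1].
  - destruct (Req_dec (py P) (py Q)) as [E2|E2].
    + destruct (Req_dec (pz P) (pz Q)) as [E3|E3].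
      * destruct H. apply R3_ext; auto.
      * exists (Rabs (pz P - pz Q)). split; [apply Rabs_pos_lt; lra|]. unfold near; lra.
    + exists (Rabs (py P - py Q)). split; [apply Rabs_pos_lt; lra|]. unfold near; lra.
  - exists (Rabs (px P - px Q)). split; [apply Rabs_pos_lt; lra|]. unfold near; lra.
Qed.

Definition cont3 (c : R -> R3) : Prop :=
  continuity (fun s => px (c s)) /\ continuity (fun s => py (c s)) /\
  continuity (fun s => pz (c s)).

Lemma cont3_near (c : R -> R3) (t eps : R) :
  cont3 c -> 0 < eps -> exists d, 0 < d /\ forall u, Rabs (u - t) < d -> near eps (c u) (c t).
Proof.
  intros (H1 & H2 & H3) He.
  specialize (H1 t); specialize (H2 t); specialize (H3 t).
  rewrite continuity_pt_eps in H1, H2, H3.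
  destruct (H1 eps He) as [d1 [D1 K1]]. destruct (H2 eps He) as [d2 [D2 K2]].
  destruct (H3 eps He) as [d3 [D3 K3]].
  exists (Rmin d1 (Rmin d2 d3)). split; [repeat apply Rmin_glb_lt; auto|].
  intros u Hu. pose proof (Rmin_l d1 (Rmin d2 d3)). pose proof (Rmin_r d1 (Rmin d2 d3)).
  pose proof (Rmin_l d2 d3). pose proof (Rmin_r d2 d3).
  repeat split; [apply K1|apply K2|apply K3]; lra.
Qed.

Lemma cont3_comp (c : R -> R3) (f : R -> R) :
  cont3 c -> continuity f -> cont3 (fun s => c (f s)).
Proof.
  intros (H1 & H2 & H3) Hf. repeat split.
  - apply (continuity_comp_fun (fun s => px (c s))); auto.
  - apply (continuity_comp_fun (fun s => py (c s))); auto.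
  - apply (continuity_comp_fun (fun s => pz (c s))); auto.
Qed.

Lemma smooth_curve_cont3 (c : R -> R3) : smooth_curve c -> cont3 c.
Proof. intros (H1 & H2 & H3). repeat split; apply smooth_continuity; auto. Qed.

(** Only the topological part of [embedded_circle] is kept, so that path lifting applies both to
    link components and to the unit circle of directions. *)
Definition closed_embedding (b : R -> R3) : Prop :=
  cont3 b /\ (forall s, b (s + 1) = b s) /\
  (forall s t, b s = b t -> exists k : Z, t = s + IZR k).

Lemma periodic_nat (b : R -> R3) (s : R) (n : nat) :
  (forall s, b (s + 1) = b s) -> b (s + INR n) = b s.
Proof.
  intros H. induction n as [|n IH].
  - simpl. rewrite Rplus_0_r; auto.
  - rewrite S_INR, <- Rplus_assoc, H; auto.
Qed.

Lemma periodic_Z (b : R -> R3) (s : R) (k : Z) :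
  (forall s, b (s + 1) = b s) -> b (s + IZR k) = b s.
Proof.
  intros H. destruct (Z_le_dec 0 k) as [Hk|Hk].
  - rewrite <- (Z2Nat.id k Hk), <- INR_IZR_INZ. apply periodic_nat; auto.
  - rewrite <- (periodic_nat b (s + IZR k) (Z.to_nat (- k)) H).
    f_equal. rewrite INR_IZR_INZ, Z2Nat.id by lia. rewrite opp_IZR. ring.
Qed.

Lemma unit_interval_shift (u : R) : exists k : Z, 0 <= u + IZR k < 1.
Proof.
  exists (- Int_part u)%Z. rewrite opp_IZR. pose proof (base_Int_part u). lra.
Qed.

Lemma small_integer (k : Z) : Rabs (IZR k) < 1 -> k = 0%Z.
Proof.
  intros H. apply Rabs_def2 in H. destruct H as [H1 H2].
  apply lt_IZR in H1. assert (H3 : IZR (-1) < IZR k) by (simpl; lra).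
  apply lt_IZR in H3. lia.
Qed.

Lemma embedding_locally_injective (b : R -> R3) (s t : R) :
  closed_embedding b -> b s = b t -> Rabs (t - s) < 1 -> s = t.
Proof.
  intros (_ & _ & H) E Hd. destruct (H s t E) as [k ->].
  replace (s + IZR k - s) with (IZR k) in Hd by ring.
  rewrite (small_integer k Hd). lra.
Qed.

(* Near the curve [b], the set [L] consists of [b] only. *)
Definition isolated (L : R3 -> Prop) (b : R -> R3) : Prop :=
  (forall s, L (b s)) /\
  forall eps, 0 < eps -> exists d, 0 < d /\
    forall s P, L P -> near d P (b s) -> exists u, Rabs (u - s) < eps /\ b u = P.

(** Compactness is applied to pairs of parameters. At a pair with the same image the component is
    the same and the parameters differ by an integer, by which the second one is shifted; at any
    other pair the two images stay apart nearby. *)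
Lemma component_isolated (n : nat) (g : nat -> R -> R3) (L : R3 -> Prop) (i : nat) :
  (forall j, (j < n)%nat -> closed_embedding (g j)) ->
  (forall j k s t, (j < n)%nat -> (k < n)%nat -> j <> k -> g j s <> g k t) ->
  (forall P, L P <-> exists j, (j < n)%nat /\ on_curve (g j) P) ->
  (i < n)%nat -> isolated L (g i).
Proof.
  intros Hg Hd HL Hi. split.
  { intros s. apply HL. exists i. split; auto. exists s; auto. }
  intros eps He.
  assert (C : exists d, 0 < d /\ forall s, 0 <= s <= 1 -> forall j, In j (seq 0 n) ->
    forall u, 0 <= u <= 1 -> near d (g j u) (g i s) ->
    exists v, Rabs (v - s) < eps /\ g i v = g j u).
  { apply (compact_uniform 0 1 (fun s d => forall j, In j (seq 0 n) ->
      forall u, 0 <= u <= 1 -> near d (g j u) (g i s) ->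
      exists v, Rabs (v - s) < eps /\ g i v = g j u)).
    { intros s d d' Hdd H j Hj u Hu Hn. apply H; auto. apply near_weaken with d'; auto; lra. }
    intros s0 Hs0.
    destruct (finite_uniform (seq 0 n) (fun j d => forall s', Rabs (s' - s0) < d ->
      forall u, 0 <= u <= 1 -> near d (g j u) (g i s') ->
      exists v, Rabs (v - s') < eps /\ g i v = g j u)) as [d [Hd0 H]].
    { intros j d d' Hdd H s' Hs' u Hu Hn. apply H; auto; [lra|].
      apply near_weaken with d'; auto; lra. }
    2:{ exists d. split; [auto|]. intros s' Hs' j Hj. apply (H j Hj s' Hs'). }
    intros j Hj. apply in_seq in Hj. assert (Hjn : (j < n)%nat) by lia. clear Hj.
    destruct (compact_uniform 0 1 (fun u d => forall s', Rabs (s' - s0) < d ->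
      near d (g j u) (g i s') ->
      exists v, Rabs (v - s') < eps /\ g i v = g j u)) as [d [Hd0 H]].
    { intros u d d' Hdd H s' Hs' Hn. apply H; auto; [lra|].
      apply near_weaken with d'; auto; lra. }
    2:{ exists d. split; [auto|]. intros s' Hs' u Hu. apply (H u Hu s' Hs'). }
    intros u0 Hu0. destruct (classic (g i s0 = g j u0)) as [E|E].
    - assert (j = i).
      { apply NNPP. intros Hne. apply (Hd i j s0 u0); auto. }
      subst j. destruct (Hg i Hi) as (_ & Hper & Hinj).
      destruct (Hinj _ _ E) as [k Hk].
      exists (eps / 2). split; [lra|]. intros u Hu s' Hs' _.
      exists (u + IZR (- k)). split; [|apply periodic_Z; auto].
      rewrite opp_IZR. apply Rabs_def2 in Hu, Hs'. apply Rabs_def1; lra.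
    - destruct (near_separate _ _ E) as [d [Hd0 Hn]].
      destruct (Hg i Hi) as (Ci & _). destruct (Hg j Hjn) as (Cj & _).
      destruct (cont3_near (g i) s0 (d / 3) Ci) as [d1 [D1 K1]]; [lra|].
      destruct (cont3_near (g j) u0 (d / 3) Cj) as [d2 [D2 K2]]; [lra|].
      exists (Rmin (d / 3) (Rmin d1 d2)).
      pose proof (Rmin_l (d / 3) (Rmin d1 d2)). pose proof (Rmin_r (d / 3) (Rmin d1 d2)).
      pose proof (Rmin_l d1 d2). pose proof (Rmin_r d1 d2).
      split; [repeat apply Rmin_glb_lt; lra|].
      intros u Hu s' Hs' Hnear. exfalso. apply Hn. apply near_sym.
      replace d with (d / 3 + (d / 3 + d / 3)) by field.
      apply near_trans with (g j u); [apply near_sym, K2; lra|].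
      apply near_trans with (g i s'); [|apply K1; lra].
      apply near_weaken with (2 := Hnear); lra. }
  destruct C as [d [Hd0 C]]. exists d. split; auto.
  intros s P HP Hn. apply HL in HP. destruct HP as [j [Hj [u Hu]]]. subst P.
  destruct (unit_interval_shift s) as [k Hk]. destruct (unit_interval_shift u) as [m Hm].
  destruct (Hg i Hi) as (_ & Hpi & _). destruct (Hg j Hj) as (_ & Hpj & _).
  destruct (C (s + IZR k)) with (j := j) (u := u + IZR m) as [v [Hv1 Hv2]];
    [lra|apply in_seq; lia|lra|rewrite !periodic_Z by auto; auto|].
  exists (v + IZR (- k)). rewrite periodic_Z by auto. rewrite Hv2, periodic_Z by auto.
  split; auto. rewrite opp_IZR. replace (v + - IZR k - s) with (v - (s + IZR k)) by ring; auto.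
Qed.

Lemma curve_isolated (b : R -> R3) : closed_embedding b -> isolated (on_curve b) b.
Proof.
  intros H. apply (component_isolated 1 (fun _ => b) _ 0); auto.
  - intros j k s t Hj Hk Hne. lia.
  - intros P. split; [intros HP; exists 0%nat; auto|]. intros [_ [_ HP]]; auto.
Qed.

(* On a short time interval, the lift is the parameter closest to the initial one. *)
Lemma lift_short (L : R3 -> Prop) (b c : R -> R3) (m m' d s0 : R) :
  closed_embedding b -> isolated L b -> cont3 c -> m <= m' -> 0 < d ->
  (forall s P, L P -> near d P (b s) -> exists u, Rabs (u - s) < / 4 /\ b u = P) ->
  (forall t, m <= t <= m' -> L (c t) /\ near d (c t) (c m)) ->
  b s0 = c m ->
  exists f, continuity f /\ f m = s0 /\ forall t, m <= t <= m' -> b (f t) = c t.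
Proof.
  intros Hb HI Hc Hm Hd0 Hd Hn E0.
  assert (C : forall t, exists u, Rabs (u - s0) < / 4 /\ b u = c (clamp m m' t)).
  { intros t. destruct (Hn (clamp m m' t)) as [H1 H2]; [apply clamp_in; auto|].
    apply Hd; auto. rewrite E0; auto. }
  apply functional_choice in C. destruct C as [f Hf].
  exists f. split; [|split].
  - intros t. apply continuity_pt_eps. intros eps He.
    destruct HI as [_ HI].
    (* Three parameter distances below 1/4 add up to less than the period, so the parameter found
       near [f t] must be [f y]. *)
    destruct (HI (Rmin eps (/ 4))) as [d' [Hd' HI']]; [apply Rmin_glb_lt; lra|].
    destruct (cont3_near (fun t => c (clamp m m' t)) t d') as [e [He' K]]; auto.
    { apply cont3_comp; auto. apply clamp_continuity. }
    exists e. split; auto. intros y Hy. specialize (K y Hy).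
    destruct (HI' (f t) (c (clamp m m' y))) as [u [Hu1 Hu2]].
    { apply Hn. apply clamp_in; auto. }
    { rewrite (proj2 (Hf t)). auto. }
    pose proof (Rmin_l eps (/ 4)). pose proof (Rmin_r eps (/ 4)).
    assert (u = f y); [|subst u; lra].
    apply (embedding_locally_injective b); auto.
    + rewrite Hu2. symmetry. apply Hf.
    + destruct (Hf y) as [F1 _]. destruct (Hf t) as [F2 _].
      assert (Hu3 : Rabs (u - f t) < / 4) by lra.
      apply Rabs_def2 in F1, F2, Hu3. apply Rabs_def1; lra.
  - destruct (Hf m) as [F1 F2]. rewrite clamp_id in F2 by lra.
    symmetry. apply (embedding_locally_injective b); auto; [congruence|lra].
  - intros t Ht. destruct (Hf t) as [_ F2]. rewrite clamp_id in F2; auto.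
Qed.

Lemma continuity_glue (f g : R -> R) (m : R) :
  continuity f -> continuity g -> f m = g m ->
  exists h, continuity h /\ (forall t, t <= m -> h t = f t) /\ (forall t, m <= t -> h t = g t).
Proof.
  intros Hf Hg E. exists (fun t => f (Rmin t m) + g (Rmax t m) - f m). split; [|split].
  - apply continuity_minus with (f1 := fun t => f (Rmin t m) + g (Rmax t m)) (f2 := fun _ => f m).
    + apply continuity_plus with (f1 := fun t => f (Rmin t m)) (f2 := fun t => g (Rmax t m));
        apply continuity_comp_fun; auto;
        apply lipschitz_continuity; intros x y; unfold Rmax, Rmin;
        repeat destruct Rle_dec; unfold Rabs; repeat destruct Rcase_abs; lra.
    + intros x. apply continuity_pt_const. intros u v; auto.
  - intros t Ht. rewrite Rmin_left, Rmax_right by auto. rewrite <- E. ring.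
  - intros t Ht. rewrite Rmin_right, Rmax_left by auto. ring.
Qed.

(** Since [b] is isolated in [L], a path in [L] that starts on [b] cannot leave it. The lift is
    glued from short ones, with steps of half the scale on which [c] moves less than the isolation
    distance. *)
Lemma curve_lift (L : R3 -> Prop) (b c : R -> R3) (p q s0 : R) :
  closed_embedding b -> isolated L b -> cont3 c -> p <= q ->
  (forall t, p <= t <= q -> L (c t)) -> b s0 = c p ->
  exists f, continuity f /\ f p = s0 /\ forall t, p <= t <= q -> b (f t) = c t.
Proof.
  intros Hb HI Hc Hpq HL E0.
  destruct (proj2 HI (/ 4)) as [d [Hd0 Hd]]; [lra|].
  assert (U : exists eta, 0 < eta /\ forall t u, p <= t <= q -> p <= u <= q ->
    Rabs (t - u) < eta -> near d (c t) (c u)).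
  { destruct Hc as (C1 & C2 & C3).
    destruct (@Heine_cor2 (fun t => px (c t)) p q (fun x _ => C1 x) (mkposreal d Hd0)) as [e1 K1].
    destruct (@Heine_cor2 (fun t => py (c t)) p q (fun x _ => C2 x) (mkposreal d Hd0)) as [e2 K2].
    destruct (@Heine_cor2 (fun t => pz (c t)) p q (fun x _ => C3 x) (mkposreal d Hd0)) as [e3 K3].
    exists (Rmin e1 (Rmin e2 e3)).
    pose proof (Rmin_l e1 (Rmin e2 e3)). pose proof (Rmin_r e1 (Rmin e2 e3)).
    pose proof (Rmin_l e2 e3). pose proof (Rmin_r e2 e3).
    split; [repeat apply Rmin_glb_lt; apply cond_pos|].
    intros t u Ht Hu Htu. simpl in *. repeat split; [apply K1|apply K2|apply K3]; auto; lra. }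
  destruct U as [eta [Heta U]].
  assert (St : forall n, exists f, continuity f /\ f p = s0 /\
    forall t, p <= t <= Rmin q (p + INR n * (eta / 2)) -> b (f t) = c t).
  { induction n as [|n [f [F1 [F2 F3]]]].
    - exists (fun _ => s0). split; [|split]; auto.
      + intros x. apply continuity_pt_const. intros u v; auto.
      + intros t Ht. simpl in Ht. replace t with p; auto.
        pose proof (Rmin_r q (p + 0 * (eta / 2))). lra.
    - pose proof (pos_INR n) as Hn. set (m := Rmin q (p + INR n * (eta / 2))) in *.
      assert (Hpm : p <= m) by (apply Rmin_glb; nra).
      assert (Hmq : m <= q) by apply Rmin_l.
      set (m' := Rmin q (p + INR (S n) * (eta / 2))).
      assert (Hm1 : m <= m').
      { unfold m, m'. rewrite S_INR. apply Rmin_glb; [apply Rmin_l|].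
        eapply Rle_trans; [apply Rmin_r|nra]. }
      assert (Hm2 : m' - m < eta).
      { unfold m, m'. rewrite S_INR. unfold Rmin. repeat destruct Rle_dec; nra. }
      assert (Hmq' : m' <= q) by apply Rmin_l.
      destruct (lift_short L b c m m' d (f m)) as [g [G1 [G2 G3]]]; auto.
      { intros t Ht. split; [apply HL; lra|]. apply U; try lra. apply Rabs_def1; lra. }
      { apply F3. split; auto. apply Rle_refl. }
      destruct (continuity_glue f g m) as [h [H1 [H2 H3]]]; auto.
      exists h. split; [|split]; auto.
      { rewrite H2; auto. }
      intros t Ht. destruct (Rle_dec t m).
      + rewrite H2 by auto. apply F3. lra.
      + rewrite H3 by lra. apply G3. lra. }
  destruct (INR_unbounded ((q - p) / (eta / 2))) as [n Hn].
  destruct (St n) as [f [F1 [F2 F3]]]. exists f. split; [|split]; auto.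
  intros t Ht. apply F3. split; [lra|]. apply Rmin_glb; [lra|].
  assert (q - p = (q - p) / (eta / 2) * (eta / 2)) by (field; lra). nra.
Qed.

Lemma curve_lift_from (L : R3 -> Prop) (b c : R -> R3) (p q t0 s0 : R) :
  closed_embedding b -> isolated L b -> cont3 c -> p <= t0 <= q ->
  (forall t, p <= t <= q -> L (c t)) -> b s0 = c t0 ->
  exists f, continuity f /\ f t0 = s0 /\ forall t, p <= t <= q -> b (f t) = c t.
Proof.
  intros Hb HI Hc Ht0 HL E0.
  destruct (curve_lift L b c t0 q s0) as [f [F1 [F2 F3]]]; auto; [lra|intros; apply HL; lra|].
  destruct (curve_lift L b (fun t => c (-1 * t + 0)) (- t0) (- p) s0) as [g [G1 [G2 G3]]]; auto.
  - apply (cont3_comp c (fun t => -1 * t + 0)); auto. apply continuity_affine.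
  - lra.
  - intros t Ht. apply HL; lra.
  - rewrite E0. f_equal. ring.
  - destruct (continuity_glue (fun t => g (-1 * t + 0)) f t0) as [h [H1 [H2 H3]]]; auto.
    { apply (continuity_comp_fun g); auto. apply continuity_affine. }
    { replace (-1 * t0 + 0) with (- t0) by ring. congruence. }
    exists h. split; [|split]; auto; [rewrite H3; auto; lra|].
    intros t Ht. destruct (Rle_dec t t0).
    + rewrite H2 by auto. rewrite G3 by lra. f_equal. ring.
    + rewrite H3 by lra. apply F3. lra.
Qed.

(** Placing the circle of directions in space makes the lifting of angles an instance of
    [curve_lift]. *)
Definition unit_circle (th : R) : R3 := (tcos th, tsin th, 0).

Lemma unit_circle_embedding : closed_embedding unit_circle.
Proof.
  split; [|split].
  - repeat split; unfold unit_circle, px, py, pz; simpl.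
    + apply tcos_continuity.
    + apply tsin_continuity.
    + intros x. apply continuity_pt_const. intros u v; auto.
  - intros s. unfold unit_circle. rewrite tcos_plus, tsin_plus.
    rewrite (tcos_IZR 1), (tsin_IZR 1). apply R3_ext; unfold px, py, pz; simpl; ring.
  - intros s t E. unfold unit_circle in E. injection E as E1 E2.
    destruct (tcos_1_integer (t - s)) as [k Hk]; [|exists k; lra].
    unfold Rminus. rewrite tcos_plus, tcos_opp, tsin_opp, E1, E2.
    pose proof (tcos2_tsin2 t). lra.
Qed.

Lemma angle_lift (X Y : R -> R) (p q : R) :
  continuity X -> continuity Y -> p <= q ->
  (forall t, p <= t <= q -> X t * X t + Y t * Y t <> 0) ->
  exists th, continuity th /\ forall t, p <= t <= q -> ang (X t) (Y t) (th t).
Proof.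
  intros HX HY Hpq Hn.
  (* Clamping keeps the vector nonzero for all times, so that its normalization is continuous on the
     whole line. *)
  set (X' := fun t => X (clamp p q t)). set (Y' := fun t => Y (clamp p q t)).
  assert (CX : continuity X') by exact (continuity_comp_fun X _ HX (clamp_continuity p q)).
  assert (CY : continuity Y') by exact (continuity_comp_fun Y _ HY (clamp_continuity p q)).
  assert (Hn' : forall t, 0 < X' t * X' t + Y' t * Y' t).
  { intros t. specialize (Hn (clamp p q t) (clamp_in p q t Hpq)).
    unfold X', Y'. nra. }
  set (r := fun t => sqrt (X' t * X' t + Y' t * Y' t)).
  assert (Hr : forall t, 0 < r t) by (intros; apply sqrt_lt_R0; auto).
  assert (Hrr : forall t, r t * r t = X' t * X' t + Y' t * Y' t).
  { intros. apply sqrt_sqrt. apply Rlt_le; auto. }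
  assert (Cr : continuity r).
  { intros t. apply (continuity_pt_comp (fun t => X' t * X' t + Y' t * Y' t) sqrt).
    - apply continuity_pt_plus; apply continuity_pt_mult; auto.
    - apply continuity_pt_sqrt. apply Rlt_le; auto. }
  assert (Cd : forall f, continuity f -> continuity (fun t => f t / r t)).
  { intros f Hf t. apply continuity_pt_div; auto. apply Rgt_not_eq, Hr. }
  set (c := fun t => (X' t / r t, Y' t / r t, 0) : R3).
  assert (HA : forall t th, unit_circle th = c t -> ang (X' t) (Y' t) th).
  { intros t th E. injection E as E1 E2. specialize (Hr t).
    replace (X' t) with (r t * tcos th) by (rewrite E1; field; lra).
    replace (Y' t) with (r t * tsin th) by (rewrite E2; field; lra).
    apply polar_ang; auto. }
  assert (HL : forall t, on_curve unit_circle (c t)).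
  { intros t. destruct (ang_exists (X' t) (Y' t)) as [th Hth]; [apply Rgt_not_eq, Hn'|].
    exists th. apply ang_polar in Hth. destruct Hth as [l [Hl [E1 E2]]].
    assert (r t = l).
    { pose proof (Hrr t) as H. rewrite E1, E2 in H. pose proof (tcos2_tsin2 th).
      specialize (Hr t). apply Rsqr_inj; [lra|lra|]. unfold Rsqr. rewrite H.
      transitivity (l * l * (tcos th * tcos th + tsin th * tsin th)); [ring|].
      rewrite H0. ring. }
    unfold unit_circle, c. rewrite E1, E2, H.
    apply R3_ext; unfold px, py, pz; simpl; field; lra. }
  destruct (HL p) as [s0 E0].
  destruct (curve_lift (on_curve unit_circle) unit_circle c p q s0) as [th [T1 [_ T3]]]; auto.
  - apply unit_circle_embedding.
  - apply curve_isolated, unit_circle_embedding.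
  - repeat split; unfold c, px, py, pz; simpl; try (apply Cd; auto).
    intros x. apply continuity_pt_const. intros u v; auto.
  - exists th. split; auto. intros t Ht.
    specialize (HA t (th t) (T3 t Ht)). unfold X', Y' in HA. rewrite clamp_id in HA; auto.
Qed.

(** Two lifts differ by a continuous integer-valued function, which is constant. *)
Lemma angle_lift_unique (X Y th th' : R -> R) (p q : R) :
  continuity th -> continuity th' -> p <= q ->
  (forall t, p <= t <= q -> ang (X t) (Y t) (th t)) ->
  (forall t, p <= t <= q -> ang (X t) (Y t) (th' t)) ->
  th q - th p = th' q - th' p.
Proof.
  intros C C' Hpq H H'.
  assert (E : th' p - th p = th' q - th q).
  { apply (integer_valued_constant (fun t => th' t - th t)); auto.
    - apply continuity_minus with (f1 := th') (f2 := th); auto.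
    - intros t Ht. apply (ang_unique (X t) (Y t)); auto. }
  lra.
Qed.

(** * Rotation numbers of Legendrian curves *)

Notation dx b := (Derive (fun u => px (b u))).
Notation dy b := (Derive (fun u => py (b u))).
Notation dz b := (Derive (fun u => pz (b u))).

Lemma dx_continuity (b : R -> R3) : smooth_curve b -> continuity (dx b).
Proof. intros (H & _). apply smooth_continuity, smooth_Derive; auto. Qed.

Lemma dy_continuity (b : R -> R3) : smooth_curve b -> continuity (dy b).
Proof. intros (_ & H & _). apply smooth_continuity, smooth_Derive; auto. Qed.

Lemma legendrian_velocity (b : R -> R3) (s : R) :
  immersed_at b s -> legendrian_at b s -> 0 < dx b s * dx b s + dy b s * dy b s.
Proof.
  intros Hi Hl. apply Rnot_le_lt. intros H.
  assert (E1 : dx b s = 0) by nra. assert (E2 : dy b s = 0) by nra.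
  apply Hi. split; [auto|split; auto]. unfold legendrian_at in Hl.
  rewrite Hl, E1. ring.
Qed.

Lemma embedded_circle_embedding (b : R -> R3) : embedded_circle b -> closed_embedding b.
Proof. intros (H1 & H2 & _ & H4). split; [|split]; auto. apply smooth_curve_cont3; auto. Qed.

(** Isolation in [L] records that [b] is an entire component near itself; it is what makes two loops
    through the same point comparable. *)
Definition loop (L : R3 -> Prop) (b : R -> R3) : Prop :=
  embedded_circle b /\ (forall s, legendrian_at b s) /\ isolated L b.

(** Every starting parameter and every lift is allowed, so that the number can be evaluated on the
    period best suited to an arc. *)
Definition is_rot (b : R -> R3) (k : Z) : Prop :=
  forall s th, continuity th ->
    (forall u, s <= u <= s + 1 -> ang (dx b u) (dy b u) (th u)) ->
    th (s + 1) - th s = IZR k.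

Lemma Derive_shift (f : R -> R) (s : R) :
  (forall u, f (u + 1) = f u) -> smooth f -> Derive f (s + 1) = Derive f s.
Proof.
  intros H Hs. replace (s + 1) with (1 * s + 1) by ring.
  transitivity (1 * Derive f (1 * s + 1)); [ring|].
  rewrite <- Derive_comp_affine by auto. apply Derive_ext. intros t.
  rewrite Rmult_1_l; auto.
Qed.

Lemma velocity_periodic (b : R -> R3) (s : R) :
  embedded_circle b -> dx b (s + 1) = dx b s /\ dy b (s + 1) = dy b s.
Proof.
  intros ((H1 & H2 & _) & Hp & _).
  split; [apply (Derive_shift (fun u => px (b u)))|apply (Derive_shift (fun u => py (b u)))];
    auto; intros u; rewrite Hp; auto.
Qed.

Lemma velocity_lift (b : R -> R3) (p q : R) :
  embedded_circle b -> (forall s, legendrian_at b s) -> p <= q ->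
  exists th, continuity th /\ forall t, p <= t <= q -> ang (dx b t) (dy b t) (th t).
Proof.
  intros (H1 & _ & H3 & _) Hl Hpq. apply angle_lift; auto.
  - apply dx_continuity; auto.
  - apply dy_continuity; auto.
  - intros t _. apply Rgt_not_eq, legendrian_velocity; auto.
Qed.

(** The increment of a lift over one period is an integer depending continuously on the starting
    parameter, hence independent of it. *)
Lemma rot_exists (b : R -> R3) :
  embedded_circle b -> (forall s, legendrian_at b s) -> exists k, is_rot b k.
Proof.
  intros He Hl.
  assert (P : forall s, dx b (s + 1) = dx b s /\ dy b (s + 1) = dy b s)
    by (intros; apply velocity_periodic; auto).
  destruct (velocity_lift b 0 1) as [th0 [C0 A0]]; auto; [lra|].
  assert (K : exists k : Z, th0 1 - th0 0 = IZR k).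
  { apply (ang_unique (dx b 0) (dy b 0)); [apply A0; lra|].
    destruct (P 0) as [P1 P2]. rewrite Rplus_0_l in P1, P2. rewrite <- P1, <- P2.
    apply A0; lra. }
  destruct K as [k Hk]. exists k. intros s th C A.
  pose proof (Rmin_l s 0). pose proof (Rmin_r s 0).
  pose proof (Rmax_l s 0). pose proof (Rmax_r s 0).
  (* One lift on an interval containing both periods connects the period at [s] with the period at
     0. *)
  destruct (velocity_lift b (Rmin s 0) (Rmax s 0 + 1)) as [th2 [C2 A2]]; auto; [lra|].
  assert (E : th2 (s + 1) - th2 s = th2 1 - th2 0).
  { assert (Hc : continuity (fun u => th2 (u + 1) - th2 u)).
    { apply continuity_minus with (f1 := fun u => th2 (u + 1)) (f2 := th2); auto.
      apply (continuity_comp_fun th2 (fun u => u + 1)); auto.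
      apply lipschitz_continuity. intros x y. right. f_equal; ring. }
    assert (Hz : forall t, Rmin s 0 <= t <= Rmax s 0 ->
      exists k : Z, th2 (t + 1) - th2 t = IZR k).
    { intros t Ht. destruct (P t) as [P1 P2].
      apply (ang_unique (dx b t) (dy b t)); [apply A2; lra|].
      rewrite <- P1, <- P2. apply A2; lra. }
    replace (th2 1) with (th2 (0 + 1)) by (f_equal; ring).
    destruct (Rle_dec s 0).
    - apply (integer_valued_constant (fun u => th2 (u + 1) - th2 u) s 0); auto.
      intros t Ht. apply Hz. lra.
    - symmetry. apply (integer_valued_constant (fun u => th2 (u + 1) - th2 u) 0 s); auto; [lra|].
      intros t Ht. apply Hz. lra. }
  rewrite <- Hk.
  rewrite (angle_lift_unique (dx b) (dy b) th th2 s (s + 1)); auto; [|lra|intros; apply A2; lra].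
  rewrite (angle_lift_unique (dx b) (dy b) th0 th2 0 1); auto; [lra|intros; apply A2; lra].
Qed.

Lemma rot_unique (b : R -> R3) (k k' : Z) :
  embedded_circle b -> (forall s, legendrian_at b s) -> is_rot b k -> is_rot b k' -> k = k'.
Proof.
  intros He Hl H H'. destruct (velocity_lift b 0 (0 + 1)) as [th [C A]]; auto; [lra|].
  apply eq_IZR. rewrite <- (H 0 th), <- (H' 0 th); auto.
Qed.

Lemma rot_shift (b : R -> R3) (s0 : R) (k : Z) :
  smooth_curve b -> is_rot b k -> is_rot (fun u => b (1 * u + s0)) k.
Proof.
  intros (S1 & S2 & _) H s th C A.
  specialize (H (s + s0) (fun u => th (1 * u + - s0))). cbv beta in H. rewrite <- H.
  - f_equal; [f_equal; ring|do 2 f_equal; ring].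
  - apply (continuity_comp_fun th); auto. apply continuity_affine.
  - intros u Hu. specialize (A (1 * u + - s0)).
    rewrite (Derive_comp_affine (fun u => px (b u))) in A by auto.
    rewrite (Derive_comp_affine (fun u => py (b u))) in A by auto.
    rewrite !Rmult_1_l in A. replace (u + - s0 + s0) with u in A by ring.
    rewrite Rmult_1_l. apply A. lra.
Qed.

(** Reversal turns every velocity by half a turn, which does not affect increments, and exchanges
    the ends of a period, which changes their sign. *)
Lemma rot_reverse (b : R -> R3) (s0 : R) (k : Z) :
  smooth_curve b -> is_rot b k -> is_rot (fun u => b (-1 * u + s0)) (- k).
Proof.
  intros (S1 & S2 & _) H s th C A.
  specialize (H (s0 - (s + 1)) (fun u => th (-1 * u + s0) + / 2)). cbv beta in H.
  rewrite opp_IZR, <- H.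
  - replace (-1 * (s0 - (s + 1) + 1) + s0) with s by ring.
    replace (-1 * (s0 - (s + 1)) + s0) with (s + 1) by ring. ring.
  - apply continuity_plus with (f1 := fun u => th (-1 * u + s0)) (f2 := fun _ => / 2).
    + apply (continuity_comp_fun th); auto. apply continuity_affine.
    + intros x. apply continuity_pt_const. intros u v; auto.
  - intros u Hu. specialize (A (-1 * u + s0)).
    rewrite (Derive_comp_affine (fun u => px (b u))) in A by auto.
    rewrite (Derive_comp_affine (fun u => py (b u))) in A by auto.
    replace (-1 * (-1 * u + s0) + s0) with u in A by ring.
    replace (dx b u) with (- (-1 * dx b u)) by ring.
    replace (dy b u) with (- (-1 * dy b u)) by ring.
    apply ang_opp, A. lra.
Qed.

Lemma loop_reparametrize (L : R3 -> Prop) (b : R -> R3) (sg s0 : R) :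
  sg = 1 \/ sg = -1 -> loop L b -> loop L (fun u => b (sg * u + s0)).
Proof.
  intros Hsg (((S1 & S2 & S3) & Hp & Hi & Hn) & Hl & HI & HI').
  assert (Hss : sg * sg = 1) by (destruct Hsg; subst; ring).
  assert (Dx : forall s, dx (fun u => b (sg * u + s0)) s = sg * dx b (sg * s + s0))
    by (intros; apply (Derive_comp_affine (fun u => px (b u))); auto).
  assert (Dy : forall s, dy (fun u => b (sg * u + s0)) s = sg * dy b (sg * s + s0))
    by (intros; apply (Derive_comp_affine (fun u => py (b u))); auto).
  assert (Dz : forall s, dz (fun u => b (sg * u + s0)) s = sg * dz b (sg * s + s0))
    by (intros; apply (Derive_comp_affine (fun u => pz (b u))); auto).
  split; [split; [|split; [|split]]|split; [|split]].
  - split; [|split].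
    + apply (smooth_comp_affine (fun u => px (b u))); auto.
    + apply (smooth_comp_affine (fun u => py (b u))); auto.
    + apply (smooth_comp_affine (fun u => pz (b u))); auto.
  - intros s. destruct Hsg; subst sg.
    + replace (1 * (s + 1) + s0) with (1 * s + s0 + 1) by ring. apply Hp.
    + rewrite <- (Hp (-1 * (s + 1) + s0)). f_equal. ring.
  - intros s (E1 & E2 & E3). rewrite Dx in E1. rewrite Dy in E2. rewrite Dz in E3.
    apply (Hi (sg * s + s0)). split; [|split]; nra.
  - intros s t E. destruct (Hn _ _ E) as [k Hk]. destruct Hsg; subst sg.
    + exists k. lra.
    + exists (- k)%Z. rewrite opp_IZR. lra.
  - intros s. unfold legendrian_at. rewrite Dx, Dz. unfold legendrian_at in Hl.
    rewrite Hl. ring.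
  - intros s. apply HI.
  - intros eps He. destruct (HI' eps He) as [d [Hd0 Hd]]. exists d. split; auto.
    intros s P HP Hnear. destruct (Hd _ _ HP Hnear) as [u [Hu1 Hu2]].
    exists (sg * (u - s0)). split.
    + replace (sg * (u - s0) - s) with (sg * (u - (sg * s + s0)) - (1 - sg * sg) * s) by ring.
      rewrite Hss. replace (sg * (u - (sg * s + s0)) - (1 - 1) * s)
        with (sg * (u - (sg * s + s0))) by ring.
      rewrite Rabs_mult. replace (Rabs sg) with 1; [lra|].
      destruct Hsg; subst sg; unfold Rabs; destruct Rcase_abs; lra.
    + rewrite <- Hu2. f_equal. replace (sg * (sg * (u - s0)) + s0)
        with (sg * sg * (u - s0) + s0) by ring. rewrite Hss. ring.
Qed.

(** The angle between velocities with positive dot product has positive cosine. If the rotation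
    numbers differed, this angle would change by at least one turn over a period and would pass a
    value half a turn from its initial one, where the cosine is negative. *)
Lemma rot_close (b b' : R -> R3) (k k' : Z) :
  embedded_circle b -> (forall s, legendrian_at b s) ->
  embedded_circle b' -> (forall s, legendrian_at b' s) ->
  (forall s, 0 <= s <= 1 -> 0 < dx b s * dx b' s + dy b s * dy b' s) ->
  is_rot b k -> is_rot b' k' -> k = k'.
Proof.
  intros He Hl He' Hl' Hd R R'.
  destruct (velocity_lift b 0 (0 + 1)) as [th [C A]]; auto; [lra|].
  destruct (velocity_lift b' 0 (0 + 1)) as [th' [C' A']]; auto; [lra|].
  pose proof (R 0 th C A) as E. pose proof (R' 0 th' C' A') as E'.
  set (f := fun s => th' s - th s).
  assert (Cf : continuity f) by (apply continuity_minus with (f1 := th') (f2 := th); auto).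
  assert (Hf : forall s, 0 <= s <= 0 + 1 -> 0 < tcos (f s)).
  { intros s Hs. specialize (A s Hs). specialize (A' s Hs). specialize (Hd s).
    apply ang_polar in A, A'. destruct A as [r [Hr [E1 E2]]]. destruct A' as [r' [Hr' [E3 E4]]].
    rewrite E1, E2, E3, E4 in Hd. unfold f, Rminus.
    rewrite tcos_plus, tcos_opp, tsin_opp.
    apply Rmult_lt_reg_l with (r * r'); [nra|]. rewrite Rmult_0_r.
    eapply Rlt_le_trans; [apply Hd; lra|]. right; ring. }
  assert (H0 : tcos (f 0 + / 2) < 0 /\ tcos (f 0 + - / 2) < 0).
  { pose proof (Hf 0 ltac:(lra)).
    rewrite !tcos_plus, tcos_opp, tsin_opp, tcos_half, tsin_half. lra. }
  assert (Ek : f (0 + 1) = f 0 + (IZR k' - IZR k)) by (unfold f; lra).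
  destruct (Z.lt_trichotomy k k') as [H|[H|H]]; auto; exfalso.
  - assert (IZR k + 1 <= IZR k') by (rewrite <- plus_IZR; apply IZR_le; lia).
    destruct (ivt f 0 (0 + 1) (f 0 + / 2)) as [t [Ht Et]]; auto; [lra|lra|].
    specialize (Hf t Ht). rewrite Et in Hf. lra.
  - assert (IZR k' + 1 <= IZR k) by (rewrite <- plus_IZR; apply IZR_le; lia).
    destruct (ivt f 0 (0 + 1) (f 0 + - / 2)) as [t [Ht Et]]; auto; [lra|lra|].
    specialize (Hf t Ht). rewrite Et in Hf. lra.
Qed.

(** * Reparametrization *)

(** This is the differentiability part of the inverse function theorem: [phi] is a continuous
    solution of [h = f o phi] near [t], and [f] has nonzero derivative at [phi t]. *)
Lemma lift_derivative (f h phi : R -> R) (t A B : R) :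
  is_derive f (phi t) A -> A <> 0 -> is_derive h t B -> continuity_pt phi t ->
  (exists d, 0 < d /\ forall u, Rabs (u - t) < d -> h u = f (phi u)) ->
  is_derive phi t (B / A).
Proof.
  intros Hf HA Hh Hc [d0 [Hd0 E]]. apply is_derive_Reals. intros eps He.
  assert (HA' : 0 < Rabs A) by (apply Rabs_pos_lt; auto).
  (* Once the error coefficients satisfy [e1 <= Rabs A / 2] and [e2 <= 1], the linear estimates
     bound the increment of [phi] by [M] times that of [t]. The second bounds in [e1] and [e2] then
     leave each error at most a quarter of [eps * Rabs A * Rabs k]. *)
  set (M := 2 * (Rabs B + 1) / Rabs A).
  assert (HM : 0 < M).
  { unfold M. pose proof (Rabs_pos B). apply Rdiv_lt_0_compat; lra. }
  set (e2 := Rmin 1 (eps * Rabs A / 4)).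
  assert (He2 : 0 < e2) by (apply Rmin_glb_lt; nra).
  set (e1 := Rmin (Rabs A / 2) (eps * Rabs A / (4 * (M + 1)))).
  assert (He1 : 0 < e1).
  { apply Rmin_glb_lt; [lra|]. apply Rdiv_lt_0_compat; nra. }
  assert (E1a : e1 <= Rabs A / 2) by apply Rmin_l.
  assert (E1b : e1 * M <= eps * Rabs A / 4).
  { apply Rle_trans with (eps * Rabs A / (4 * (M + 1)) * M).
    - apply Rmult_le_compat_r; [lra|apply Rmin_r].
    - replace (eps * Rabs A / (4 * (M + 1)) * M)
        with (eps * Rabs A / 4 * (M / (M + 1))) by (field; lra).
      rewrite <- (Rmult_1_r (eps * Rabs A / 4)) at 2.
      apply Rmult_le_compat_l; [nra|].
      apply Rmult_le_reg_r with (M + 1); [lra|].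
      replace (M / (M + 1) * (M + 1)) with M by (field; lra). lra. }
  assert (E2a : e2 <= 1) by apply Rmin_l.
  assert (E2b : e2 <= eps * Rabs A / 4) by apply Rmin_r.
  destruct (Derive_eps f (phi t)) with (eps := e1) as [d1 [D1 K1]]; auto; [exists A; auto|].
  rewrite (is_derive_unique _ _ _ Hf) in K1.
  destruct (Derive_eps h t) with (eps := e2) as [d2 [D2 K2]]; auto; [exists B; auto|].
  rewrite (is_derive_unique _ _ _ Hh) in K2.
  rewrite continuity_pt_eps in Hc. destruct (Hc d1 D1) as [d3 [D3 K3]].
  assert (Hm : 0 < Rmin d0 (Rmin d2 d3)) by (repeat apply Rmin_glb_lt; auto).
  exists (mkposreal _ Hm). intros k Hk0 Hk. simpl in Hk.
  pose proof (Rmin_l d0 (Rmin d2 d3)). pose proof (Rmin_r d0 (Rmin d2 d3)).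
  pose proof (Rmin_l d2 d3). pose proof (Rmin_r d2 d3).
  set (D := phi (t + k) - phi t).
  assert (I1 : Rabs (f (phi t + D) - f (phi t) - A * D) <= e1 * Rabs D).
  { apply K1. apply K3. replace (t + k - t) with k by ring. lra. }
  replace (phi t + D) with (phi (t + k)) in I1 by (unfold D; ring).
  rewrite <- !E in I1; [|rewrite Rminus_diag, Rabs_R0; auto
                         |replace (t + k - t) with k by ring; lra].
  assert (I2 : Rabs (h (t + k) - h t - B * k) <= e2 * Rabs k) by (apply K2; lra).
  assert (I3 : Rabs (A * D - B * k) <= e1 * Rabs D + e2 * Rabs k).
  { replace (A * D - B * k) with
      (- (h (t + k) - h t - A * D) + (h (t + k) - h t - B * k)) by ring.
    eapply Rle_trans; [apply Rabs_triang|]. rewrite Rabs_Ropp. lra. }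
  assert (Hk' : 0 < Rabs k) by (apply Rabs_pos_lt; auto).
  assert (I4 : Rabs D <= M * Rabs k).
  { assert (I : Rabs A * Rabs D <= Rabs B * Rabs k + (e1 * Rabs D + e2 * Rabs k)).
    { rewrite <- !Rabs_mult. replace (A * D) with (B * k + (A * D - B * k)) by ring.
      eapply Rle_trans; [apply Rabs_triang|]. rewrite Rabs_mult in *. lra. }
    pose proof (Rabs_pos D).
    apply Rmult_le_reg_l with (Rabs A / 2); [lra|].
    replace (Rabs A / 2 * (M * Rabs k)) with ((Rabs B + 1) * Rabs k)
      by (unfold M; field; lra). nra. }
  replace (D / k - B / A) with ((A * D - B * k) / (A * k)) by (field; auto).
  unfold Rdiv. rewrite Rabs_mult, Rabs_inv, Rabs_mult.
  assert (0 < Rabs A * Rabs k) by nra.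
  apply Rmult_lt_reg_r with (Rabs A * Rabs k); auto.
  replace (Rabs (A * D - B * k) * / (Rabs A * Rabs k) * (Rabs A * Rabs k))
    with (Rabs (A * D - B * k)) by (field; lra).
  assert (e1 * Rabs D <= eps * Rabs A / 4 * Rabs k).
  { apply Rle_trans with (e1 * (M * Rabs k)); [apply Rmult_le_compat_l; lra|].
    rewrite <- Rmult_assoc. apply Rmult_le_compat_r; lra. }
  assert (e2 * Rabs k <= eps * Rabs A / 4 * Rabs k) by (apply Rmult_le_compat_r; lra).
  assert (0 < eps * Rabs A * Rabs k) by (apply Rmult_lt_0_compat; nra). lra.
Qed.

Lemma interior_point (p q t d : R) :
  p < q -> p <= t <= q -> 0 < d -> exists u, p < u < q /\ Rabs (u - t) < d.
Proof.
  intros Hpq Ht Hd. destruct (Rle_dec t ((p + q) / 2));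
    pose proof (Rmin_l (d / 2) ((q - p) / 4)); pose proof (Rmin_r (d / 2) ((q - p) / 4));
    assert (0 < Rmin (d / 2) ((q - p) / 4)) by (apply Rmin_glb_lt; lra).
  - exists (t + Rmin (d / 2) ((q - p) / 4)). split; [lra|]. apply Rabs_def1; lra.
  - exists (t - Rmin (d / 2) ((q - p) / 4)). split; [lra|]. apply Rabs_def1; lra.
Qed.

Lemma zero_on_closure (f : R -> R) (p q : R) :
  continuity f -> p < q -> (forall t, p < t < q -> f t = 0) ->
  forall t, p <= t <= q -> f t = 0.
Proof.
  intros Hf Hpq H t Ht. apply NNPP. intros Hn.
  pose proof (Hf t) as Hc. rewrite continuity_pt_eps in Hc.
  destruct (Hc (Rabs (f t))) as [d [Hd K]]; [apply Rabs_pos_lt; auto|].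
  destruct (interior_point p q t d) as [u [Hu1 Hu2]]; auto.
  specialize (K u Hu2). rewrite (H u Hu1) in K.
  rewrite Rminus_0_l, Rabs_Ropp in K. lra.
Qed.

(** The lift of [c] through [b] is differentiable in the interior, by whichever of the coordinates
    x, y has nonzero derivative along [b]. Hence the planar velocities are parallel, at the ends by
    continuity. Being nonzero they never have zero dot product, so the sign at [t0] decides that
    [phi] increases and that directions agree throughout. *)
Lemma loop_reparametrization (L : R3 -> Prop) (b c : R -> R3) (p q t0 s0 : R) :
  loop L b -> smooth_curve c -> p < q -> p <= t0 <= q ->
  (forall t, p <= t <= q -> immersed_at c t /\ legendrian_at c t /\ L (c t)) ->
  b s0 = c t0 -> 0 < dx c t0 * dx b s0 \/ 0 < dy c t0 * dy b s0 ->
  exists phi, continuity phi /\ phi t0 = s0 /\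
    (forall t, p <= t <= q -> b (phi t) = c t) /\
    (forall t u, p <= t -> t < u -> u <= q -> phi t < phi u) /\
    (forall t th, p <= t <= q ->
       ang (dx b (phi t)) (dy b (phi t)) th -> ang (dx c t) (dy c t) th).
Proof.
  intros (He & Hl & HI) Hc Hpq Ht0 HL E0 Hpos.
  pose proof He as (Hb & _ & Hi & _).
  destruct (curve_lift_from L b c p q t0 s0) as [phi [C [F0 F]]]; auto.
  { apply embedded_circle_embedding; auto. }
  { apply smooth_curve_cont3; auto. }
  { intros t Ht. apply HL; auto. }
  exists phi. split; [auto|]. split; [auto|]. split; [auto|].
  assert (Vb : forall s, 0 < dx b s * dx b s + dy b s * dy b s)
    by (intros; apply legendrian_velocity; auto).
  assert (Vc : forall t, p <= t <= q -> 0 < dx c t * dx c t + dy c t * dy c t)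
    by (intros t Ht; apply legendrian_velocity; apply HL; auto).
  (* At an end of the interval [c] is known to agree with [b o phi] on one side only, which says
     nothing yet about two-sided derivatives. *)
  assert (In : forall t, p < t < q -> exists l, is_derive phi t l /\
     dx c t = l * dx b (phi t) /\ dy c t = l * dy b (phi t)).
  { intros t Ht.
    assert (Loc : exists d, 0 < d /\ forall u, Rabs (u - t) < d -> c u = b (phi u)).
    { exists (Rmin (t - p) (q - t)). split; [apply Rmin_glb_lt; lra|].
      intros u Hu. symmetry. apply F. pose proof (Rmin_l (t - p) (q - t)).
      pose proof (Rmin_r (t - p) (q - t)). apply Rabs_def2 in Hu. lra. }
    assert (Dl : exists l, is_derive phi t l).
    { destruct Loc as [d [Hd0 Hd]].
      destruct (Req_dec (dx b (phi t)) 0) as [Z|Z].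
      - assert (Z' : dy b (phi t) <> 0) by (specialize (Vb (phi t)); nra).
        eexists. apply lift_derivative with (f := fun u => py (b u)) (h := fun u => py (c u))
          (A := dy b (phi t)) (B := dy c t); auto.
        + apply Derive_correct. apply (smooth_ex_derive (fun u => py (b u))). apply Hb.
        + apply Derive_correct. apply (smooth_ex_derive (fun u => py (c u))). apply Hc.
        + exists d. split; auto. intros u Hu. rewrite (Hd u Hu); auto.
      - eexists. apply lift_derivative with (f := fun u => px (b u)) (h := fun u => px (c u))
          (A := dx b (phi t)) (B := dx c t); auto.
        + apply Derive_correct. apply (smooth_ex_derive (fun u => px (b u))). apply Hb.
        + apply Derive_correct. apply (smooth_ex_derive (fun u => px (c u))). apply Hc.
        + exists d. split; auto. intros u Hu. rewrite (Hd u Hu); auto. }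
    destruct Dl as [l Dl]. exists l. split; auto.
    assert (Eloc : locally t (fun u => c u = b (phi u))).
    { destruct Loc as [d [Hd0 Hd]]. exists (mkposreal d Hd0). intros u Hu. apply Hd, Hu. }
    rewrite <- (is_derive_unique phi t l Dl).
    split.
    - rewrite <- (Derive_comp (fun u => px (b u)) phi); [|apply (smooth_ex_derive (fun u => px (b u))); apply Hb|exists l; auto].
      apply Derive_ext_loc. apply filter_imp with (2 := Eloc). intros u ->; auto.
    - rewrite <- (Derive_comp (fun u => py (b u)) phi); [|apply (smooth_ex_derive (fun u => py (b u))); apply Hb|exists l; auto].
      apply Derive_ext_loc. apply filter_imp with (2 := Eloc). intros u ->; auto. }
  pose proof (continuity_comp_fun _ _ (dx_continuity b Hb) C) as C1.
  pose proof (continuity_comp_fun _ _ (dy_continuity b Hb) C) as C2.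
  pose proof (dx_continuity c Hc) as C3. pose proof (dy_continuity c Hc) as C4.
  assert (Cdot : continuity (fun t => dx c t * dx b (phi t) + dy c t * dy b (phi t)))
    by exact (continuity_plus _ _ (continuity_mult _ _ C3 C1) (continuity_mult _ _ C4 C2)).
  assert (Ccross : continuity (fun t => dx b (phi t) * dy c t - dy b (phi t) * dx c t))
    by exact (continuity_minus _ _ (continuity_mult _ _ C1 C4) (continuity_mult _ _ C2 C3)).
  assert (Z : forall t, p <= t <= q -> dx b (phi t) * dy c t - dy b (phi t) * dx c t = 0).
  { apply (zero_on_closure (fun t => dx b (phi t) * dy c t - dy b (phi t) * dx c t)); auto.
    intros t Ht. destruct (In t Ht) as [l [_ [-> ->]]]. ring. }
  assert (Pos : forall t, p <= t <= q -> 0 < dx c t * dx b (phi t) + dy c t * dy b (phi t)).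
  { apply (nonvanishing_positive (fun t => dx c t * dx b (phi t) + dy c t * dy b (phi t)) p q t0);
      auto; [|specialize (Z t0 Ht0); rewrite F0 in *; nra].
    intros t Ht Hz. specialize (Z t Ht). specialize (Vb (phi t)). specialize (Vc t Ht).
    set (a1 := dx b (phi t)) in *. set (a2 := dy b (phi t)) in *.
    set (c1 := dx c t) in *. set (c2 := dy c t) in *.
    assert (0 < (a1 * a1 + a2 * a2) * (c1 * c1 + c2 * c2)) by (apply Rmult_lt_0_compat; auto).
    (* By Lagrange's identity, nonzero vectors cannot have both dot product and cross product
       zero. *)
    assert ((a1 * a1 + a2 * a2) * (c1 * c1 + c2 * c2) =
      (c1 * a1 + c2 * a2) * (c1 * a1 + c2 * a2) + (a1 * c2 - a2 * c1) * (a1 * c2 - a2 * c1)) by ring.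
    rewrite Hz, Z in H0. lra. }
  split.
  - intros t u H1 H2 H3.
    (* The factor of proportionality as a projection onto the velocity of [b]: an explicit and
       visibly positive formula for the derivative of [phi]. *)
    set (df := fun t => (dx c t * dx b (phi t) + dy c t * dy b (phi t)) /
      (dx b (phi t) * dx b (phi t) + dy b (phi t) * dy b (phi t))).
    destruct (MVT_gen phi t u df) as [v [Hv Ev]].
    + rewrite Rmin_left, Rmax_right by lra. intros x Hx.
      destruct (In x) as [l [Dl [E1 E2]]]; [lra|].
      assert (Edf : (df x : R) = l).
      { unfold df. rewrite E1, E2. field. specialize (Vb (phi x)). lra. }
      rewrite Edf; auto.
    + intros x _. apply C.
    + rewrite Rmin_left, Rmax_right in Hv by lra.
      assert (0 < df v).
      { apply Rdiv_lt_0_compat; [apply Pos; lra|apply Vb]. }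
      nra.
  - intros t th Ht Ha. apply ang_eq_of_cross with (1 := Ha).
    + specialize (Z t Ht). lra.
    + specialize (Pos t Ht). lra.
Qed.

(* The rotation number of the component through the fixed point (x, 0, 0), oriented
   by the direction of increasing y at that point. *)
Definition inv (L : R3 -> Prop) (x : R) (k : Z) : Prop :=
  exists b, loop L b /\ b 0 = (x, 0, 0) /\ 0 < dy b 0 /\ is_rot b k.

Lemma loop_periodic (L : R3 -> Prop) (b : R -> R3) (s : R) (k : Z) :
  loop L b -> b (s + IZR k) = b s.
Proof. intros ((_ & H & _) & _). apply periodic_Z; auto. Qed.

(** Following one loop through the other gives an increasing change of parameter that takes one
    period exactly onto one period; an angle lift along one loop then becomes an angle lift along
    the other. *)
Lemma inv_unique (L : R3 -> Prop) (x : R) (k k' : Z) : inv L x k -> inv L x k' -> k = k'.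
Proof.
  intros (b & Hb & E & Y & R) (b' & Hb' & E' & Y' & R').
  pose proof Hb as (He & Hl & HI). pose proof Hb' as (He' & Hl' & HI').
  destruct (loop_reparametrization L b b' 0 1 0 0) as (phi & C & F0 & F & Inc & A);
    auto; try lra.
  { apply He'. }
  { intros t Ht. split; [apply He'|split; [apply Hl'|apply HI']]. }
  { congruence. }
  { right. nra. }
  assert (P0 : b (phi 1) = b 0).
  { rewrite F, E by lra. rewrite <- E'. replace 1 with (0 + 1) by ring. apply He'. }
  destruct He as (_ & _ & _ & Hn). destruct (Hn _ _ (eq_sym P0)) as [m Hm].
  rewrite Rplus_0_l in Hm.
  assert (Hm0 : 0 < IZR m) by (rewrite <- Hm, <- F0; apply Inc; lra).
  apply lt_IZR in Hm0.
  (* For larger [m] the value 1 of [phi] would be taken strictly inside the period, and [b'] would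
     return to its starting point too early. *)
  assert (m = 1%Z).
  { apply NNPP. intros Hne.
    assert (H2 : 1 < IZR m) by (apply IZR_lt; lia).
    destruct (ivt phi 0 1 1) as [t [Ht Et]]; auto; [lra|left; lra|].
    assert (t <> 1) by (intros ->; lra). assert (t <> 0) by (intros ->; lra).
    assert (Ez : b' 0 = b' t).
    { rewrite <- (F t) by lra. rewrite Et, E'. rewrite <- E. symmetry.
      replace 1 with (0 + IZR 1) by (simpl; ring). apply (loop_periodic L); auto. }
    destruct He' as (_ & _ & _ & Hn'). destruct (Hn' _ _ Ez) as [j Hj].
    rewrite Rplus_0_l in Hj.
    assert (j = 0%Z) by (apply small_integer; apply Rabs_def1; lra). subst j.
    simpl in Hj. lra. }
  subst m. simpl in Hm.
  destruct (velocity_lift b 0 1) as [th [Ct At]]; auto; [apply Hb|lra|].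
  apply eq_IZR.
  rewrite <- (R 0 th), <- (R' 0 (fun t => th (phi t))); auto.
  - rewrite Rplus_0_l, Hm, F0. auto.
  - apply continuity_comp_fun; auto.
  - rewrite Rplus_0_l. intros u Hu. apply A; auto. apply At.
    split.
    + destruct (Req_dec u 0) as [->|]; [lra|]. rewrite <- F0. left; apply Inc; lra.
    + destruct (Req_dec u 1) as [->|]; [lra|]. rewrite <- Hm. left; apply Inc; lra.
  - rewrite Rplus_0_l. auto.
Qed.

(** * Comparison of two diagrams that differ in a disk *)

(** In [symmetric_arc] the link over the diagram is existential; here it is the given link, which is
    legitimate because a diagram determines its link. *)
Definition arc_over (Phi : R2 -> R2) (L : R3 -> Prop) (a : R -> R3) : Prop :=
  smooth_curve a /\
  (forall s, -1 <= s <= 1 ->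
     immersed_at a s /\ legendrian_at a s /\ a (- s) = tau (a s)) /\
  (forall s u, -1 <= s <= 1 -> -1 <= u <= 1 -> a s = a u -> s = u) /\
  (forall P, (L P /\ in_disk Phi (front_proj P)) <-> exists s, -1 <= s <= 1 /\ a s = P).

(** An arc filling a whole period of the loop would come back to its starting point, against
    injectivity. So part of each component is left over outside the disk. *)
Lemma arc_parameter_gap (b a : R -> R3) (phi : R -> R) :
  (forall s, b (s + 1) = b s) -> continuity phi ->
  (forall s u, -1 <= s <= 1 -> -1 <= u <= 1 -> a s = a u -> s = u) ->
  (forall t, -1 <= t <= 1 -> b (phi t) = a t) ->
  (forall t u, -1 <= t -> t < u -> u <= 1 -> phi t < phi u) ->
  phi 1 < phi (-1) + 1.
Proof.
  intros Hp C Hinj F Inc. apply Rnot_le_lt. intros H.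
  destruct (ivt phi (-1) 1 (phi (-1) + 1)) as [t [Ht Et]]; auto; [lra|left; lra|].
  assert (E : a t = a (-1)).
  { rewrite <- !F by lra. rewrite Et. apply Hp. }
  apply Hinj in E; try lra. subst t. lra.
Qed.

Lemma increasing_le (phi : R -> R) (p q : R) :
  (forall t u, p <= t -> t < u -> u <= q -> phi t < phi u) ->
  forall t u, p <= t -> t <= u -> u <= q -> phi t <= phi u.
Proof.
  intros H t u H1 H2 H3. destruct (Req_dec t u) as [->|]; [lra|]. left. apply H; lra.
Qed.

(* Outside the disk the two components run through the same points, so that the
   difference of the rotation numbers comes from the arcs in the disk. *)
Lemma rotation_difference (Phi : R2 -> R2) (L L' : R3 -> Prop) (a a' b b' : R -> R3) (k k' : Z) :
  arc_over Phi L a -> arc_over Phi L' a' ->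
  no_crossings a -> front_proj (a 1) = front_proj (a' 1) ->
  dx a 1 < 0 -> dx a' 1 < 0 ->
  (forall P, (forall d, 0 < d -> exists Q, L Q /\ near d Q P) -> L P) ->
  (forall P, L' P -> ~ in_disk Phi (front_proj P) -> L P) ->
  loop L b -> loop L' b' -> b 0 = a 0 -> b' 0 = a' 0 ->
  0 < dy a 0 * dy b 0 -> 0 < dy a' 0 * dy b' 0 -> is_rot b k -> is_rot b' k' ->
  exists al al', continuity al /\ continuity al' /\
    (forall s, -1 <= s <= 1 -> ang (dx a s) (dy a s) (al s)) /\
    (forall s, -1 <= s <= 1 -> ang (dx a' s) (dy a' s) (al' s)) /\
    IZR k - IZR k' = (al 1 - al (-1)) - (al' 1 - al' (-1)).
Proof.
  intros (Sa & Ia & Ja & Da) (Sa' & Ia' & Ja' & Da') Hnc He X1 X1' Hcl Hout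
    Hb Hb' B0 B0' Y0 Y0' Rk Rk'.
  destruct (loop_reparametrization L b a (-1) 1 0 0) as (phi & C & F0 & F & Inc & A);
    auto; try lra.
  { intros t Ht. destruct (Ia t Ht) as (I1 & I2 & _). split; [auto|split; [auto|]].
    apply (Da (a t)). exists t; auto. }
  destruct (loop_reparametrization L' b' a' (-1) 1 0 0) as (phi' & C' & F0' & F' & Inc' & A');
    auto; try lra.
  { intros t Ht. destruct (Ia' t Ht) as (I1 & I2 & _). split; [auto|split; [auto|]].
    apply (Da' (a' t)). exists t; auto. }
  pose proof Hb as (Eb & Lb & HI). pose proof Hb' as (Eb' & Lb' & HI').
  pose proof Eb as (Sb & Pb & Ib & Nb). pose proof Eb' as (Sb' & Pb' & Ib' & Nb').
  pose proof (arc_parameter_gap b a phi Pb C Ja F Inc) as G.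
  pose proof (arc_parameter_gap b' a' phi' Pb' C' Ja' F' Inc') as G'.
  pose proof (increasing_le _ _ _ Inc) as IncL. pose proof (increasing_le _ _ _ Inc') as IncL'.
  (* The points of [L'] over the disk are exactly those of the arc, and the arc occupies the
     complementary part of this period. *)
  assert (O : forall u, phi' 1 < u < phi' (-1) + 1 -> ~ in_disk Phi (front_proj (b' u))).
  { intros u Hu Hd. destruct (proj1 (Da' (b' u))) as [s [Hs Es]]; [split; auto; apply HI'|].
    rewrite <- (F' s Hs) in Es. destruct (Nb' _ _ Es) as [m Hm].
    pose proof (IncL' (-1) s ltac:(lra) ltac:(lra) ltac:(lra)).
    pose proof (IncL' s 1 ltac:(lra) ltac:(lra) ltac:(lra)).
    assert (m = 0%Z) by (apply small_integer, Rabs_def1; lra). subst m. simpl in Hm. lra. }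
  (* The open piece lies off the disk, where the links agree; its two ends lie over the disk and are
     reached because [L] is closed. *)
  assert (HL : forall u, phi' 1 <= u <= phi' (-1) + 1 -> L (b' u)).
  { intros u Hu. apply Hcl. intros d Hd.
    destruct (cont3_near b' u d) as [e [He' K]]; auto; [apply smooth_curve_cont3; auto|].
    destruct (interior_point (phi' 1) (phi' (-1) + 1) u e) as [w [Hw1 Hw2]]; auto.
    exists (b' w). split; [|apply K; auto]. apply Hout; [apply HI'|apply O; auto]. }
  (* This end of [a'] lies in [L] over the disk, hence on [a], and over the same front point as
     [a 1]. The absence of crossings on [a] identifies the two points in space. *)
  assert (E1 : a' 1 = a 1).
  { destruct (proj1 (Da (a' 1))) as [s [Hs Es]].
    - split; [rewrite <- F' by lra; apply HL; lra|].
      rewrite <- He. apply (Da (a 1)). exists 1. split; auto; lra.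
    - rewrite <- Es in He. apply Hnc in He; try lra. congruence. }
  assert (E2 : a' (-1) = a (-1)).
  { destruct (Ia 1) as (_ & _ & T1); [lra|]. destruct (Ia' 1) as (_ & _ & T2); [lra|].
    replace (-1) with (- (1)) by ring. rewrite T1, T2, E1. auto. }
  destruct (velocity_lift b (phi (-1)) (phi (-1) + 1)) as [th [Ct At]]; auto; [lra|].
  destruct (velocity_lift b' (phi' (-1)) (phi' (-1) + 1)) as [th' [Ct' At']]; auto; [lra|].
  assert (In1 : forall t, -1 <= t <= 1 -> phi (-1) <= phi t <= phi (-1) + 1).
  { intros t Ht. pose proof (IncL (-1) t ltac:(lra) ltac:(lra) ltac:(lra)).
    pose proof (IncL t 1 ltac:(lra) ltac:(lra) ltac:(lra)). lra. }
  assert (In1' : forall t, -1 <= t <= 1 -> phi' (-1) <= phi' t <= phi' (-1) + 1).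
  { intros t Ht. pose proof (IncL' (-1) t ltac:(lra) ltac:(lra) ltac:(lra)).
    pose proof (IncL' t 1 ltac:(lra) ltac:(lra) ltac:(lra)). lra. }
  assert (Xb : dx b (phi 1) < 0).
  { pose proof (At (phi 1) (In1 1 ltac:(lra))) as H. pose proof (A 1 _ ltac:(lra) H) as H'.
    apply ang_polar in H, H'. destruct H as [r [Hr [-> _]]], H' as [r' [Hr' [H' _]]].
    rewrite H' in X1. nra. }
  assert (Xb' : dx b' (phi' 1) < 0).
  { pose proof (At' (phi' 1) (In1' 1 ltac:(lra))) as H. pose proof (A' 1 _ ltac:(lra) H) as H'.
    apply ang_polar in H, H'. destruct H as [r [Hr [-> _]]], H' as [r' [Hr' [H' _]]].
    rewrite H' in X1'. nra. }
  (* The part of [b'] outside the disk is followed along [b], from the end of one arc onwards; [psi]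
     turns out to end where the arc [a] starts again one period later. *)
  destruct (loop_reparametrization L b b' (phi' 1) (phi' (-1) + 1) (phi' 1) (phi 1))
    as (psi & Cp & P0 & P & Incp & Ap); auto; try lra.
  { rewrite F, F' by lra. auto. }
  { left. nra. }
  (* Otherwise an inner point of the outside piece would be [a (-1)], which lies over the disk. *)
  assert (Q : psi (phi' (-1) + 1) <= phi (-1) + 1).
  { apply Rnot_lt_le. intros H.
    destruct (ivt psi (phi' 1) (phi' (-1) + 1) (phi (-1) + 1)) as [u [Hu Eu]]; auto; [lra|left; lra|].
    assert (u <> phi' 1) by (intros ->; lra).
    assert (u <> phi' (-1) + 1) by (intros ->; lra).
    apply (O u); [lra|]. rewrite <- P by auto. rewrite Eu, Pb, F by lra.
    apply (Da (a (-1))). exists (-1). split; auto; lra. }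
  assert (Q' : psi (phi' (-1) + 1) = phi (-1) + 1).
  { assert (E3 : b (phi (-1)) = b (psi (phi' (-1) + 1))).
    { rewrite P, F, Pb', F' by lra. auto. }
    destruct (Nb _ _ E3) as [m Hm].
    assert (phi 1 < psi (phi' (-1) + 1)) by (rewrite <- P0; apply Incp; lra).
    pose proof (Inc (-1) 1 ltac:(lra) ltac:(lra) ltac:(lra)).
    assert (m - 1 = 0)%Z.
    { apply small_integer. rewrite minus_IZR. apply Rabs_def1; lra. }
    assert (m = 1%Z) by lia. subst m. auto. }
  exists (fun s => th (phi s)), (fun s => th' (phi' s)).
  split; [apply continuity_comp_fun; auto|]. split; [apply continuity_comp_fun; auto|].
  split; [intros s Hs; apply A; auto|]. split; [intros s Hs; apply A'; auto|].
  rewrite <- (Rk _ th Ct At), <- (Rk' _ th' Ct' At').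
  assert (R : th' (phi' (-1) + 1) - th' (phi' 1) = th (phi (-1) + 1) - th (phi 1)).
  { rewrite (angle_lift_unique (dx b') (dy b') th' (fun t => th (psi t)) (phi' 1) (phi' (-1) + 1));
      auto; try lra.
    - rewrite Q', P0. auto.
    - apply continuity_comp_fun; auto.
    - intros t Ht. apply At'. pose proof (In1' 1 ltac:(lra)). lra.
    - intros t Ht. apply Ap; auto. apply At.
      pose proof (increasing_le _ _ _ Incp (phi' 1) t ltac:(lra) ltac:(lra) ltac:(lra)).
      pose proof (increasing_le _ _ _ Incp t (phi' (-1) + 1) ltac:(lra) ltac:(lra) ltac:(lra)).
      pose proof (In1 1 ltac:(lra)). lra. }
  lra.
Qed.

(** * Total angle of the arcs *)

(** Differentiating [a (- s) = tau (a s)] makes x' odd and y' even. The relation holds on [-1, 1]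
    only, so the ends are treated by continuity. *)
Lemma arc_symmetry (Phi : R2 -> R2) (L : R3 -> Prop) (a : R -> R3) :
  arc_over Phi L a -> forall t, -1 <= t <= 1 -> dx a (- t) = - dx a t /\ dy a (- t) = dy a t.
Proof.
  intros ((S1 & S2 & S3) & Ia & _).
  assert (Loc : forall t, -1 < t < 1 -> locally t (fun u => a (-1 * u + 0) = tau (a u))).
  { intros t Ht. assert (H : 0 < Rmin (t + 1) (1 - t)) by (apply Rmin_glb_lt; lra).
    exists (mkposreal _ H). intros u Hu. change (Rabs (u - t) < Rmin (t + 1) (1 - t)) in Hu.
    pose proof (Rmin_l (t + 1) (1 - t)). pose proof (Rmin_r (t + 1) (1 - t)).
    apply Rabs_def2 in Hu. destruct (Ia u) as (_ & _ & E); [lra|].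
    rewrite <- E. f_equal. ring. }
  assert (Cn : forall f, continuity f -> continuity (fun t => f (- t))).
  { intros f Hf. apply (continuity_comp_fun f Ropp); auto.
    apply lipschitz_continuity. intros x y. right.
    replace (- y - - x) with (- (y - x)) by ring. apply Rabs_Ropp. }
  intros t Ht. split.
  - assert (Z : dx a (- t) + dx a t = 0); [|lra].
    apply (zero_on_closure (fun t => dx a (- t) + dx a t) (-1) 1); auto; try lra.
    + pose proof (dx_continuity a (conj S1 (conj S2 S3))) as Cd.
      exact (continuity_plus _ _ (Cn _ Cd) Cd).
    + intros u Hu.
      assert (E : -1 * dx a (-1 * u + 0) = dx a u).
      { rewrite <- (Derive_comp_affine (fun u => px (a u)) (-1) 0) by auto.
        apply Derive_ext_loc. apply filter_imp with (2 := Loc u Hu). intros v ->. auto. }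
      replace (- u) with (-1 * u + 0) by ring. lra.
  - assert (Z : dy a (- t) - dy a t = 0); [|lra].
    apply (zero_on_closure (fun t => dy a (- t) - dy a t) (-1) 1); auto; try lra.
    + pose proof (dy_continuity a (conj S1 (conj S2 S3))) as Cd.
      exact (continuity_minus _ _ (Cn _ Cd) Cd).
    + intros u Hu.
      assert (E : -1 * dy a (-1 * u + 0) = - dy a u).
      { rewrite <- (Derive_comp_affine (fun u => py (a u)) (-1) 0) by auto.
        rewrite <- Derive_opp.
        apply Derive_ext_loc. apply filter_imp with (2 := Loc u Hu). intros v ->. auto. }
      replace (- u) with (-1 * u + 0) by ring. lra.
Qed.

(** By the symmetry, [/ 2 - al (- t)] is another lift of the direction at [t], so both halves of the
    arc turn by the same amount. *)
Lemma arc_total_angle (Phi : R2 -> R2) (L : R3 -> Prop) (a : R -> R3) (al : R -> R) :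
  arc_over Phi L a -> continuity al ->
  (forall s, -1 <= s <= 1 -> ang (dx a s) (dy a s) (al s)) ->
  al 1 - al (-1) = 2 * (al 1 - al 0).
Proof.
  intros Ha C A. pose proof (arc_symmetry Phi L a Ha) as Sy.
  assert (E : al 1 - al 0 = (/ 2 - al (- (1))) - (/ 2 - al (- 0))).
  { apply (angle_lift_unique (dx a) (dy a) al (fun t => / 2 - al (- t)) 0 1); auto; try lra.
    - apply continuity_minus with (f1 := fun _ => / 2) (f2 := fun t => al (- t)).
      + intros x. apply continuity_pt_const. intros u v; auto.
      + apply (continuity_comp_fun al Ropp); auto.
        apply lipschitz_continuity. intros x y. right.
        replace (- y - - x) with (- (y - x)) by ring. apply Rabs_Ropp.
    - intros t Ht. apply A. lra.
    - intros t Ht. destruct (Sy t) as [E1 E2]; [lra|].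
      replace (dx a t) with (- dx a (- t)) by lra. rewrite <- E2.
      apply ang_reflect, A. lra. }
  rewrite Ropp_0 in E. replace (- (1)) with (-1) in E by ring. lra.
Qed.

(** To leave the interval the angle would have to pass 1/2, or take a value in [-1/4, 0], and the
    sine is not positive there. *)
Lemma sector_step (f : R -> R) (p q : R) :
  continuity f -> f p = 0 -> (forall t, p < t <= q -> 0 < tsin (f t)) ->
  forall t, p < t <= q -> 0 < f t < / 2.
Proof.
  intros C F0 H t Ht. split; apply Rnot_le_lt; intros Hle.
  - destruct (Rle_dec (- / 4) (f t)) as [H1|H1].
    + pose proof (H t Ht) as H2. destruct (Req_dec (f t) 0) as [E|E].
      * rewrite E, tsin_0 in H2. lra.
      * pose proof (tsin_pos (- f t)) as H3. rewrite tsin_opp in H3. lra.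
    + destruct (ivt f p t (- / 4)) as [u [Hu Eu]]; auto; [lra|lra|].
      assert (u <> p) by (intros ->; lra).
      pose proof (H u ltac:(lra)) as H2. rewrite Eu, tsin_opp in H2.
      pose proof (tsin_pos (/ 4)). lra.
  - destruct (ivt f p t (/ 2)) as [u [Hu Eu]]; auto; [lra|lra|].
    assert (u <> p) by (intros ->; lra).
    pose proof (H u ltac:(lra)) as H2. rewrite Eu, tsin_half in H2. lra.
Qed.

(** A direction that starts vertical and then stays on one side of the vertical turns by less than
    half a turn. The sense [e] is given by the sign of x' against the initial vertical sense, since
    cos (u + d) = - sin u sin d when cos u = 0. *)
Lemma sector (al : R -> R) (p q e : R) :
  continuity al -> e = 1 \/ e = -1 -> tcos (al p) = 0 ->
  (forall t, p < t <= q -> 0 < e * (- tsin (al p)) * tcos (al t)) ->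
  forall t, p < t <= q -> 0 < e * (al t - al p) < / 2.
Proof.
  intros C He H0 H.
  apply (sector_step (fun t => e * (al t - al p))).
  - apply continuity_scal. apply continuity_minus with (f1 := al) (f2 := fun _ => al p); auto.
    intros x. apply continuity_pt_const. intros u v; auto.
  - ring.
  - intros t Ht. specialize (H t Ht). pose proof (tcos2_tsin2 (al p)) as E. rewrite H0 in E.
    replace (al t) with (al p + (al t - al p)) in H by ring.
    rewrite tcos_plus, H0 in H.
    assert (E' : tsin (e * (al t - al p)) = e * tsin (al t - al p)).
    { destruct He as [-> | ->].
      - rewrite !Rmult_1_l; auto.
      - replace (-1 * (al t - al p)) with (- (al t - al p)) by ring. rewrite tsin_opp. ring. }
    rewrite E'. set (sn := tsin (al t - al p)) in *. set (sp := tsin (al p)) in *.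
    replace (e * - sp * (0 * tcos (al t - al p) - sp * sn)) with (e * sn * (0 * 0 + sp * sp)) in H by ring.
    rewrite E in H. lra.
Qed.

Lemma ang_vertical (X Y th : R) : ang X Y th -> X = 0 ->
  tcos th = 0 /\ (0 < Y -> tsin th = 1) /\ (Y < 0 -> tsin th = -1).
Proof.
  intros Ha ->. apply ang_polar in Ha. destruct Ha as [r [Hr [H1 ->]]].
  pose proof (tcos2_tsin2 th) as E. assert (H0 : tcos th = 0) by nra.
  rewrite H0 in E. split; [auto|]. split; intros H; nra.
Qed.

Lemma ang_x_sign (X Y th e : R) : ang X Y th -> 0 < e * X -> 0 < e * tcos th.
Proof.
  intros Ha. apply ang_polar in Ha. destruct Ha as [r [Hr [-> _]]]. intros H.
  apply Rmult_lt_reg_l with r; auto. lra.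
Qed.

(** As z' = y x', a half arc with x' of sign [e] and z of sign [f] has y of sign [e * f] at points
    arbitrarily close to the fixed point. There y vanishes, x' vanishes by symmetry and hence y'
    does not, so y' has this sign as well. *)
Lemma departure_sign (Phi : R2 -> R2) (L : R3 -> Prop) (a : R -> R3) (r e f : R) :
  arc_over Phi L a -> 0 < r <= 1 ->
  (forall s, 0 < s < r -> 0 < e * dx a s) -> (forall s, 0 < s < r -> 0 < f * pz (a s)) ->
  dx a 0 = 0 /\ 0 < e * f * dy a 0.
Proof.
  intros Ha Hr HX HZ. pose proof Ha as ((S1 & S2 & S3) & Ia & _).
  destruct (arc_symmetry Phi L a Ha 0) as [X0 _]; [lra|]. rewrite Ropp_0 in X0.
  assert (X0' : dx a 0 = 0) by lra. split; auto.
  destruct (Ia 0) as (I1 & I2 & I3); [lra|]. rewrite Ropp_0 in I3.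
  assert (y0 : py (a 0) = 0).
  { assert (E : py (a 0) = - py (a 0)) by (rewrite I3 at 1; auto). lra. }
  assert (z0 : pz (a 0) = 0).
  { assert (E : pz (a 0) = - pz (a 0)) by (rewrite I3 at 1; auto). lra. }
  assert (Y0 : dy a 0 <> 0).
  { pose proof (legendrian_velocity a 0 I1 I2). rewrite X0' in H. intros E. rewrite E in H. lra. }
  assert (Hc : forall s, 0 < s < r -> exists c, 0 < c < s /\ 0 < e * f * py (a c)).
  { intros s Hs. destruct (mvt (fun u => pz (a u)) 0 s) as [c [Hc Ec]]; [|lra|].
    { intros u. apply (smooth_ex_derive (fun u => pz (a u))); auto. }
    cbv beta in Ec. destruct (Ia c) as (_ & Lc & _); [lra|]. unfold legendrian_at in Lc.
    rewrite Lc, z0 in Ec. exists c. split; auto.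
    specialize (HZ s Hs). specialize (HX c ltac:(lra)).
    replace (pz (a s)) with (py (a c) * dx a c * s) in HZ by lra.
    assert (H1 : 0 < f * (py (a c) * dx a c)) by (apply Rmult_lt_reg_r with s; lra).
    assert (H2 : 0 < (f * (py (a c) * dx a c)) * (e * dx a c)) by (apply Rmult_lt_0_compat; auto).
    apply Rmult_lt_reg_r with (dx a c * dx a c); [|lra].
    assert (dx a c <> 0) by (intros E; rewrite E in HX; lra). nra. }
  apply Rnot_le_lt. intros Hle.
  assert (Hef : e * f <> 0).
  { destruct (Hc (r / 2)) as [c [_ Hc']]; [lra|]. intros E; rewrite E in Hc'; lra. }
  assert (Hneg : e * f * dy a 0 < 0).
  { destruct Hle as [|E]; auto. apply Rmult_integral in E. tauto. }
  destruct (Derive_eps (fun u => py (a u)) 0) with (eps := Rabs (dy a 0) / 2)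
    as [d [Hd K]]; [apply (smooth_ex_derive (fun u => py (a u))); auto| |].
  { apply Rabs_pos_lt in Y0. lra. }
  pose proof (Rmin_l d r). pose proof (Rmin_r d r).
  assert (0 < Rmin d r) by (apply Rmin_glb_lt; lra).
  destruct (Hc (Rmin d r / 2)) as [c [Hc1 Hc2]]; [lra|].
  specialize (K c). rewrite Rplus_0_l, y0 in K.
  rewrite (Rabs_right c) in K by lra. specialize (K ltac:(lra)).
  apply Rabs_le_between in K.
  (* So close to the fixed point, y is at least half of its linear approximation and has the same
     sign. *)
  assert (Hfin : exists l, / 2 <= l /\ py (a c) = l * (dy a 0 * c)).
  { assert (Hz : dy a 0 * c <> 0) by (apply Rmult_integral_contrapositive; split; auto; lra).
    exists (py (a c) / (dy a 0 * c)). split; [|field; split; auto; lra].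
    unfold Rabs in K. destruct Rcase_abs in K.
    - apply Rmult_le_reg_r with (- (dy a 0 * c)); [nra|].
      replace (py (a c) / (dy a 0 * c) * - (dy a 0 * c)) with (- py (a c)) by (field; split; auto; lra).
      lra.
    - assert (0 < dy a 0 * c) by nra. apply Rmult_le_reg_r with (dy a 0 * c); auto.
      replace (py (a c) / (dy a 0 * c) * (dy a 0 * c)) with (py (a c)) by (field; split; auto; lra).
      lra. }
  destruct Hfin as [l [Hl El]]. rewrite El in Hc2.
  assert (e * f * (l * (dy a 0 * c)) = (e * f * dy a 0) * (l * c)) by ring.
  assert (0 < l * c) by nra. nra.
Qed.

(** Near the cusp this half runs leftwards below the axis, so y increases at the start; x' stays
    negative on the whole half, which is one counterclockwise sector. *)
Lemma T_angle (Phi : R2 -> R2) (L : R3 -> Prop) (a : R -> R3) (al : R -> R) (r : R) :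
  arc_over Phi L a -> 0 < r < 1 ->
  (forall s, 0 < s <= 1 -> dx a s < 0) -> (forall s, 0 < s < r -> pz (a s) < 0) ->
  continuity al -> (forall s, -1 <= s <= 1 -> ang (dx a s) (dy a s) (al s)) ->
  0 < dy a 0 /\ 0 < al 1 - al 0 < / 2.
Proof.
  intros Ha Hr HX HZ C A.
  destruct (departure_sign Phi L a r (-1) (-1) Ha) as [X0 Y0]; [lra| | |].
  { intros s Hs. specialize (HX s). lra. }
  { intros s Hs. specialize (HZ s). lra. }
  split; [lra|].
  destruct (ang_vertical _ _ _ (A 0 ltac:(lra)) X0) as (V0 & V1 & _).
  rewrite <- (Rmult_1_l (al 1 - al 0)).
  apply (sector al 0 1 1); auto; [|lra].
  intros t Ht. rewrite V1 by lra.
  pose proof (ang_x_sign _ _ _ (-1) (A t ltac:(lra))) as H. specialize (HX t Ht). lra.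
Qed.

(** Here the half runs leftwards above the axis, so y decreases at the start and the sector is
    clockwise. *)
Lemma cusp_angle (Phi : R2 -> R2) (L : R3 -> Prop) (a : R -> R3) (al : R -> R) :
  arc_over Phi L a ->
  (forall s, 0 < s <= 1 -> dx a s < 0) -> (forall s, 0 < s <= 1 -> 0 < pz (a s)) ->
  continuity al -> (forall s, -1 <= s <= 1 -> ang (dx a s) (dy a s) (al s)) ->
  dy a 0 < 0 /\ - / 2 < al 1 - al 0 < 0.
Proof.
  intros Ha HX HZ C A.
  destruct (departure_sign Phi L a 1 (-1) 1 Ha) as [X0 Y0]; [lra| | |].
  { intros s Hs. specialize (HX s). lra. }
  { intros s Hs. specialize (HZ s). lra. }
  split; [lra|].
  destruct (ang_vertical _ _ _ (A 0 ltac:(lra)) X0) as (V0 & _ & V1).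
  assert (H : 0 < -1 * (al 1 - al 0) < / 2); [|lra].
  apply (sector al 0 1 (-1)); auto; [|lra].
  intros t Ht. rewrite V1 by lra.
  pose proof (ang_x_sign _ _ _ (-1) (A t ltac:(lra))) as H. specialize (HX t Ht). lra.
Qed.

(* If y increased through the right-pointing cusp, then the strand entering the cusp
   would run above the strand leaving it. *)
Lemma right_cusp_direction (a : R -> R3) (r : R) :
  smooth_curve a -> (forall s, -1 <= s <= 1 -> immersed_at a s /\ legendrian_at a s) ->
  0 < r < 1 -> (forall s, 0 < s < r -> 0 < dx a s) -> dx a r = 0 ->
  (forall s, r < s <= 1 -> dx a s < 0) ->
  (forall s u, 0 < s < r -> r < u <= 1 -> px (a s) = px (a u) -> pz (a s) < pz (a u)) ->
  dy a r < 0.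
Proof.
  intros (S1 & S2 & S3) Ia Hr X1 Xr X2 HZ.
  destruct (Ia r) as [I1 I2]; [lra|].
  pose proof (legendrian_velocity a r I1 I2) as V. rewrite Xr in V.
  apply Rnot_le_lt. intros Hle. assert (Yr : 0 < dy a r) by nra. clear Hle V.
  destruct (Derive_eps (fun u => py (a u)) r) with (eps := dy a r / 2)
    as [d0 [Hd0 K]]; [apply (smooth_ex_derive (fun u => py (a u))); auto|lra|].
  assert (Hd : exists d, 0 < d /\ d < d0 /\ d < r /\ d < 1 - r).
  { exists (Rmin d0 (Rmin r (1 - r)) / 2).
    pose proof (Rmin_l d0 (Rmin r (1 - r))). pose proof (Rmin_r d0 (Rmin r (1 - r))).
    pose proof (Rmin_l r (1 - r)). pose proof (Rmin_r r (1 - r)).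
    assert (0 < Rmin d0 (Rmin r (1 - r))) by (repeat apply Rmin_glb_lt; lra). lra. }
  destruct Hd as (d & D0 & D1 & D2 & D3).
  assert (Yl : forall s, r - d <= s < r -> py (a s) < py (a r)).
  { intros s Hs. specialize (K (s - r)). replace (r + (s - r)) with s in K by ring.
    rewrite (Rabs_left (s - r)) in K by lra. specialize (K ltac:(lra)).
    apply Rabs_le_between in K. nra. }
  assert (Yg : forall s, r < s <= r + d -> py (a r) < py (a s)).
  { intros s Hs. specialize (K (s - r)). replace (r + (s - r)) with s in K by ring.
    rewrite (Rabs_right (s - r)) in K by lra. specialize (K ltac:(lra)).
    apply Rabs_le_between in K. nra. }
  assert (Ex : forall s, ex_derive (fun u => px (a u)) s)
    by (intros; apply (smooth_ex_derive (fun u => px (a u))); auto).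
  assert (Ez : forall s, ex_derive (fun u => pz (a u)) s)
    by (intros; apply (smooth_ex_derive (fun u => pz (a u))); auto).
  assert (Cx : continuity (fun u => px (a u))) by (apply ex_derive_continuity; auto).
  assert (Xl : px (a (r - d)) < px (a r)).
  { destruct (mvt (fun u => px (a u)) (r - d) r) as [c [Hc Ec]]; auto; [lra|].
    cbv beta in Ec. specialize (X1 c ltac:(lra)). nra. }
  assert (Xg : px (a (r + d)) < px (a r)).
  { destruct (mvt (fun u => px (a u)) r (r + d)) as [c [Hc Ec]]; auto; [lra|].
    cbv beta in Ec. specialize (X2 c ltac:(lra)). nra. }
  (* Two points on the two branches with the same x: the branch that reaches less far to the left is
     taken at its full length. *)
  assert (E : exists s u, r - d <= s < r /\ r < u <= r + d /\ px (a s) = px (a u)).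
  { destruct (Rle_dec (px (a (r - d))) (px (a (r + d)))).
    - destruct (ivt (fun u => px (a u)) (r - d) r (px (a (r + d)))) as [s [Hs Es]]; auto; [lra|lra|].
      exists s, (r + d). assert (s <> r) by (intros ->; lra). repeat split; try lra; auto.
    - destruct (ivt (fun u => px (a u)) r (r + d) (px (a (r - d)))) as [u [Hu Eu]]; auto; [lra|lra|].
      exists (r - d), u. assert (u <> r) by (intros ->; lra). repeat split; try lra; auto. }
  destruct E as (s & u & Hs & Hu & E).
  specialize (HZ s u ltac:(lra) ltac:(lra) E).
  (* The height above the tangent line of the cusp has derivative (y - y(r)) x', which would be
     negative on both branches. At equal x the later branch would then be the lower one. *)
  set (f := fun v => pz (a v) - py (a r) * px (a v)).
  assert (Df : forall v, ex_derive f v).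
  { intros v. apply (ex_derive_minus (fun u => pz (a u)) (fun u => py (a r) * px (a u))); auto.
    apply ex_derive_scal; auto. }
  assert (DfE : forall v, -1 <= v <= 1 -> Derive f v = (py (a v) - py (a r)) * dx a v).
  { intros v Hv. unfold f.
    rewrite (Derive_minus (fun u => pz (a u)) (fun u => py (a r) * px (a u))); auto;
      [|apply ex_derive_scal; auto].
    rewrite Derive_scal. destruct (Ia v Hv) as [_ Lv]. unfold legendrian_at in Lv.
    change (dz a v - py (a r) * dx a v = (py (a v) - py (a r)) * dx a v).
    rewrite Lv. ring. }
  destruct (mvt f s r) as [c [Hc Ec]]; auto; [lra|].
  rewrite DfE in Ec by lra.
  destruct (mvt f r u) as [c' [Hc' Ec']]; auto; [lra|].
  rewrite DfE in Ec' by lra.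
  specialize (X1 c ltac:(lra)). specialize (X2 c' ltac:(lra)).
  specialize (Yl c ltac:(lra)). specialize (Yg c' ltac:(lra)).
  assert (0 < (py (a r) - py (a c)) * dx a c * (r - s)) by (repeat apply Rmult_lt_0_compat; lra).
  assert (0 < (py (a c') - py (a r)) * (- dx a c') * (u - r)) by (repeat apply Rmult_lt_0_compat; lra).
  unfold f in Ec, Ec'. rewrite E in Ec. lra.
Qed.

Lemma closure_bounds (f : R -> R) (p q l h : R) :
  continuity f -> p < q -> (forall t, p < t < q -> l <= f t <= h) -> l <= f q <= h.
Proof.
  intros C Hpq H. split; apply Rnot_lt_le; intros Hlt;
    pose proof (C q) as Cq; rewrite continuity_pt_eps in Cq.
  - destruct (Cq (l - f q)) as [d [Hd K]]; [lra|].
    destruct (interior_point p q q d) as [u [Hu1 Hu2]]; auto; [lra|].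
    specialize (K u Hu2). specialize (H u Hu1). apply Rabs_def2 in K. lra.
  - destruct (Cq (f q - h)) as [d [Hd K]]; [lra|].
    destruct (interior_point p q q d) as [u [Hu1 Hu2]]; auto; [lra|].
    specialize (K u Hu2). specialize (H u Hu1). apply Rabs_def2 in K. lra.
Qed.

(** The direction turns clockwise from upwards through the right to downwards at the off-axis cusp,
    exactly half a turn, and then continues clockwise into the left half plane by less than another
    half turn. *)
Lemma S_angle (Phi : R2 -> R2) (L : R3 -> Prop) (a : R -> R3) (al : R -> R) (r : R) :
  arc_over Phi L a -> 0 < r < 1 ->
  (forall s, 0 < s < r -> 0 < dx a s) -> dx a r = 0 ->
  (forall s, r < s <= 1 -> dx a s < 0) -> (forall s, 0 < s <= 1 -> 0 < pz (a s)) ->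
  (forall s u, 0 < s < r -> r < u <= 1 -> px (a s) = px (a u) -> pz (a s) < pz (a u)) ->
  continuity al -> (forall s, -1 <= s <= 1 -> ang (dx a s) (dy a s) (al s)) ->
  0 < dy a 0 /\ -1 < al 1 - al 0 < - / 2.
Proof.
  intros Ha Hr X1 Xr X2 HZ HZ2 C A.
  destruct (departure_sign Phi L a r 1 1 Ha) as [X0 Y0]; [lra| | |].
  { intros s Hs. specialize (X1 s). lra. }
  { intros s Hs. specialize (HZ s). lra. }
  assert (Yr : dy a r < 0).
  { apply right_cusp_direction; auto; [apply Ha|].
    intros s Hs. destruct Ha as (_ & Ia & _). destruct (Ia s Hs) as (I1 & I2 & _). auto. }
  split; [lra|].
  destruct (ang_vertical _ _ _ (A 0 ltac:(lra)) X0) as (V0 & V1 & _).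
  destruct (ang_vertical _ _ _ (A r ltac:(lra)) Xr) as (W0 & _ & W1).
  specialize (V1 ltac:(lra)). specialize (W1 Yr).
  assert (H1 : - / 2 <= al r - al 0 <= 0).
  { apply (closure_bounds (fun t => al t - al 0) 0 r); [|lra|].
    - apply continuity_minus with (f1 := al) (f2 := fun _ => al 0); auto.
      intros x. apply continuity_pt_const. intros u v; auto.
    - intros t Ht.
      assert (H : 0 < -1 * (al t - al 0) < / 2); [|lra].
      apply (sector al 0 t (-1)); auto; [|lra].
      intros v Hv. rewrite V1.
      pose proof (ang_x_sign _ _ _ 1 (A v ltac:(lra))) as H. specialize (X1 v ltac:(lra)). lra. }
  (* The two directions are opposite, so the angle is 1/2 modulo 1; within the closed bounds of [H1]
     only -1/2 remains. *)
  assert (H2 : al r - al 0 = - / 2).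
  { assert (E : tcos (al r - al 0 + / 2) = 1).
    { rewrite tcos_plus, tcos_half, tsin_half. unfold Rminus.
      rewrite tcos_plus, tcos_opp, tsin_opp, V0, V1, W0, W1. ring. }
    destruct (tcos_1_integer _ E) as [k Hk].
    assert (k = 0%Z) by (apply small_integer, Rabs_def1; lra). subst k. simpl in Hk. lra. }
  assert (H3 : 0 < -1 * (al 1 - al r) < / 2).
  { apply (sector al r 1 (-1)); auto; [|lra].
    intros t Ht. rewrite W1.
    pose proof (ang_x_sign _ _ _ (-1) (A t ltac:(lra))) as H. specialize (X2 t Ht). lra. }
  lra.
Qed.

(** * Fronts determine Legendrian links *)

Lemma component_loop (n : nat) (g : nat -> R -> R3) (L : R3 -> Prop) (i : nat) :
  parametrizes n g L -> (i < n)%nat -> loop L (g i).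
Proof.
  intros [[Hg Hd] HL] Hi. destruct (Hg i Hi) as (H1 & H2 & _).
  split; [auto|split; auto].
  apply (component_isolated n g L i); auto.
  - intros j Hj. apply embedded_circle_embedding, Hg; auto.
Qed.

Lemma unit_parameter (b : R -> R3) (s : R) :
  (forall s, b (s + 1) = b s) -> exists u, 0 <= u <= 1 /\ b u = b s.
Proof.
  intros H. destruct (unit_interval_shift s) as [k Hk].
  exists (s + IZR k). split; [lra|]. apply periodic_Z; auto.
Qed.

(** A link is a finite union of compact curves, so a point off it has a positive distance from
    it. *)
Lemma link_closed (n : nat) (g : nat -> R -> R3) (L : R3 -> Prop) (P : R3) :
  parametrizes n g L -> (forall d, 0 < d -> exists Q, L Q /\ near d Q P) -> L P.
Proof.
  intros HP H. apply NNPP. intros Hn.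
  pose proof HP as [[Hg _] HL].
  destruct (finite_uniform (seq 0 n) (fun i d => forall s, 0 <= s <= 1 -> ~ near d (g i s) P))
    as [d [Hd K]].
  - intros i d d' Hdd K s Hs Hne. apply (K s Hs). apply near_weaken with d'; auto; lra.
  - intros i Hi. apply in_seq in Hi.
    apply (compact_uniform 0 1 (fun s d => ~ near d (g i s) P)).
    + intros s d d' Hdd K Hne. apply K. apply near_weaken with d'; auto; lra.
    + intros s Hs. destruct (near_separate (g i s) P) as [d [Hd K]].
      { intros E. apply Hn. apply HL. exists i. split; [lia|]. exists s; auto. }
      destruct (cont3_near (g i) s (d / 2)) as [e [He Ke]]; [|lra|].
      { apply embedded_circle_embedding, Hg. lia. }
      exists (Rmin (d / 2) e). pose proof (Rmin_l (d / 2) e). pose proof (Rmin_r (d / 2) e).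
      split; [apply Rmin_glb_lt; lra|]. intros s' Hs' Hne. apply K.
      replace d with (d / 2 + d / 2) by field.
      apply near_trans with (g i s'); [apply near_sym, Ke; lra|].
      apply near_weaken with (2 := Hne); auto.
  - destruct (H d Hd) as [Q [HQ Hne]]. apply HL in HQ. destruct HQ as [i [Hi [s Es]]].
    destruct (unit_parameter (g i) s) as [u [Hu Eu]]; [apply Hg; auto|].
    apply (K i) with u; auto; [apply in_seq; lia|]. rewrite Eu, Es. auto.
Qed.

(** * Slopes of a front and the y-coordinate *)

Definition regular_or_cusp (a : R -> R3) (s : R) : Prop := singular a s -> semicubical a s.

(** At a zero of x' the relation z' = y x' gives z'' = y x''. If x'' vanished too, so would the
    determinant defining a semicubical cusp; hence x'' is nonzero and the zero of x' is isolated. *)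
Lemma punctured_regular (a : R -> R3) (s : R) :
  smooth_curve a -> (forall u, legendrian_at a u) -> regular_or_cusp a s ->
  exists e, 0 < e /\ forall u, 0 < Rabs (u - s) < e -> dx a u <> 0.
Proof.
  intros Sa La Hc. pose proof Sa as (S1 & S2 & S3).
  destruct (Req_dec (dx a s) 0) as [E|E].
  - assert (Hs : singular a s).
    { split; auto. rewrite (La s), E. ring. }
    specialize (Hc Hs). unfold semicubical in Hc.
    set (X2 := Derive (dx a) s).
    assert (E2 : Derive_n (fun u => px (a u)) 2 s = X2) by reflexivity.
    assert (E3 : Derive_n (fun u => pz (a u)) 2 s = py (a s) * X2).
    { change (Derive_n (fun u => pz (a u)) 2 s) with (Derive (dz a) s).
      rewrite (Derive_ext (dz a) (fun u => py (a u) * dx a u)) by (intros; apply La).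
      rewrite (Derive_mult (fun u => py (a u)) (dx a)).
      - rewrite E. unfold X2. ring.
      - apply (smooth_ex_derive (fun u => py (a u))); auto.
      - apply smooth_ex_derive, smooth_Derive; auto. }
    rewrite E2, E3 in Hc.
    assert (Hx : X2 <> 0) by (intros Z; apply Hc; rewrite Z; ring).
    apply Rabs_pos_lt in Hx.
    destruct (Derive_eps (dx a) s) with (eps := Rabs X2 / 2) as [d [Hd K]]; [|lra|].
    { apply smooth_ex_derive, smooth_Derive; auto. }
    exists d. split; auto. intros u [Hu1 Hu2] Z. specialize (K (u - s) Hu2).
    replace (s + (u - s)) with u in K by ring. rewrite E, Z in K.
    replace (0 - 0 - Derive (dx a) s * (u - s)) with (- (X2 * (u - s))) in K by (unfold X2; ring).
    rewrite Rabs_Ropp, Rabs_mult in K. nra.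
  - pose proof (dx_continuity a Sa s) as C. rewrite continuity_pt_eps in C.
    destruct (C (Rabs (dx a s))) as [d [Hd K]]; [apply Rabs_pos_lt; auto|].
    exists d. split; auto. intros u [_ Hu] Z. specialize (K u Hu). rewrite Z in K.
    rewrite Rminus_0_l, Rabs_Ropp in K. lra.
Qed.

(** This is Cauchy's mean value theorem for the pair (x, z), where the quotient of derivatives is
    y. *)
Lemma secant_between (a : R -> R3) (p q : R) :
  smooth_curve a -> (forall u, legendrian_at a u) -> p < q ->
  (forall u, p < u < q -> dx a u <> 0) ->
  px (a q) <> px (a p) /\
  exists c, p < c < q /\ pz (a q) - pz (a p) = py (a c) * (px (a q) - px (a p)).
Proof.
  intros (S1 & S2 & S3) La Hpq H.
  assert (Ex : forall s, ex_derive (fun u => px (a u)) s)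
    by (intros; apply (smooth_ex_derive (fun u => px (a u))); auto).
  assert (Ez : forall s, ex_derive (fun u => pz (a u)) s)
    by (intros; apply (smooth_ex_derive (fun u => pz (a u))); auto).
  split.
  - destruct (mvt (fun u => px (a u)) p q) as [c [Hc Ec]]; auto.
    cbv beta in Ec. specialize (H c Hc). intros E. rewrite E, Rminus_diag in Ec.
    symmetry in Ec. apply Rmult_integral in Ec. destruct Ec; [auto|lra].
  - set (DX := px (a q) - px (a p)). set (DZ := pz (a q) - pz (a p)).
    assert (Ef : forall v, ex_derive (fun v => DX * pz (a v) - DZ * px (a v)) v).
    { intros v. apply (ex_derive_minus (fun v => DX * pz (a v)) (fun v => DZ * px (a v)));
        apply ex_derive_scal; auto. }
    destruct (mvt (fun v => DX * pz (a v) - DZ * px (a v)) p q) as [c [Hc Ec]]; auto.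
    exists c. split; auto.
    rewrite (Derive_minus (fun v => DX * pz (a v)) (fun v => DZ * px (a v))) in Ec
      by (apply ex_derive_scal; auto).
    rewrite !Derive_scal in Ec.
    change (DX * pz (a q) - DZ * px (a q) - (DX * pz (a p) - DZ * px (a p)) =
      (DX * dz a c - DZ * dx a c) * (q - p)) in Ec.
    specialize (La c). unfold legendrian_at in La. rewrite La in Ec.
    specialize (H c Hc).
    assert (E0 : (DX * (py (a c) * dx a c) - DZ * dx a c) * (q - p) = 0).
    { rewrite <- Ec. unfold DX, DZ. ring. }
    apply Rmult_integral in E0. destruct E0 as [E0|E0]; [|lra].
    apply Rmult_eq_reg_r with (dx a c); auto. lra.
Qed.

(** Secants of the front converge to slope y even at a cusp, where the derivative of the projection
    vanishes. *)
Lemma secant_slope (a : R -> R3) (s eta : R) :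
  smooth_curve a -> (forall u, legendrian_at a u) -> regular_or_cusp a s -> 0 < eta ->
  exists e, 0 < e /\ forall u, 0 < Rabs (u - s) < e ->
    px (a u) <> px (a s) /\
    Rabs (pz (a u) - pz (a s) - py (a s) * (px (a u) - px (a s))) <=
      eta * Rabs (px (a u) - px (a s)).
Proof.
  intros Sa La Hc He. destruct (punctured_regular a s Sa La Hc) as [e1 [He1 K1]].
  destruct (cont3_near a s eta) as [e2 [He2 K2]]; auto; [apply smooth_curve_cont3; auto|].
  exists (Rmin e1 e2). pose proof (Rmin_l e1 e2). pose proof (Rmin_r e1 e2).
  split; [apply Rmin_glb_lt; auto|]. intros u [Hu1 Hu2].
  assert (E : px (a u) <> px (a s) /\ exists c, Rabs (c - s) < Rabs (u - s) /\
     pz (a u) - pz (a s) = py (a c) * (px (a u) - px (a s))).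
  { assert (Hne : u <> s) by (intros ->; rewrite Rminus_diag, Rabs_R0 in Hu1; lra).
    destruct (Rle_dec s u).
    - destruct (secant_between a s u) as [Hx [c [Hc1 Hc2]]]; auto; [lra| |].
      { intros v Hv. apply K1. rewrite Rabs_right in * by lra. lra. }
      split; auto. exists c. split; auto. rewrite !Rabs_right by lra. lra.
    - destruct (secant_between a u s) as [Hx [c [Hc1 Hc2]]]; auto; [lra| |].
      { intros v Hv. apply K1. rewrite Rabs_left in * by lra. lra. }
      split; [auto|]. exists c. split; [rewrite !Rabs_left by lra; lra|]. lra. }
  destruct E as [Hx [c [Hc1 Hc2]]]. split; auto.
  rewrite Hc2. rewrite <- Rmult_minus_distr_r, Rabs_mult.
  apply Rmult_le_compat_r; [apply Rabs_pos|]. left. apply (K2 c). lra.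
Qed.

Lemma front_proj_eq (P Q : R3) : front_proj P = front_proj Q -> px P = px Q /\ pz P = pz Q.
Proof. intros E. injection E; auto. Qed.

(* Two branches over the same front points near a point have the same slopes there. *)
Lemma front_determines_point (n : nat) (g : nat -> R -> R3) (L : R3 -> Prop)
    (a : R -> R3) (s0 e : R) :
  parametrizes n g L -> generic_front n g ->
  smooth_curve a -> (forall u, legendrian_at a u) -> regular_or_cusp a s0 -> 0 < e ->
  (forall h, Rabs h < e -> front L (front_proj (a (s0 + h)))) -> L (a s0).
Proof.
  intros HP [Hg _] Sa La Ha He Hf. apply NNPP. intros Hn.
  pose proof HP as [[Hc _] HL].
  assert (Ca : cont3 a) by (apply smooth_curve_cont3; auto).
  (* The value h = 0 is excluded: a strand of [L] may pass over the very front point of [a s0] with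
     a different slope. *)
  destruct (finite_uniform (seq 0 n) (fun i d => forall s, 0 <= s <= 1 ->
      forall h, 0 < Rabs h < d -> front_proj (g i s) <> front_proj (a (s0 + h))))
    as [d [Hd K]].
  - intros i d d' Hdd K s Hs h Hh. apply K; auto. lra.
  - intros i Hi. apply in_seq in Hi.
    apply (compact_uniform 0 1 (fun s d =>
      forall h, 0 < Rabs h < d -> front_proj (g i s) <> front_proj (a (s0 + h)))).
    + intros s d d' Hdd K h Hh. apply K. lra.
    + intros s Hs. destruct (Hc i) as ((Si & _) & Li & _); [lia|].
      assert (Ci : cont3 (g i)) by (apply smooth_curve_cont3; auto).
      destruct (classic (front_proj (g i s) = front_proj (a s0))) as [E|E].
      * apply front_proj_eq in E. destruct E as [E1 E2].
        assert (Hy : py (g i s) <> py (a s0)).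
        { intros E3. apply Hn. apply HL. exists i. split; [lia|]. exists s. apply R3_ext; auto. }
        (* Secants with a common end, each within a third of the slope difference of its own limit
           slope, cannot coincide. *)
        set (eta := Rabs (py (g i s) - py (a s0)) / 3).
        assert (Heta : 0 < eta) by (unfold eta; apply Rdiv_lt_0_compat; [apply Rabs_pos_lt|]; lra).
        destruct (secant_slope a s0 eta) as [d1 [Hd1 K1]]; auto.
        destruct (secant_slope (g i) s eta) as [d2 [Hd2 K2]]; auto.
        { intros Hsing. apply Hg; [lia|auto]. }
        exists (Rmin d1 d2). pose proof (Rmin_l d1 d2). pose proof (Rmin_r d1 d2).
        split; [apply Rmin_glb_lt; auto|]. intros s' Hs' h Hh E.
        apply front_proj_eq in E. destruct E as [E3 E4].
        destruct (K1 (s0 + h)) as [I1 I2]; [replace (s0 + h - s0) with h by ring; lra|].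
        destruct (K2 s') as [I3 I4].
        { split; [|lra]. apply Rabs_pos_lt. intros Z. replace s' with s in * by lra.
          apply I1. congruence. }
        rewrite E3, E4, E1, E2 in I4.
        set (DX := px (a (s0 + h)) - px (a s0)) in *.
        set (DZ := pz (a (s0 + h)) - pz (a s0)) in *.
        assert (HDX : 0 < Rabs DX) by (apply Rabs_pos_lt; unfold DX; lra).
        assert (I5 : Rabs ((py (g i s) - py (a s0)) * DX) <= 2 * eta * Rabs DX).
        { replace ((py (g i s) - py (a s0)) * DX)
            with ((DZ - py (a s0) * DX) + - (DZ - py (g i s) * DX)) by ring.
          eapply Rle_trans; [apply Rabs_triang|]. rewrite Rabs_Ropp. lra. }
        rewrite Rabs_mult in I5.
        assert (Rabs (py (g i s) - py (a s0)) = 3 * eta) by (unfold eta; field). nra.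
      * assert (S : exists r, 0 < r /\ (r <= Rabs (px (g i s) - px (a s0)) \/
                                         r <= Rabs (pz (g i s) - pz (a s0)))).
        { destruct (Req_dec (px (g i s)) (px (a s0))) as [E1|E1].
          - destruct (Req_dec (pz (g i s)) (pz (a s0))) as [E2|E2].
            + exfalso. apply E. unfold front_proj. rewrite E1, E2; auto.
            + exists (Rabs (pz (g i s) - pz (a s0))). split; [apply Rabs_pos_lt; lra|right; lra].
          - exists (Rabs (px (g i s) - px (a s0))). split; [apply Rabs_pos_lt; lra|left; lra]. }
        destruct S as [r [Hr Sep]].
        destruct (cont3_near a s0 (r / 2)) as [d1 [Hd1 K1]]; auto; [lra|].
        destruct (cont3_near (g i) s (r / 2)) as [d2 [Hd2 K2]]; auto; [lra|].
        exists (Rmin d1 d2). pose proof (Rmin_l d1 d2). pose proof (Rmin_r d1 d2).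
        split; [apply Rmin_glb_lt; auto|]. intros s' Hs' h Hh Ef.
        apply front_proj_eq in Ef. destruct Ef as [E3 E4].
        destruct (K1 (s0 + h)) as (A1 & _ & A3); [replace (s0 + h - s0) with h by ring; lra|].
        destruct (K2 s') as (B1 & _ & B3); [lra|].
        rewrite <- E3 in A1. rewrite <- E4 in A3.
        apply Rabs_def2 in A1, A3, B1, B3.
        destruct Sep as [Sep|Sep]; unfold Rabs in Sep; destruct Rcase_abs in Sep; lra.
  - destruct (Hf (Rmin d e / 2)) as [P [HPL EP]].
    { pose proof (Rmin_r d e). assert (0 < Rmin d e) by (apply Rmin_glb_lt; auto).
      rewrite Rabs_right; lra. }
    apply HL in HPL. destruct HPL as [i [Hi [s Es]]].
    destruct (unit_parameter (g i) s) as [u [Hu Eu]]; [apply Hc; auto|].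
    apply (K i) with (s := u) (h := Rmin d e / 2); auto; [apply in_seq; lia| |].
    { pose proof (Rmin_l d e). assert (0 < Rmin d e) by (apply Rmin_glb_lt; auto).
      rewrite Rabs_right; lra. }
    rewrite Eu, Es. auto.
Qed.

(** Locally in space, a strand of [L'] whose front belongs to [F] belongs to [L]. With [U] trivial
    this shows that a diagram determines its link; with [U] the complement of the disk it compares
    two diagrams. *)
Lemma represents_outside (F F' : R2 -> Prop) (L L' : R3 -> Prop) (U : R3 -> Prop) :
  represents F L -> represents F' L' ->
  (forall P, L' P -> U P -> exists d, 0 < d /\ forall Q, L' Q -> near d Q P ->
     (F' (front_proj Q) -> F (front_proj Q))) ->
  forall P, L' P -> U P -> L P.
Proof.
  intros [(n & g & HP & Hg) HF] [(n' & g' & HP' & Hg') HF'] H P HL HU.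
  destruct (H P HL HU) as [d [Hd K]].
  pose proof HP' as [[Hc' _] HL']. apply HL' in HL. destruct HL as [i [Hi [s Es]]].
  destruct (Hc' i Hi) as ((Si & _) & Li & _).
  destruct (cont3_near (g' i) s d) as [e [He Ke]]; auto; [apply smooth_curve_cont3; auto|].
  subst P. apply (front_determines_point n g L (g' i) s e); auto.
  - intros Hs. apply Hg'; auto.
  - intros h Hh. apply HF.
    assert (HQ : L' (g' i (s + h))) by (apply HL'; exists i; split; auto; exists (s + h); auto).
    apply (K (g' i (s + h))); auto.
    + apply Ke. replace (s + h - s) with h by ring. auto.
    + apply HF'. exists (g' i (s + h)). auto.
Qed.

Lemma represents_unique (F : R2 -> Prop) (L L' : R3 -> Prop) :
  represents F L -> represents F L' -> forall P, L P <-> L' P.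
Proof.
  intros H H' P. split; intros HL.
  - apply (represents_outside F F L' L (fun _ => True)); auto.
    intros Q _ _. exists 1. split; [lra|auto].
  - apply (represents_outside F F L L' (fun _ => True)); auto.
    intros Q _ _. exists 1. split; [lra|auto].
Qed.

(** The points of [L'] over the disk form the compact arc [a']. A point of [L'] off the disk
    therefore has a neighbourhood in which all of [L'] projects off the disk, where the diagrams
    coincide. *)
Lemma coincide_outside_links (Phi : R2 -> R2) (F F' : R2 -> Prop) (L L' : R3 -> Prop)
    (a' : R -> R3) :
  represents F L -> represents F' L' -> coincide_outside Phi F F' -> arc_over Phi L' a' ->
  forall P, L' P -> ~ in_disk Phi (front_proj P) -> L P.
Proof.
  intros H H' Hco (Sa & _ & _ & Da).
  apply (represents_outside F F' L L' (fun P => ~ in_disk Phi (front_proj P))); auto.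
  intros P HP Hn.
  assert (Ca : cont3 a') by (apply smooth_curve_cont3; auto).
  destruct (compact_uniform (-1) 1 (fun s d => ~ near d (a' s) P)) as [d [Hd K]].
  - intros s d d' Hdd K Hne. apply K. apply near_weaken with d'; auto; lra.
  - intros s Hs. destruct (near_separate (a' s) P) as [d [Hd K]].
    { intros E. apply Hn. subst P. apply (Da (a' s)). exists s; auto. }
    destruct (cont3_near a' s (d / 2)) as [e [He Ke]]; auto; [lra|].
    exists (Rmin (d / 2) e). pose proof (Rmin_l (d / 2) e). pose proof (Rmin_r (d / 2) e).
    split; [apply Rmin_glb_lt; lra|]. intros s' Hs' Hne. apply K.
    replace d with (d / 2 + d / 2) by field.
    apply near_trans with (a' s'); [apply near_sym, Ke; lra|].
    apply near_weaken with (2 := Hne); auto.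
  - exists d. split; auto. intros Q HQ Hne HF. apply Hco; auto.
    intros Hin. destruct (proj1 (Da Q)) as [s [Hs Es]]; [split; auto|].
    apply (K s Hs). rewrite Es. auto.
Qed.

Lemma symmetric_arc_over (Phi : R2 -> R2) (e : R2) (F : R2 -> Prop) (L : R3 -> Prop)
    (a : R -> R3) :
  symmetric_arc Phi e F a -> represents F L -> arc_over Phi L a /\ front_proj (a 1) = e.
Proof.
  intros (H1 & H2 & H3 & (L1 & R1 & D1) & _ & E & _) HR.
  pose proof (represents_unique F L L1 HR R1) as U.
  split; auto. split; [auto|]. split; [auto|]. split; [auto|].
  intros P. rewrite <- D1, U. tauto.
Qed.

(** * Fixed points *)

Lemma tau_fixed (P : R3) : tau P = P <-> P = (px P, 0, 0).
Proof.
  destruct P as [[x y] z]. unfold tau, px, py, pz. simpl. split; intros E; injection E as E1 E2.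
  - assert (y = 0) by lra. assert (z = 0) by lra. congruence.
  - subst. rewrite Ropp_0. auto.
Qed.

Lemma tau_axis (x : R) : tau (x, 0, 0) = (x, 0, 0).
Proof. unfold tau, px, py, pz. simpl. rewrite Ropp_0. auto. Qed.

Lemma near_tau (d : R) (P Q : R3) : near d P Q -> near d (tau P) (tau Q).
Proof.
  unfold near, tau, px, py, pz. simpl. intros (H1 & H2 & H3).
  replace (- snd (fst P) - - snd (fst Q)) with (- (snd (fst P) - snd (fst Q))) by ring.
  replace (- snd P - - snd Q) with (- (snd P - snd Q)) by ring.
  rewrite !Rabs_Ropp. auto.
Qed.

(* Otherwise the curve is a graph over the x-axis near the fixed point, and the
   graph is pointwise fixed since [tau] preserves x. *)
Lemma fixed_point_velocity (b : R -> R3) (s0 : R) :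
  embedded_circle b -> (forall s, legendrian_at b s) -> strongly_invertible b ->
  tau (b s0) = b s0 -> dx b s0 = 0 /\ dy b s0 <> 0.
Proof.
  intros He Hl (Hsym & P & Q & HPQ & Hfix) E0.
  assert (X0 : dx b s0 = 0).
  { apply NNPP. intros Hne.
    pose proof He as (Sb & _ & _ & _). pose proof Sb as (S1 & _).
    pose proof (embedded_circle_embedding b He) as Hemb.
    pose proof (dx_continuity b Sb s0) as C. rewrite continuity_pt_eps in C.
    destruct (C (Rabs (dx b s0))) as [e [Hepos K]]; [apply Rabs_pos_lt; auto|].
    assert (Hinj : forall u v, Rabs (u - s0) < e -> Rabs (v - s0) < e -> u < v ->
      px (b u) <> px (b v)).
    { intros u v Hu Hv Huv Ex.
      destruct (mvt (fun u => px (b u)) u v) as [c [Hc Ec]]; auto.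
      { intros s; apply (smooth_ex_derive (fun u => px (b u))); auto. }
      cbv beta in Ec. rewrite Ex, Rminus_diag in Ec. symmetry in Ec.
      apply Rmult_integral in Ec. destruct Ec as [Ec|Ec]; [|lra].
      assert (Hcs : Rabs (c - s0) < e) by (apply Rabs_def2 in Hu, Hv; apply Rabs_def1; lra).
      specialize (K c Hcs). rewrite Ec, Rminus_0_l, Rabs_Ropp in K. lra. }
    destruct (curve_isolated b Hemb) as [_ HI].
    destruct (HI e Hepos) as [d [Hd Kd]].
    destruct (cont3_near b s0 d) as [r [Hr Kr]]; auto; [apply Hemb|].
    assert (Hall : forall s, Rabs (s - s0) < Rmin e r -> tau (b s) = b s).
    { intros s Hs. pose proof (Rmin_l e r). pose proof (Rmin_r e r).
      destruct (Kd s0 (tau (b s))) as [u [Hu1 Hu2]].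
      - apply Hsym. exists s. destruct (b s) as [[x y] z]. unfold tau, px, py, pz; simpl.
        rewrite !Ropp_involutive. auto.
      - rewrite <- E0. apply near_tau, Kr. lra.
      - assert (Ex : px (b u) = px (b s)) by (rewrite Hu2; auto).
        destruct (Rtotal_order u s) as [H1|[H1|H1]].
        + exfalso. apply (Hinj u s); auto; lra.
        + subst u. congruence.
        + exfalso. apply (Hinj s u); auto; lra. }
    set (h := Rmin (Rmin e r) 1).
    assert (Hh : 0 < h) by (repeat apply Rmin_glb_lt; lra).
    assert (Hh1 : h <= Rmin e r) by apply Rmin_l. assert (Hh2 : h <= 1) by apply Rmin_r.
    assert (T : forall s, Rabs (s - s0) < h -> b s = P \/ b s = Q).
    { intros s Hs. apply Hfix. split; [exists s; auto|]. apply Hall. lra. }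
    assert (D : forall s t, Rabs (s - s0) < h -> Rabs (t - s0) < h -> s < t -> t - s < 1 -> b s <> b t).
    { intros s t Hs Ht Hst Hst1 Eb.
      apply (embedding_locally_injective b s t Hemb) in Eb; [lra|]. apply Rabs_def1; lra. }
    (* Three parameters with distinct images, all fixed by [tau], against the two available fixed
       points. *)
    assert (A1 : Rabs (s0 - s0) < h) by (rewrite Rminus_diag, Rabs_R0; auto).
    assert (A2 : Rabs (s0 + h / 3 - s0) < h).
    { replace (s0 + h / 3 - s0) with (h / 3) by ring. rewrite Rabs_right; lra. }
    assert (A3 : Rabs (s0 + h / 2 - s0) < h).
    { replace (s0 + h / 2 - s0) with (h / 2) by ring. rewrite Rabs_right; lra. }
    pose proof (D _ _ A1 A2 ltac:(lra) ltac:(lra)).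
    pose proof (D _ _ A1 A3 ltac:(lra) ltac:(lra)).
    pose proof (D _ _ A2 A3 ltac:(lra) ltac:(lra)).
    destruct (T _ A1), (T _ A2), (T _ A3); congruence. }
  split; auto. intros Y0.
  pose proof (legendrian_velocity b s0) as V. rewrite X0, Y0 in V.
  assert (0 < 0 * 0 + 0 * 0) by (apply V; auto; apply He). lra.
Qed.

(* [oriented_rot b x k] : the version of [inv] for a given parametrization [b] of the
   component. *)
Definition oriented_rot (b : R -> R3) (x : R) (k : Z) : Prop :=
  exists s m, b s = (x, 0, 0) /\ is_rot b m /\
    ((0 < dy b s /\ k = m) \/ (dy b s < 0 /\ k = (- m)%Z)).

Lemma oriented_rot_inv (n : nat) (g : nat -> R -> R3) (L : R3 -> Prop) (i : nat) (x : R) (k : Z) :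
  parametrizes n g L -> (i < n)%nat -> oriented_rot (g i) x k -> inv L x k.
Proof.
  intros HP Hi (s & m & Es & Hm & Hor).
  pose proof (component_loop n g L i HP Hi) as Hb.
  pose proof Hb as (((S1 & S2 & S3) & _) & _).
  destruct Hor as [[Y ->]|[Y ->]].
  - exists (fun u => g i (1 * u + s)). split; [apply loop_reparametrize; auto|].
    split; [rewrite <- Es; f_equal; ring|].
    split; [|apply rot_shift; auto; split; auto].
    rewrite (Derive_comp_affine (fun u => py (g i u))) by auto.
    replace (1 * 0 + s) with s by ring. lra.
  - exists (fun u => g i (-1 * u + s)). split; [apply loop_reparametrize; auto|].
    split; [rewrite <- Es; f_equal; ring|].
    split; [|apply rot_reverse; auto; split; auto].
    rewrite (Derive_comp_affine (fun u => py (g i u))) by auto.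
    replace (-1 * 0 + s) with s by ring. lra.
Qed.

Lemma oriented_rot_exists (b : R -> R3) (x : R) :
  embedded_circle b -> (forall s, legendrian_at b s) -> strongly_invertible b ->
  on_curve b (x, 0, 0) -> exists k, oriented_rot b x k.
Proof.
  intros He Hl Hs [s Es]. destruct (rot_exists b He Hl) as [m Hm].
  destruct (fixed_point_velocity b s He Hl Hs) as [_ Y]; [rewrite Es; apply tau_axis|].
  destruct (Rlt_dec 0 (dy b s)).
  - exists m, s, m. auto.
  - exists (- m)%Z, s, m. split; auto. split; auto. right. split; auto. lra.
Qed.

Lemma inv_exists (n : nat) (g : nat -> R -> R3) (L : R3 -> Prop) (x : R) :
  parametrizes n g L -> L (x, 0, 0) -> exists k, inv L x k.
Proof.
  intros HP HL. pose proof HP as [[Hg _] HL']. apply HL' in HL. destruct HL as [i [Hi Hx]].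
  destruct (Hg i Hi) as (He & Hl & Hs).
  destruct (oriented_rot_exists (g i) x He Hl Hs Hx) as [k Hk].
  exists k. apply (oriented_rot_inv n g L i); auto.
Qed.

Lemma inv_ext (L L' : R3 -> Prop) (x : R) (k : Z) :
  (forall P, L P <-> L' P) -> inv L x k -> inv L' x k.
Proof.
  intros E (b & (He & Hl & HI & HI') & H). exists b. split; auto. split; [auto|]. split; [auto|].
  split; [intros s; apply E, HI|].
  intros eps Hep. destruct (HI' eps Hep) as [d [Hd K]]. exists d. split; auto.
  intros s P HP. apply K. apply E; auto.
Qed.

(** * Counting fixed points *)

Definition same_sides (L : R3 -> Prop) (c : R) (L' : R3 -> Prop) (c' : R) : Prop :=
  (forall x, (L (x, 0, 0) /\ x < c) <-> (L' (x, 0, 0) /\ x < c')) /\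
  (forall x, (L (x, 0, 0) /\ c < x) <-> (L' (x, 0, 0) /\ c' < x)).

(** By equivariance and injectivity a point of the axis comes from the horizontal diameter, and the
    diameter is mapped into the axis; so the disk meets the axis in an interval. *)
Lemma disk_axis_interval (Phi : R2 -> R2) (x1 x2 x : R) :
  symmetric_disk Phi -> in_disk Phi (x1, 0) -> in_disk Phi (x2, 0) -> x1 <= x <= x2 ->
  in_disk Phi (x, 0).
Proof.
  intros (HC & HI & HS & _) H1 H2 Hx.
  assert (Ax : forall y, in_disk Phi (y, 0) -> exists v, -1 <= v <= 1 /\ Phi (v, 0) = (y, 0)).
  { intros y [[u1 u2] [Hu Eu]]. unfold closed_unit_disk in Hu. simpl in Hu.
    assert (E : (u1, - u2) = (u1, u2)).
    { apply HI; [unfold closed_unit_disk; simpl; nra|exact Hu|].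
      pose proof (HS (u1, u2) Hu) as E. simpl in E. rewrite E, Eu. simpl. rewrite Ropp_0. auto. }
    injection E as E. assert (u2 = 0) by lra. subst u2. exists u1. split; auto. nra. }
  destruct (Ax x1 H1) as [v1 [Hv1 E1]]. destruct (Ax x2 H2) as [v2 [Hv2 E2]].
  set (f := fun s => fst (Phi (clamp (-1) 1 s, 0))).
  assert (Hin : forall s, closed_unit_disk (clamp (-1) 1 s, 0)).
  { intros s. unfold closed_unit_disk; simpl. pose proof (clamp_in (-1) 1 s). nra. }
  assert (Cf : continuity f).
  { intros s. apply continuity_pt_eps. intros eps He.
    pose proof (HC _ (Hin s)) as HC'.
    pose proof (proj1 (filterlim_locally Phi _) HC' (mkposreal eps He)) as [d Hd].
    pose proof (clamp_continuity (-1) 1 s) as Cc. rewrite continuity_pt_eps in Cc.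
    destruct (Cc d (cond_pos d)) as [d' [Hd' K]].
    exists d'. split; auto. intros y Hy.
    assert (B : ball (Phi (clamp (-1) 1 s, 0)) eps (Phi (clamp (-1) 1 y, 0))).
    { apply Hd; auto. split; simpl; [apply K; auto|apply ball_center]. }
    destruct B as [B _]. exact B. }
  assert (F1 : f v1 = x1) by (unfold f; rewrite clamp_id, E1; auto).
  assert (F2 : f v2 = x2) by (unfold f; rewrite clamp_id, E2; auto).
  assert (Hs : exists s, f s = x).
  { destruct (Rle_dec v1 v2).
    - destruct (ivt f v1 v2 x) as [s [_ Es]]; auto; [lra|]. exists s; auto.
    - destruct (ivt f v2 v1 x) as [s [_ Es]]; auto; [lra|lra|]. exists s; auto. }
  destruct Hs as [s Es]. exists (clamp (-1) 1 s, 0). split; auto.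
  pose proof (HS _ (Hin s)) as E. simpl in E. rewrite Ropp_0 in E.
  apply (f_equal snd) in E. simpl in E.
  unfold f in Es. destruct (Phi (clamp (-1) 1 s, 0)) as [w1 w2]. simpl in *.
  f_equal; lra.
Qed.

(** A fixed point on the arc satisfies [a (- s) = a s], which by injectivity leaves only the
    midpoint. *)
Lemma arc_axis_point (Phi : R2 -> R2) (L : R3 -> Prop) (a : R -> R3) :
  arc_over Phi L a -> a 0 = (px (a 0), 0, 0) /\ in_disk Phi (px (a 0), 0) /\
    L (px (a 0), 0, 0) /\
    forall x, L (x, 0, 0) -> in_disk Phi (x, 0) -> x = px (a 0).
Proof.
  intros (_ & Ia & Ja & Da).
  destruct (Ia 0) as (_ & _ & E0); [lra|]. rewrite Ropp_0 in E0. symmetry in E0.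
  apply tau_fixed in E0.
  destruct (proj2 (Da (a 0))) as [H1 H2]; [exists 0; split; auto; lra|].
  split; auto. split; [|split].
  - rewrite E0 in H2. exact H2.
  - rewrite <- E0. auto.
  - intros x Hx Hd. destruct (proj1 (Da (x, 0, 0))) as [s [Hs Es]]; [split; auto|].
    destruct (Ia s Hs) as (_ & _ & E). rewrite Es, tau_axis, <- Es in E.
    apply Ja in E; try lra. assert (s = 0) by lra. subst s. rewrite Es. auto.
Qed.

(** All other fixed points lie off the disk and are common to both links. None of them separates the
    two midpoints, since the interval between these lies in the disk. *)
Lemma disk_same_sides (Phi : R2 -> R2) (L L' : R3 -> Prop) (a a' : R -> R3) :
  symmetric_disk Phi -> arc_over Phi L a -> arc_over Phi L' a' ->
  (forall P, ~ in_disk Phi (front_proj P) -> (L P <-> L' P)) ->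
  same_sides L (px (a 0)) L' (px (a' 0)).
Proof.
  intros HP Ha Ha' Hout.
  destruct (arc_axis_point Phi L a Ha) as (_ & D & _ & U).
  destruct (arc_axis_point Phi L' a' Ha') as (_ & D' & _ & U').
  pose proof (fun x => disk_axis_interval Phi (px (a 0)) (px (a' 0)) x HP D D') as I.
  pose proof (fun x => disk_axis_interval Phi (px (a' 0)) (px (a 0)) x HP D' D) as I'.
  set (c := px (a 0)) in *. set (c' := px (a' 0)) in *.
  assert (N : forall x, L (x, 0, 0) -> x <> c -> ~ in_disk Phi (x, 0)) by (intros x Hx Hne Hd; auto).
  assert (N' : forall x, L' (x, 0, 0) -> x <> c' -> ~ in_disk Phi (x, 0)) by (intros x Hx Hne Hd; auto).
  assert (O : forall x, ~ in_disk Phi (x, 0) -> (L (x, 0, 0) <-> L' (x, 0, 0)))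
    by (intros x Hx; apply Hout; auto).
  assert (Hl : forall x, ~ in_disk Phi (x, 0) -> (x < c <-> x < c')).
  { intros x Hx. specialize (I x). specialize (I' x). split; intros H; apply Rnot_le_lt; intros Hle.
    - apply Hx, I'; lra.
    - apply Hx, I; lra. }
  assert (Hr : forall x, ~ in_disk Phi (x, 0) -> (c < x <-> c' < x)).
  { intros x Hx. specialize (I x). specialize (I' x). split; intros H; apply Rnot_le_lt; intros Hle.
    - apply Hx, I; lra.
    - apply Hx, I'; lra. }
  split; intros x; split; intros [H1 H2].
  - assert (Hn : ~ in_disk Phi (x, 0)) by (apply N; auto; lra).
    split; [apply O|apply Hl]; auto.
  - assert (Hn : ~ in_disk Phi (x, 0)) by (apply N'; auto; lra).
    split; [apply O|apply Hl]; auto.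
  - assert (Hn : ~ in_disk Phi (x, 0)) by (apply N; auto; lra).
    split; [apply O|apply Hr]; auto.
  - assert (Hn : ~ in_disk Phi (x, 0)) by (apply N'; auto; lra).
    split; [apply O|apply Hr]; auto.
Qed.

Definition enumerates (N : nat) (A : R -> Prop) : Prop :=
  exists l, NoDup l /\ length l = N /\ forall x, In x l <-> A x.

(** The position of a fixed point in the order along the axis, which serves to recognize it after an
    isotopy or a local change. *)
Definition nleft (L : R3 -> Prop) (c : R) (N : nat) : Prop :=
  enumerates N (fun x => L (x, 0, 0) /\ x < c).

Lemma enumerates_unique (N N' : nat) (A : R -> Prop) :
  enumerates N A -> enumerates N' A -> N = N'.
Proof.
  intros (l & D & <- & H) (l' & D' & <- & H').
  apply Permutation_length, NoDup_Permutation; auto.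
  intros x. rewrite H, H'. tauto.
Qed.

Lemma enumerates_ext (N : nat) (A B : R -> Prop) :
  (forall x, A x <-> B x) -> enumerates N A -> enumerates N B.
Proof.
  intros E (l & D & Hl & H). exists l. split; auto. split; auto.
  intros x. rewrite H. apply E.
Qed.

Lemma nleft_injective (L : R3 -> Prop) (c c' : R) (N : nat) :
  L (c, 0, 0) -> L (c', 0, 0) -> nleft L c N -> nleft L c' N -> c = c'.
Proof.
  assert (W : forall c c', L (c, 0, 0) -> c < c' -> nleft L c N -> nleft L c' N -> False).
  { clear. intros c c' Hc Hlt (l & D & E & H) (l' & D' & E' & H').
    assert (Hle : (length (c :: l) <= length l')%nat).
    { apply NoDup_incl_length.
      - constructor; auto. intros Hin. apply H in Hin. lra.
      - intros x [<-|Hx]; apply H'; [split; auto|]. apply H in Hx. split; [tauto|lra]. }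
    simpl in Hle. lia. }
  intros Hc Hc' H H'. destruct (Rtotal_order c c') as [Hlt|[Heq|Hlt]]; auto; exfalso.
  - apply (W c c'); auto.
  - apply (W c' c); auto.
Qed.

Definition axis_points (b : R -> R3) (xl xr : R) : Prop :=
  xl < xr /\ forall x, on_curve b (x, 0, 0) <-> (x = xl \/ x = xr).

Lemma axis_points_exist (b : R -> R3) :
  strongly_invertible b -> exists xl xr, axis_points b xl xr.
Proof.
  intros (_ & P & Q & HPQ & H).
  destruct (proj2 (H P)) as [HP TP]; [auto|]. destruct (proj2 (H Q)) as [HQ TQ]; [auto|].
  apply tau_fixed in TP, TQ. set (p := px P) in *. set (q := px Q) in *.
  assert (E : forall x, on_curve b (x, 0, 0) <-> (x = p \/ x = q)).
  { intros x. split.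
    - intros Hx. destruct (proj1 (H (x, 0, 0))) as [E|E]; [split; [auto|apply tau_axis]| |].
      + left. exact (f_equal px E).
      + right. exact (f_equal px E).
    - intros [-> | ->]; [rewrite <- TP|rewrite <- TQ]; auto. }
  destruct (Rtotal_order p q) as [Hlt|[Heq|Hlt]].
  - exists p, q. split; auto.
  - exfalso. apply HPQ. congruence.
  - exists q, p. split; auto. intros x. rewrite E. tauto.
Qed.

(** The label [true] stands for the left and [false] for the right fixed point of a component. *)
Definition fixed_indices (n : nat) : list (nat * bool) := list_prod (seq 0 n) (true :: false :: nil).

Lemma in_fixed_indices (n : nat) (j : nat * bool) : In j (fixed_indices n) <-> (fst j < n)%nat.
Proof.
  destruct j as [i e]. unfold fixed_indices. rewrite in_prod_iff, in_seq. simpl.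
  split; [lia|]. intros H. split; [lia|]. destruct e; auto.
Qed.

Lemma fixed_indices_NoDup (n : nat) : NoDup (fixed_indices n).
Proof.
  unfold fixed_indices. generalize (seq_NoDup n 0). generalize (seq 0 n).
  intros l. induction l as [|a l IH]; intros D; simpl; [constructor|].
  inversion D; subst. constructor; [|constructor; auto].
  - intros [E|Hin]; [discriminate|]. apply in_prod_iff in Hin. tauto.
  - intros Hin. apply in_prod_iff in Hin. tauto.
Qed.

Definition numbers_fixed_points (n : nat) (g : nat -> R -> R3) (X : nat * bool -> R) : Prop :=
  forall i, (i < n)%nat -> axis_points (g i) (X (i, true)) (X (i, false)).

Lemma numbering_exists (n : nat) (g : nat -> R -> R3) :
  si_legendrian n g -> exists X, numbers_fixed_points n g X.
Proof.
  intros [Hg _].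
  assert (C : forall i, exists p : R * R, (i < n)%nat -> axis_points (g i) (fst p) (snd p)).
  { intros i. destruct (classic (i < n)%nat) as [Hi|Hi].
    - destruct (Hg i Hi) as (_ & _ & Hs). destruct (axis_points_exist _ Hs) as (xl & xr & H).
      exists (xl, xr). auto.
    - exists (0, 0). tauto. }
  apply functional_choice in C. destruct C as [f Hf].
  exists (fun j : nat * bool => if snd j then fst (f (fst j)) else snd (f (fst j))).
  intros i Hi. simpl. auto.
Qed.

Lemma numbering_on_curve (n : nat) (g : nat -> R -> R3) (X : nat * bool -> R) (j : nat * bool) :
  numbers_fixed_points n g X -> In j (fixed_indices n) -> on_curve (g (fst j)) (X j, 0, 0).
Proof.
  intros H Hj. apply in_fixed_indices in Hj. destruct (H _ Hj) as [_ K].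
  apply K. destruct j as [i [|]]; simpl; auto.
Qed.

Lemma numbering_spec (n : nat) (g : nat -> R -> R3) (L : R3 -> Prop) (X : nat * bool -> R) (x : R) :
  parametrizes n g L -> numbers_fixed_points n g X ->
  (L (x, 0, 0) <-> exists j, In j (fixed_indices n) /\ X j = x).
Proof.
  intros [_ HL] HX. rewrite HL. split.
  - intros [i [Hi Hx]]. apply HX in Hx; auto. destruct Hx as [-> | ->].
    + exists (i, true). split; auto. apply in_fixed_indices; auto.
    + exists (i, false). split; auto. apply in_fixed_indices; auto.
  - intros [j [Hj <-]]. exists (fst j). split; [apply in_fixed_indices; auto|].
    apply (numbering_on_curve n); auto.
Qed.

Lemma numbering_injective (n : nat) (g : nat -> R -> R3) (X : nat * bool -> R) (j k : nat * bool) :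
  si_legendrian n g -> numbers_fixed_points n g X ->
  In j (fixed_indices n) -> In k (fixed_indices n) -> X j = X k -> j = k.
Proof.
  intros [_ Hd] HX Hj Hk E.
  pose proof (numbering_on_curve n g X j HX Hj) as [s Hs].
  pose proof (numbering_on_curve n g X k HX Hk) as [t Ht].
  apply in_fixed_indices in Hj, Hk.
  destruct (Nat.eq_dec (fst j) (fst k)) as [Ei|Ni].
  - destruct j as [i e], k as [i' e']. simpl in *. subst i'.
    destruct (HX i Hj) as [Hlt _]. destruct e, e'; auto; lra.
  - exfalso. apply (Hd _ _ s t Hj Hk Ni). congruence.
Qed.

(** The selection uses [Y] while the listed points are given by [X]: with [Y] the positions at time
    0 and [X] those at either end, the counts at both times are lengths of the same list. *)
Lemma enumerates_filter (n : nat) (g : nat -> R -> R3) (X Y : nat * bool -> R) (c : R) :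
  si_legendrian n g -> numbers_fixed_points n g X ->
  enumerates (length (filter (fun j => if Rlt_dec (Y j) c then true else false) (fixed_indices n)))
    (fun x => exists j, In j (fixed_indices n) /\ Y j < c /\ X j = x).
Proof.
  intros Hg HX. set (p := fun j => if Rlt_dec (Y j) c then true else false).
  assert (Hp : forall j, p j = true <-> Y j < c).
  { intros j. unfold p. destruct Rlt_dec; split; auto; try discriminate; lra. }
  exists (map X (filter p (fixed_indices n))). split; [|split].
  - apply Injective_map_NoDup_in.
    + intros j k Hj Hk. apply filter_In in Hj, Hk. apply (numbering_injective n g); tauto.
    + apply NoDup_filter, fixed_indices_NoDup.
  - apply length_map.
  - intros x. rewrite in_map_iff. split.
    + intros [j [E Hj]]. apply filter_In in Hj. rewrite Hp in Hj. exists j. tauto.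
    + intros [j [Hj [Hlt E]]]. exists j. split; auto. apply filter_In. rewrite Hp. auto.
Qed.

(** The number of fixed points recovers the number of components from the subset alone. *)
Lemma enumerates_all (n : nat) (g : nat -> R -> R3) (L : R3 -> Prop) :
  parametrizes n g L -> enumerates (n * 2) (fun x => L (x, 0, 0)).
Proof.
  intros HP. pose proof HP as [Hg _]. destruct (numbering_exists n g Hg) as [X HX].
  exists (map X (fixed_indices n)). split; [|split].
  - apply Injective_map_NoDup_in; [|apply fixed_indices_NoDup].
    intros j k Hj Hk. apply (numbering_injective n g); auto.
  - rewrite length_map. unfold fixed_indices. rewrite length_prod, length_seq. auto.
  - intros x. rewrite in_map_iff, (numbering_spec n g L X) by auto.
    split; intros [j H]; exists j; tauto.
Qed.

Lemma nleft_exists (n : nat) (g : nat -> R -> R3) (L : R3 -> Prop) (c : R) :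
  parametrizes n g L -> exists N, nleft L c N.
Proof.
  intros HP. pose proof HP as [Hg _]. destruct (numbering_exists n g Hg) as [X HX].
  eexists. apply enumerates_ext with (2 := enumerates_filter n g X X c Hg HX).
  intros x. rewrite (numbering_spec n g L X x HP HX). split.
  - intros [j [Hj [Hlt E]]]. rewrite E in Hlt. split; auto. exists j; auto.
  - intros [[j [Hj E]] Hlt]. exists j. rewrite E. auto.
Qed.

(** * Fixed points along an isotopy *)

Lemma continuity_2d_eps (f : R -> R -> R) (t s : R) :
  continuity_2d_pt f t s -> forall eps, 0 < eps -> exists d, 0 < d /\
    forall t' s', Rabs (t' - t) < d -> Rabs (s' - s) < d -> Rabs (f t' s' - f t s) < eps.
Proof.
  intros H eps He. destruct (H (mkposreal eps He)) as [d Hd]. exists d.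
  split; [apply cond_pos|]. intros t' s' H1 H2. apply Hd; auto.
Qed.

Lemma smooth2_continuous (f : R -> R -> R) (t s : R) : smooth2 f -> continuity_2d_pt f t s.
Proof. intros H. destruct (H 0%nat) as [H0 _]. auto. Qed.

Lemma smooth2_Derive_continuous (f : R -> R -> R) (t s : R) :
  smooth2 f -> continuity_2d_pt (fun t s => Derive (fun s' => f t s') s) t s.
Proof. intros H. destruct (H 1%nat) as (_ & _ & _ & H0 & _). auto. Qed.

Definition si_family (c : R -> R -> R3) : Prop :=
  smooth_family c /\
  forall t, 0 <= t <= 1 ->
    embedded_circle (c t) /\ (forall s, legendrian_at (c t) s) /\ strongly_invertible (c t).

Lemma family_velocity_eps (c : R -> R -> R3) (t s eps : R) :
  smooth_family c -> 0 < eps -> exists d, 0 < d /\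
    forall t' s', Rabs (t' - t) < d -> Rabs (s' - s) < d ->
      Rabs (dx (c t') s' - dx (c t) s) < eps /\ Rabs (dy (c t') s' - dy (c t) s) < eps.
Proof.
  intros (S1 & S2 & _) He.
  destruct (continuity_2d_eps _ t s (smooth2_Derive_continuous _ t s S1) eps He) as [d1 [D1 K1]].
  destruct (continuity_2d_eps _ t s (smooth2_Derive_continuous _ t s S2) eps He) as [d2 [D2 K2]].
  exists (Rmin d1 d2). pose proof (Rmin_l d1 d2). pose proof (Rmin_r d1 d2).
  split; [apply Rmin_glb_lt; auto|]. intros t' s' Ht Hs.
  split; [apply K1|apply K2]; lra.
Qed.

Lemma family_near (c : R -> R -> R3) (t s eps : R) :
  smooth_family c -> 0 < eps -> exists d, 0 < d /\
    forall t' s', Rabs (t' - t) < d -> Rabs (s' - s) < d -> near eps (c t' s') (c t s).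
Proof.
  intros (S1 & S2 & S3) He.
  destruct (continuity_2d_eps _ t s (smooth2_continuous _ t s S1) eps He) as [d1 [D1 K1]].
  destruct (continuity_2d_eps _ t s (smooth2_continuous _ t s S2) eps He) as [d2 [D2 K2]].
  destruct (continuity_2d_eps _ t s (smooth2_continuous _ t s S3) eps He) as [d3 [D3 K3]].
  exists (Rmin d1 (Rmin d2 d3)). pose proof (Rmin_l d1 (Rmin d2 d3)).
  pose proof (Rmin_r d1 (Rmin d2 d3)). pose proof (Rmin_l d2 d3). pose proof (Rmin_r d2 d3).
  split; [repeat apply Rmin_glb_lt; auto|]. intros t' s' Ht Hs.
  split; [apply K1; lra|split; [apply K2; lra|apply K3; lra]].
Qed.

Lemma family_rot_constant (c : R -> R -> R3) (t0 : R) (m : Z) :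
  si_family c -> 0 <= t0 <= 1 -> is_rot (c t0) m ->
  exists d, 0 < d /\ forall t, 0 <= t <= 1 -> Rabs (t - t0) < d -> is_rot (c t) m.
Proof.
  intros [Sc Hc] Ht0 Hm. destruct (Hc t0 Ht0) as (He0 & Hl0 & _).
  destruct (compact_uniform 0 1 (fun s d => forall t, Rabs (t - t0) < d ->
    0 < dx (c t0) s * dx (c t) s + dy (c t0) s * dy (c t) s)) as [d [Hd K]].
  - intros s d d' Hdd K t Ht. apply K. lra.
  - intros s _. pose proof (legendrian_velocity (c t0) s) as V.
    specialize (V ltac:(apply He0) (Hl0 s)).
    set (X := dx (c t0) s) in *. set (Y := dy (c t0) s) in *.
    set (M := Rabs X + Rabs Y + 1).
    assert (HM : 1 <= M) by (unfold M; pose proof (Rabs_pos X); pose proof (Rabs_pos Y); lra).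
    (* If all velocity components move by less than [eps], the dot product drops by at most
       [2 * M * eps], which is at most half of X^2 + Y^2. *)
    set (eps := Rmin 1 ((X * X + Y * Y) / (4 * M))).
    assert (Heps : 0 < eps) by (apply Rmin_glb_lt; [lra|apply Rdiv_lt_0_compat; lra]).
    assert (E1 : eps <= 1) by apply Rmin_l.
    assert (E2 : 4 * M * eps <= X * X + Y * Y).
    { apply Rle_trans with (4 * M * ((X * X + Y * Y) / (4 * M))).
      - apply Rmult_le_compat_l; [lra|apply Rmin_r].
      - right. field. lra. }
    destruct (family_velocity_eps c t0 s eps Sc Heps) as [d [Hd K]].
    exists d. split; auto. intros s' Hs' t Ht.
    destruct (K t0 s') as [A1 A2]; [rewrite Rminus_diag, Rabs_R0; auto|auto|].
    destruct (K t s' Ht Hs') as [B1 B2].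
    fold X in A1, B1. fold Y in A2, B2.
    set (a1 := dx (c t0) s' - X) in *. set (b1 := dx (c t) s' - X) in *.
    set (a2 := dy (c t0) s' - Y) in *. set (b2 := dy (c t) s' - Y) in *.
    replace (dx (c t0) s') with (X + a1) by (unfold a1; ring).
    replace (dx (c t) s') with (X + b1) by (unfold b1; ring).
    replace (dy (c t0) s') with (Y + a2) by (unfold a2; ring).
    replace (dy (c t) s') with (Y + b2) by (unfold b2; ring).
    assert (P : forall u v w, Rabs u < eps -> Rabs v < eps ->
      - (2 * eps * Rabs w + eps * 1) <= w * u + w * v + u * v).
    { intros u v w Hu Hv.
      assert (Q1 : Rabs (w * u) <= Rabs w * eps)
        by (rewrite Rabs_mult; apply Rmult_le_compat_l; [apply Rabs_pos|lra]).
      assert (Q2 : Rabs (w * v) <= Rabs w * eps)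
        by (rewrite Rabs_mult; apply Rmult_le_compat_l; [apply Rabs_pos|lra]).
      assert (Q3 : Rabs (u * v) <= eps * 1).
      { rewrite Rabs_mult. apply Rmult_le_compat; try apply Rabs_pos; lra. }
      apply Rabs_le_between in Q1, Q2, Q3. lra. }
    pose proof (P a1 b1 X A1 B1). pose proof (P a2 b2 Y A2 B2).
    assert (4 * M * eps = 4 * eps * Rabs X + 4 * eps * Rabs Y + 4 * eps) by (unfold M; ring).
    pose proof (Rabs_pos X). pose proof (Rabs_pos Y).
    assert (0 <= eps * Rabs X) by nra. assert (0 <= eps * Rabs Y) by nra.
    lra.
  - exists d. split; auto. intros t Ht Htd. destruct (Hc t Ht) as (He & Hl & _).
    destruct (rot_exists (c t) He Hl) as [m' Hm'].
    replace m with m'; auto. symmetry.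
    apply (rot_close (c t0) (c t)); auto.
Qed.

(** At a fixed point y' is nonzero, so it keeps its sign nearby in time and parameter. Compactness
    makes the size uniform, since parameters that are not fixed have a neighbourhood without fixed
    ones. *)
Lemma family_fixed_direction (c : R -> R -> R3) (t0 : R) :
  si_family c -> 0 <= t0 <= 1 ->
  exists eta, 0 < eta /\ forall s0, 0 <= s0 <= 1 -> tau (c t0 s0) = c t0 s0 ->
    forall t s, Rabs (t - t0) < eta -> Rabs (s - s0) < eta -> 0 < dy (c t0) s0 * dy (c t) s.
Proof.
  intros [Sc Hc] Ht0. destruct (Hc t0 Ht0) as (He & Hl & Hs).
  apply (compact_uniform 0 1 (fun s0 d => tau (c t0 s0) = c t0 s0 ->
    forall t s, Rabs (t - t0) < d -> Rabs (s - s0) < d -> 0 < dy (c t0) s0 * dy (c t) s)).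
  - intros s d d' Hdd K T t s' Ht Hs'. apply K; auto; lra.
  - intros s Hs01. destruct (classic (tau (c t0 s) = c t0 s)) as [T|T].
    + destruct (fixed_point_velocity (c t0) s He Hl Hs T) as [_ Y].
      set (V := dy (c t0) s) in *.
      destruct (family_velocity_eps c t0 s (Rabs V)) as [d [Hd K]]; auto; [apply Rabs_pos_lt; auto|].
      exists (d / 2). split; [lra|]. intros s' Hs' _ t u Ht Hu.
      destruct (K t0 s') as [_ A]; [rewrite Rminus_diag, Rabs_R0; auto|lra|].
      destruct (K t u) as [_ B]; [lra| |].
      { replace (u - s) with ((u - s') + (s' - s)) by ring.
        eapply Rle_lt_trans; [apply Rabs_triang|lra]. }
      fold V in A, B. unfold Rabs at 2 in A. unfold Rabs at 2 in B.
      destruct (Rcase_abs V); apply Rabs_def2 in A, B; nra.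
    + destruct (near_separate _ _ T) as [d [Hd Hn]].
      destruct (cont3_near (c t0) s (d / 2)) as [e [Hepos K]]; [|lra|].
      { apply smooth_curve_cont3, He. }
      exists e. split; auto. intros s' Hs' T'. exfalso. apply Hn.
      replace d with (d / 2 + d / 2) by field. apply near_trans with (c t0 s').
      * rewrite <- T'. apply near_tau, near_sym, K; auto.
      * apply K; auto.
Qed.

(** A point that [tau] moves at time [t0] is still moved at nearby times and parameters, so fixed
    points can only appear near old ones. *)
Lemma family_fixed_near (c : R -> R -> R3) (t0 eps eta : R) :
  si_family c -> 0 <= t0 <= 1 -> 0 < eps -> 0 < eta ->
  exists d, 0 < d /\ forall s, 0 <= s <= 1 -> forall t, Rabs (t - t0) < d ->
    tau (c t s) = c t s ->
    exists s0, 0 <= s0 <= 1 /\ tau (c t0 s0) = c t0 s0 /\ Rabs (s - s0) < eta /\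
      Rabs (px (c t s) - px (c t0 s0)) < eps.
Proof.
  intros [Sc Hc] Ht0 Heps Heta.
  assert (C : exists d, 0 < d /\ forall s, 0 <= s <= 1 -> 0 <= s <= 1 -> forall t, Rabs (t - t0) < d ->
    tau (c t s) = c t s ->
    exists s0, 0 <= s0 <= 1 /\ tau (c t0 s0) = c t0 s0 /\ Rabs (s - s0) < eta /\
      Rabs (px (c t s) - px (c t0 s0)) < eps).
  2:{ destruct C as [d [Hd K]]. exists d. split; auto. }
  apply (compact_uniform 0 1 (fun s d => 0 <= s <= 1 -> forall t, Rabs (t - t0) < d ->
    tau (c t s) = c t s ->
    exists s0, 0 <= s0 <= 1 /\ tau (c t0 s0) = c t0 s0 /\ Rabs (s - s0) < eta /\
      Rabs (px (c t s) - px (c t0 s0)) < eps)).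
  - intros s d d' Hdd K Hs t Ht T. apply K; auto; lra.
  - intros s Hs. destruct (classic (tau (c t0 s) = c t0 s)) as [T|T].
    + destruct (family_near c t0 s eps Sc Heps) as [d [Hd K]].
      exists (Rmin d eta). pose proof (Rmin_l d eta). pose proof (Rmin_r d eta).
      split; [apply Rmin_glb_lt; auto|]. intros s' Hs' _ t Ht _.
      exists s. split; [auto|]. split; [auto|]. split; [lra|]. apply K; lra.
    + destruct (near_separate _ _ T) as [d [Hd Hn]].
      destruct (family_near c t0 s (d / 2) Sc) as [e [He K]]; [lra|].
      exists e. split; auto. intros s' Hs' _ t Ht T'. exfalso. apply Hn.
      replace d with (d / 2 + d / 2) by field. apply near_trans with (c t s').
      * rewrite <- T'. apply near_tau, near_sym, K; auto.
      * apply K; auto.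
Qed.

(* Close to time [t0] the two fixed points cannot be close to the same fixed point at
   time [t0], since y is monotone there. *)
Lemma family_axis_points (c : R -> R -> R3) (t0 eps : R) :
  si_family c -> 0 <= t0 <= 1 -> 0 < eps ->
  exists d, 0 < d /\ forall t, 0 <= t <= 1 -> Rabs (t - t0) < d ->
    forall xl xr xl0 xr0, axis_points (c t) xl xr -> axis_points (c t0) xl0 xr0 ->
      (Rabs (xl - xl0) < eps /\ Rabs (xr - xr0) < eps) /\
      (forall k, oriented_rot (c t0) xl0 k -> oriented_rot (c t) xl k) /\
      (forall k, oriented_rot (c t0) xr0 k -> oriented_rot (c t) xr k).
Proof.
  intros Hfam Ht0 Heps. pose proof Hfam as [Sc Hc].
  destruct (Hc t0 Ht0) as (He0 & Hl0 & Hs0).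
  destruct (rot_exists (c t0) He0 Hl0) as [m Hm].
  destruct (family_rot_constant c t0 m Hfam Ht0 Hm) as [d1 [Hd1 K1]].
  destruct (family_fixed_direction c t0 Hfam Ht0) as [eta0 [Heta0 K2]].
  set (eta := Rmin eta0 (/ 4)).
  assert (Heta : 0 < eta) by (apply Rmin_glb_lt; lra).
  assert (Heta1 : eta <= eta0) by apply Rmin_l. assert (Heta2 : eta <= / 4) by apply Rmin_r.
  destruct (axis_points_exist _ Hs0) as (yl & yr & Hy).
  (* At half the distance the new fixed points cannot be close to the old ones in exchanged
     order. *)
  set (eps' := Rmin eps ((yr - yl) / 2)).
  assert (Heps' : 0 < eps').
  { apply Rmin_glb_lt; [lra|]. destruct Hy. lra. }
  assert (Heps1 : eps' <= eps) by apply Rmin_l.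
  assert (Heps2 : eps' <= (yr - yl) / 2) by apply Rmin_r.
  destruct (family_fixed_near c t0 eps' eta Hfam Ht0 Heps' Heta) as [d3 [Hd3 K3]].
  exists (Rmin d1 (Rmin eta d3)).
  pose proof (Rmin_l d1 (Rmin eta d3)). pose proof (Rmin_r d1 (Rmin eta d3)).
  pose proof (Rmin_l eta d3). pose proof (Rmin_r eta d3).
  split; [apply Rmin_glb_lt; [|apply Rmin_glb_lt]; auto|].
  intros t Ht Htd xl xr xl0 xr0 [Hlt Hx] [Hlt0 Hx0].
  assert (E0 : xl0 = yl /\ xr0 = yr).
  { destruct Hy as [Hylt Hy]. pose proof (proj1 (Hx0 yl) (proj2 (Hy yl) (or_introl eq_refl))).
    pose proof (proj1 (Hx0 yr) (proj2 (Hy yr) (or_intror eq_refl))). lra. }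
  destruct E0 as [-> ->].
  destruct (Hc t Ht) as (He & Hl & Hs).
  assert (F : forall x, on_curve (c t) (x, 0, 0) -> exists s s0 x0,
     c t s = (x, 0, 0) /\ 0 <= s0 <= 1 /\ c t0 s0 = (x0, 0, 0) /\ Rabs (s - s0) < eta /\
     Rabs (x - x0) < eps').
  { intros x [u Eu]. destruct (unit_parameter (c t) u) as [s [Hs01 Es]]; [apply He|].
    rewrite Eu in Es.
    destruct (K3 s Hs01 t) as (s0 & H01 & T0 & D0 & X0); [lra|rewrite Es; apply tau_axis|].
    exists s, s0, (px (c t0 s0)). apply tau_fixed in T0. rewrite Es in X0. auto. }
  assert (Tr : forall s s0 x x0, c t s = (x, 0, 0) -> 0 <= s0 <= 1 -> c t0 s0 = (x0, 0, 0) ->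
     Rabs (s - s0) < eta -> forall k, oriented_rot (c t0) x0 k -> oriented_rot (c t) x k).
  { intros s s0 x x0 Es H01 Es0 D k (v & m' & Ev & Hm' & Hor).
    assert (m' = m) by (apply (rot_unique (c t0)); auto). subst m'.
    exists s, m. split; auto. split; [apply K1; auto; lra|].
    assert (Y : dy (c t0) v = dy (c t0) s0).
    { pose proof He0 as (S & Hp & _ & Hn). rewrite <- Es0 in Ev.
      destruct (Hn _ _ (eq_sym Ev)) as [j ->].
      destruct S as (_ & S2 & _).
      replace (s0 + IZR j) with (1 * s0 + IZR j) by ring.
      rewrite <- (Rmult_1_l (dy (c t0) (1 * s0 + IZR j))).
      rewrite <- (Derive_comp_affine (fun u => py (c t0 u))) by auto.
      apply Derive_ext. intros w. rewrite Rmult_1_l, periodic_Z; auto. }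
    specialize (K2 s0 H01 ltac:(rewrite Es0; apply tau_axis) t s ltac:(lra) ltac:(lra)).
    rewrite Y in Hor. destruct Hor as [[Hv ->]|[Hv ->]]; [left|right]; split; auto; nra. }
  destruct (F xl) as (s & s0 & x0 & Es & H01 & Es0 & D & X); [apply Hx; auto|].
  destruct (F xr) as (u & u0 & w0 & Eu & U01 & Eu0 & D' & X'); [apply Hx; auto|].
  assert (Dis : x0 <> w0).
  { intros Ex. subst w0. rewrite <- Es0 in Eu0.
    pose proof He0 as (_ & _ & _ & Hn). destruct (Hn _ _ (eq_sym Eu0)) as [j Hj].
    (* The old parameters agree up to the period only; after the shift both new parameters are close
       to [s0]. *)
    set (u' := u + IZR (- j)).
    assert (Eu' : c t u' = (xr, 0, 0)) by (unfold u'; rewrite periodic_Z; auto; apply He).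
    assert (D'' : Rabs (u' - s0) < eta).
    { unfold u'. rewrite opp_IZR. replace (u + - IZR j - s0) with (u - u0) by lra. auto. }
    assert (Z : forall p q, Rabs (p - s0) < eta -> Rabs (q - s0) < eta -> p < q ->
      py (c t p) = 0 -> py (c t q) = 0 -> False).
    { intros p q Hp Hq Hpq Ep Eq.
      destruct (mvt (fun v => py (c t v)) p q) as [w [Hw Ew]]; auto.
      { intros v. apply (smooth_ex_derive (fun v => py (c t v))). apply He. }
      cbv beta in Ew. rewrite Ep, Eq, Rminus_diag in Ew.
      assert (Hwn : Rabs (w - s0) < eta) by (apply Rabs_def2 in Hp, Hq; apply Rabs_def1; lra).
      specialize (K2 s0 H01 ltac:(rewrite Es0; apply tau_axis) t w ltac:(lra) ltac:(lra)).
      symmetry in Ew. apply Rmult_integral in Ew. destruct Ew as [Ew|Ew]; [|lra].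
      rewrite Ew in K2. lra. }
    assert (P1 : py (c t s) = 0) by (rewrite Es; auto).
    assert (P2 : py (c t u') = 0) by (rewrite Eu'; auto).
    destruct (Rtotal_order s u') as [Ho|[Ho|Ho]].
    - apply (Z s u'); auto.
    - rewrite <- Ho, Es in Eu'. injection Eu'; lra.
    - apply (Z u' s); auto. }
  pose proof (proj1 (Hx0 x0) (ex_intro _ _ Es0)) as C1.
  pose proof (proj1 (Hx0 w0) (ex_intro _ _ Eu0)) as C2.
  assert (E1 : x0 = yl /\ w0 = yr).
  { destruct C1 as [-> | ->], C2 as [-> | ->]; try tauto.
    apply Rabs_def2 in X, X'. lra. }
  destruct E1 as [-> ->].
  split; [split; lra|]. split.
  - apply (Tr s s0); auto.
  - apply (Tr u u0); auto.
Qed.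

Lemma oriented_rot_unique (b : R -> R3) (x : R) (k k' : Z) :
  embedded_circle b -> (forall s, legendrian_at b s) ->
  oriented_rot b x k -> oriented_rot b x k' -> k = k'.
Proof.
  intros He Hl (s & m & Es & Hm & Ho) (u & m' & Eu & Hm' & Ho').
  assert (m' = m) by (apply (rot_unique b); auto). subst m'.
  assert (Y : dy b u = dy b s).
  { pose proof He as ((_ & S2 & _) & Hp & _ & Hn). rewrite <- Eu in Es.
    destruct (Hn _ _ Es) as [j ->].
    replace (s + IZR j) with (1 * s + IZR j) by ring.
    rewrite <- (Rmult_1_l (dy b (1 * s + IZR j))).
    rewrite <- (Derive_comp_affine (fun u => py (b u))) by auto.
    apply Derive_ext. intros w. rewrite Rmult_1_l, periodic_Z; auto. }
  rewrite Y in Ho'. destruct Ho as [[H1 ->]|[H1 ->]], Ho' as [[H2 ->]|[H2 ->]]; auto; lra.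
Qed.

Definition link_at (n : nat) (g : nat -> R -> R -> R3) (t : R) (P : R3) : Prop :=
  exists i, (i < n)%nat /\ on_curve (g i t) P.

(** The numbering is chosen separately at each time; it is nevertheless continuous, because left and
    right are determined by the order on the axis. *)
Lemma isotopy_fixed_points (n : nat) (g : nat -> R -> R -> R3) (L L' : R3 -> Prop) :
  isotopy n g L L' -> exists X : R -> nat * bool -> R,
    (forall t, 0 <= t <= 1 -> numbers_fixed_points n (fun i => g i t) (X t)) /\
    (forall t0 j eps, 0 <= t0 <= 1 -> In j (fixed_indices n) -> 0 < eps ->
       exists d, 0 < d /\ forall t, 0 <= t <= 1 -> Rabs (t - t0) < d ->
         Rabs (X t j - X t0 j) < eps) /\
    (forall j k, In j (fixed_indices n) -> oriented_rot (g (fst j) 0) (X 0 j) k ->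
       oriented_rot (g (fst j) 1) (X 1 j) k).
Proof.
  intros (Hsm & Hsi & _).
  assert (C : forall t, exists X, 0 <= t <= 1 -> numbers_fixed_points n (fun i => g i t) X).
  { intros t. destruct (classic (0 <= t <= 1)) as [Ht|Ht].
    - destruct (numbering_exists n (fun i => g i t) (Hsi t Ht)) as [X HX]. exists X; auto.
    - exists (fun _ => 0). tauto. }
  apply functional_choice in C. destruct C as [X HX]. exists X.
  assert (Fam : forall i, (i < n)%nat -> si_family (g i)).
  { intros i Hi. split; auto. intros t Ht. destruct (Hsi t Ht) as [H _]. apply (H i Hi). }
  split; [auto|]. split.
  - intros t0 [i e] eps Ht0 Hj Heps. apply in_fixed_indices in Hj. simpl in Hj.
    destruct (family_axis_points (g i) t0 eps (Fam i Hj) Ht0 Heps) as [d [Hd K]].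
    exists d. split; auto. intros t Ht Htd.
    destruct (K t Ht Htd _ _ _ _ (HX t Ht i Hj) (HX t0 Ht0 i Hj)) as [[K1 K2] _].
    destruct e; auto.
  - intros [i e] k Hj. apply in_fixed_indices in Hj. simpl in *.
    apply (locally_constant_connected (fun t => oriented_rot (g i t) (X t (i, e)))).
    + intros t a a' Ht. apply oriented_rot_unique; apply (Fam i Hj); auto.
    + intros t0 Ht0. destruct (Fam i Hj) as [_ Hi]. destruct (Hi t0 Ht0) as (H1 & H2 & H3).
      assert (Hon : on_curve (g i t0) (X t0 (i, e), 0, 0)).
      { apply (HX t0 Ht0 i Hj). destruct e; auto. }
      destruct (oriented_rot_exists (g i t0) _ H1 H2 H3 Hon) as [a Ha].
      destruct (family_axis_points (g i) t0 1 (Fam i Hj) Ht0 Rlt_0_1) as [d [Hd K]].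
      exists a, d. split; auto. intros t Ht Htd.
      destruct (K t Ht Htd _ _ _ _ (HX t Ht i Hj) (HX t0 Ht0 i Hj)) as [_ [K1 K2]].
      destruct e; auto.
Qed.

Lemma isotopy_order (n : nat) (g : nat -> R -> R -> R3) (L L' : R3 -> Prop)
    (X : R -> nat * bool -> R) (j k : nat * bool) :
  isotopy n g L L' ->
  (forall t, 0 <= t <= 1 -> numbers_fixed_points n (fun i => g i t) (X t)) ->
  (forall t0 j eps, 0 <= t0 <= 1 -> In j (fixed_indices n) -> 0 < eps ->
     exists d, 0 < d /\ forall t, 0 <= t <= 1 -> Rabs (t - t0) < d ->
       Rabs (X t j - X t0 j) < eps) ->
  In j (fixed_indices n) -> In k (fixed_indices n) -> X 0 j < X 0 k -> X 1 j < X 1 k.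
Proof.
  intros (_ & Hsi & _) HX HC Hj Hk H0.
  assert (Hne : j <> k) by (intros ->; lra).
  apply (locally_constant_prop (fun t => X t j < X t k)); auto.
  intros t0 Ht0.
  assert (N : X t0 j <> X t0 k).
  { intros E. apply Hne. apply (numbering_injective n (fun i => g i t0) (X t0)); auto. }
  set (e := Rabs (X t0 j - X t0 k) / 2).
  assert (He : 0 < e) by (unfold e; apply Rdiv_lt_0_compat; [apply Rabs_pos_lt|]; lra).
  destruct (HC t0 j e Ht0 Hj He) as [d1 [D1 K1]].
  destruct (HC t0 k e Ht0 Hk He) as [d2 [D2 K2]].
  exists (Rmin d1 d2). pose proof (Rmin_l d1 d2). pose proof (Rmin_r d1 d2).
  split; [apply Rmin_glb_lt; auto|]. intros t Ht Htd.
  specialize (K1 t Ht ltac:(lra)). specialize (K2 t Ht ltac:(lra)).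
  apply Rabs_def2 in K1, K2. unfold e, Rabs in K1, K2.
  destruct Rcase_abs in K1; destruct Rcase_abs in K2; lra.
Qed.

(** The intrinsic integer and position are translated to an index at time 0, carried along the
    isotopy, and translated back at time 1. *)
Lemma isotopy_transport_index (n : nat) (g : nat -> R -> R -> R3) (L L' : R3 -> Prop)
    (X : R -> nat * bool -> R) (j : nat * bool) (k : Z) (N : nat) :
  isotopy n g L L' ->
  (forall t, 0 <= t <= 1 -> numbers_fixed_points n (fun i => g i t) (X t)) ->
  (forall t0 j eps, 0 <= t0 <= 1 -> In j (fixed_indices n) -> 0 < eps ->
     exists d, 0 < d /\ forall t, 0 <= t <= 1 -> Rabs (t - t0) < d ->
       Rabs (X t j - X t0 j) < eps) ->
  (forall j k, In j (fixed_indices n) -> oriented_rot (g (fst j) 0) (X 0 j) k ->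
     oriented_rot (g (fst j) 1) (X 1 j) k) ->
  In j (fixed_indices n) -> inv L (X 0 j) k -> nleft L (X 0 j) N ->
  inv L' (X 1 j) k /\ nleft L' (X 1 j) N.
Proof.
  intros HI HX HC HR Hj Hk HN. pose proof HI as (_ & Hsi & HP0 & HP1).
  assert (H00 : 0 <= 0 <= 1) by lra. assert (H11 : 0 <= 1 <= 1) by lra.
  pose proof (HX 0 H00) as X0. pose proof (HX 1 H11) as X1.
  split.
  - pose proof (numbering_on_curve _ _ _ _ X0 Hj) as Hon. cbv beta in Hon.
    pose proof (proj1 (in_fixed_indices n j) Hj) as Hi.
    destruct (Hsi 0 H00) as [Hg _]. destruct (Hg _ Hi) as (H1 & H2 & H3).
    destruct (oriented_rot_exists _ _ H1 H2 H3 Hon) as [k' Hk'].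
    assert (k' = k).
    { apply (inv_unique L (X 0 j)); auto.
      apply (oriented_rot_inv n (fun i => g i 0) L (fst j)); auto. }
    subst k'. apply (oriented_rot_inv n (fun i => g i 1) L' (fst j)); auto.
  - pose proof (enumerates_filter n (fun i => g i 0) (X 0) (X 0) (X 0 j) (Hsi 0 H00) X0) as E0.
    pose proof (enumerates_filter n (fun i => g i 1) (X 1) (X 0) (X 0 j) (Hsi 1 H11) X1) as E1.
    (* The indices to the left of [j] at time 0 are counted; the preserved order shows that they are
       the same ones at time 1. *)
    assert (EN : N = length (filter (fun k => if Rlt_dec (X 0 k) (X 0 j) then true else false)
      (fixed_indices n))).
    { apply (enumerates_unique _ _ _ HN). apply enumerates_ext with (2 := E0).
      intros x. rewrite (numbering_spec n _ L (X 0) x HP0 X0). split.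
      - intros [i [Hi [Hlt E]]]. rewrite E in Hlt. split; auto. exists i; auto.
      - intros [[i [Hi E]] Hlt]. exists i. rewrite E. auto. }
    rewrite EN. apply enumerates_ext with (2 := E1).
    intros x. rewrite (numbering_spec n _ L' (X 1) x HP1 X1). split.
    + intros [i [Hi [Hlt <-]]]. split; [exists i; auto|].
      apply (isotopy_order n g L L' X i j); auto.
    + intros [[i [Hi <-]] Hlt]. exists i. split; auto. split; auto.
      destruct (Rtotal_order (X 0 i) (X 0 j)) as [Ho|[Ho|Ho]]; auto.
      * assert (i = j) by (apply (numbering_injective n (fun i => g i 0) (X 0)); auto).
        subst i. lra.
      * pose proof (isotopy_order n g L L' X j i HI HX HC Hj Hi Ho). lra.
Qed.

Lemma inv_on_link (L : R3 -> Prop) (x : R) (k : Z) : inv L x k -> L (x, 0, 0).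
Proof. intros (b & (_ & _ & HI & _) & E & _). rewrite <- E. auto. Qed.

(** * Transport of the invariant along equivalences *)

Lemma equivalent_transport (L L' : R3 -> Prop) (x : R) (k : Z) (N : nat) :
  equivalent L L' -> inv L x k -> nleft L x N ->
  exists x', inv L' x' k /\ nleft L' x' N.
Proof.
  intros (n & g & HI) Hk HN.
  destruct (isotopy_fixed_points n g L L' HI) as (X & HX & HC & HR).
  pose proof HI as (_ & _ & HP0 & _).
  pose proof (inv_on_link L x k Hk) as HL.
  rewrite (numbering_spec n _ L (X 0) x HP0 (HX 0 ltac:(lra))) in HL.
  destruct HL as [j [Hj <-]]. exists (X 1 j).
  apply (isotopy_transport_index n g L L' X j); auto.
Qed.

(** The distinguished point moves continuously among finitely many fixed points that never meet, so
    its index is constant. *)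
Lemma pointed_equivalent_transport (L L' : R3 -> Prop) (p p' : R3) (k : Z) (N : nat) :
  pointed_equivalent L p L' p' -> inv L (px p) k -> nleft L (px p) N ->
  inv L' (px p') k /\ nleft L' (px p') N.
Proof.
  intros (n & g & q & HI & (Sq & _) & Q0 & Q1 & HQ) Hk HN.
  destruct (isotopy_fixed_points n g L L' HI) as (X & HX & HC & HR).
  pose proof HI as (_ & Hsi & HP0 & HP1).
  assert (Fx : forall t, 0 <= t <= 1 -> exists j, In j (fixed_indices n) /\ X t j = px (q t)).
  { intros t Ht. apply (numbering_spec n (fun i => g i t) (link_at n g t)).
    - split; [auto|]. intros P. unfold link_at. tauto.
    - auto.
    - destruct (HQ t Ht) as [T [i [Hi Hon]]]. apply tau_fixed in T. rewrite <- T. exists i; auto. }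
  destruct (Fx 0) as [j [Hj Ej]]; [lra|].
  assert (E1 : In j (fixed_indices n) /\ X 1 j = px (q 1)).
  { apply (locally_constant_connected (fun t i => In i (fixed_indices n) /\ X t i = px (q t))).
    - intros t a a' Ht [Ha Ea] [Ha' Ea'].
      apply (numbering_injective n (fun i => g i t) (X t)); auto. congruence.
    - intros t0 Ht0. destruct (Fx t0 Ht0) as [a [Ha Ea]]. exists a.
      (* Every index other than [a] stays away from the marked point for nearby times, and some
         index must match it. *)
      destruct (finite_uniform (fixed_indices n) (fun i d => i <> a ->
        forall t, 0 <= t <= 1 -> Rabs (t - t0) < d -> X t i <> px (q t))) as [d [Hd K]].
      + intros i d d' Hdd K Hne t Ht Htd. apply K; auto. lra.
      + intros i Hi. destruct (classic (i = a)) as [->|Hne]; [exists 1; split; [lra|tauto]|].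
        assert (Hsep : X t0 i <> px (q t0)).
        { rewrite <- Ea. intros E. apply Hne.
          apply (numbering_injective n (fun i => g i t0) (X t0)); auto. }
        set (e := Rabs (X t0 i - px (q t0)) / 2).
        assert (He : 0 < e) by (unfold e; apply Rdiv_lt_0_compat; [apply Rabs_pos_lt|]; lra).
        destruct (HC t0 i e Ht0 Hi He) as [d1 [D1 K1]].
        pose proof (smooth_continuity _ Sq t0) as Cq. rewrite continuity_pt_eps in Cq.
        destruct (Cq e He) as [d2 [D2 K2]].
        exists (Rmin d1 d2). pose proof (Rmin_l d1 d2). pose proof (Rmin_r d1 d2).
        split; [apply Rmin_glb_lt; auto|]. intros _ t Ht Htd E.
        specialize (K1 t Ht ltac:(lra)). specialize (K2 t ltac:(lra)).
        rewrite E in K1. apply Rabs_def2 in K1, K2. unfold e, Rabs in K1, K2.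
        destruct Rcase_abs in K1; destruct Rcase_abs in K2; lra.
      + exists d. split; auto. intros t Ht Htd.
        destruct (Fx t Ht) as [i [Hi Ei]].
        destruct (classic (i = a)) as [->|Hne]; auto.
        exfalso. apply (K i Hi Hne t Ht Htd Ei).
    - auto. }
  destruct E1 as [_ E1]. rewrite <- Q1, <- E1. rewrite <- Q0, <- Ej in Hk, HN.
  apply (isotopy_transport_index n g L L' X j); auto.
Qed.

(** * Effect of the local configurations *)

(* [lo] and [hi] bound the angle of the half [0, 1] in turns. *)
Definition turning_arc (Phi : R2 -> R2) (e : R2) (L : R3 -> Prop) (a : R -> R3)
    (sg lo hi : R) : Prop :=
  arc_over Phi L a /\ front_proj (a 1) = e /\ dx a 1 < 0 /\ 0 < sg * dy a 0 /\
  forall al, continuity al -> (forall s, -1 <= s <= 1 -> ang (dx a s) (dy a s) (al s)) ->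
    lo < al 1 - al 0 < hi.

Lemma arc_angle_exists (Phi : R2 -> R2) (L : R3 -> Prop) (a : R -> R3) :
  arc_over Phi L a -> exists al, continuity al /\
    forall s, -1 <= s <= 1 -> ang (dx a s) (dy a s) (al s).
Proof.
  intros (Sa & Ia & _). apply angle_lift.
  - apply dx_continuity; auto.
  - apply dy_continuity; auto.
  - lra.
  - intros t Ht. destruct (Ia t Ht) as (I1 & I2 & _).
    apply Rgt_not_eq, legendrian_velocity; auto.
Qed.

Lemma cusp_turning_arc (Phi : R2 -> R2) (c e : R2) (F : R2 -> Prop) (L : R3 -> Prop) :
  represents F L -> cusp_configuration Phi c e F ->
  exists a, turning_arc Phi e L a (-1) (- / 2) 0 /\ no_crossings a /\ c = (px (a 0), 0).
Proof.
  intros HR (a & Hs & Hn & Hc & HX & HZ).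
  destruct (symmetric_arc_over Phi e F L a Hs HR) as [Ha He].
  destruct (arc_angle_exists Phi L a Ha) as (al & C & A).
  exists a. split; [|split; auto].
  - split; [auto|]. split; [auto|]. split; [apply HX; lra|]. split.
    + destruct (cusp_angle Phi L a al Ha HX HZ C A). lra.
    + intros al' C' A'. apply (cusp_angle Phi L a al' Ha HX HZ C' A').
  - destruct (arc_axis_point Phi L a Ha) as (E0 & _). rewrite <- Hc, E0. reflexivity.
Qed.

Lemma S_turning_arc (Phi : R2 -> R2) (e : R2) (F : R2 -> Prop) (L : R3 -> Prop) :
  represents F L -> S_configuration Phi e F ->
  exists a, turning_arc Phi e L a 1 (-1) (- / 2) /\ no_crossings a.
Proof.
  intros HR (a & r & Hs & Hn & Hr & X1 & Xr & X2 & HZ & HZ2).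
  destruct (symmetric_arc_over Phi e F L a Hs HR) as [Ha He].
  destruct (arc_angle_exists Phi L a Ha) as (al & C & A).
  exists a. split; auto.
  split; [auto|]. split; [auto|]. split; [apply X2; lra|]. split.
  - destruct (S_angle Phi L a al r Ha Hr X1 Xr X2 HZ HZ2 C A). lra.
  - intros al' C' A'. apply (S_angle Phi L a al' r Ha Hr X1 Xr X2 HZ HZ2 C' A').
Qed.

Lemma T_turning_arc (Phi : R2 -> R2) (e : R2) (F : R2 -> Prop) (L : R3 -> Prop) :
  represents F L -> T_configuration Phi e F ->
  exists a, turning_arc Phi e L a 1 0 (/ 2).
Proof.
  intros HR (a & r & Hs & Hr & HX & HZ & _).
  destruct (symmetric_arc_over Phi e F L a Hs HR) as [Ha He].
  destruct (arc_angle_exists Phi L a Ha) as (al & C & A).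
  exists a.
  split; [auto|]. split; [auto|]. split; [apply HX; lra|]. split.
  - destruct (T_angle Phi L a al r Ha Hr HX HZ C A). lra.
  - intros al' C' A'. apply (T_angle Phi L a al' r Ha Hr HX HZ C' A').
Qed.

(** The invariant orients the component upwards at the fixed point, the arc may start downwards;
    [sg] corrects the sign of the rotation number. *)
Lemma loop_along_arc (L : R3 -> Prop) (a : R -> R3) (sg : Z) (k : Z) :
  (sg = 1 \/ sg = -1)%Z -> a 0 = (px (a 0), 0, 0) -> 0 < IZR sg * dy a 0 ->
  inv L (px (a 0)) k ->
  exists b, loop L b /\ b 0 = a 0 /\ 0 < dy a 0 * dy b 0 /\ is_rot b (sg * k).
Proof.
  intros Hsg E0 Y (b & Hb & Eb & Yb & Rb).
  pose proof Hb as (((S1 & S2 & S3) & _) & _).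
  destruct Hsg as [-> | ->].
  - exists b. split; auto. split; [congruence|]. split; [nra|].
    rewrite Z.mul_1_l. auto.
  - exists (fun u => b (-1 * u + 0)).
    split; [apply loop_reparametrize; auto|].
    split; [rewrite E0, <- Eb; f_equal; ring|].
    split.
    + rewrite (Derive_comp_affine (fun u => py (b u))) by auto.
      replace (-1 * 0 + 0) with 0 by ring. nra.
    + replace (-1 * k)%Z with (- k)%Z by ring. apply rot_reverse; auto. split; auto.
Qed.

(** The factor 2 accounts for the two halves of each arc; the rest of each component contributes
    equally and cancels. *)
Lemma inv_change (Phi : R2 -> R2) (e : R2) (F F' : R2 -> Prop) (L L' : R3 -> Prop)
    (a a' : R -> R3) (sg sg' : Z) (lo hi lo' hi' : R) (k k' : Z) :
  (sg = 1 \/ sg = -1)%Z -> (sg' = 1 \/ sg' = -1)%Z ->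
  represents F L -> represents F' L' -> coincide_outside Phi F F' ->
  turning_arc Phi e L a (IZR sg) lo hi -> turning_arc Phi e L' a' (IZR sg') lo' hi' ->
  no_crossings a -> inv L (px (a 0)) k -> inv L' (px (a' 0)) k' ->
  2 * (lo - hi') < IZR (sg * k - sg' * k') < 2 * (hi - lo').
Proof.
  intros Hsg Hsg' HR HR' Hco (Ha & He & X & Y & B) (Ha' & He' & X' & Y' & B') Hn Hk Hk'.
  destruct (arc_axis_point Phi L a Ha) as (E0 & _).
  destruct (arc_axis_point Phi L' a' Ha') as (E0' & _).
  destruct (loop_along_arc L a sg k Hsg E0 Y Hk) as (b & Lb & Eb & Yb & Rb).
  destruct (loop_along_arc L' a' sg' k' Hsg' E0' Y' Hk') as (b' & Lb' & Eb' & Yb' & Rb').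
  destruct (rotation_difference Phi L L' a a' b b' (sg * k) (sg' * k')) as
    (al & al' & C & C' & A & A' & E); auto.
  - congruence.
  - destruct HR as ((n & g & HP & _) & _). intros P. apply (link_closed n g); auto.
  - apply (coincide_outside_links Phi F F' L L' a'); auto.
  - rewrite minus_IZR, E, (arc_total_angle Phi L a al), (arc_total_angle Phi L' a' al'); auto.
    specialize (B al C A). specialize (B' al' C' A'). lra.
Qed.

Lemma configuration_same_sides (Phi : R2 -> R2) (F F' : R2 -> Prop) (L L' : R3 -> Prop)
    (a a' : R -> R3) :
  symmetric_disk Phi -> represents F L -> represents F' L' -> coincide_outside Phi F F' ->
  arc_over Phi L a -> arc_over Phi L' a' -> same_sides L (px (a 0)) L' (px (a' 0)).
Proof.
  intros HD HR HR' Hco Ha Ha'. apply (disk_same_sides Phi); auto.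
  intros P HP. split; intros H.
  - apply (coincide_outside_links Phi F' F L' L a); auto.
    intros q Hq. symmetry. apply Hco; auto.
  - apply (coincide_outside_links Phi F F' L L' a'); auto.
Qed.

Lemma same_sides_nleft (L L' : R3 -> Prop) (c c' : R) (N : nat) :
  same_sides L c L' c' -> nleft L c N -> nleft L' c' N.
Proof. intros [H _]. apply enumerates_ext. auto. Qed.

(** The sign of [k] is reversed because the arc of the old cusp starts downwards and the arc
    replacing it starts upwards. *)
Definition changes_inv (config : (R2 -> R2) -> R2 -> (R2 -> Prop) -> Prop) (eps : Z) : Prop :=
  forall F c G L M, represents F L -> represents G M -> replace_cusp config F c G ->
    exists x x', c = (x, 0) /\ same_sides L x M x' /\
      forall k, inv L x k -> inv M x' (- k + eps).

Lemma link_inv_exists (F : R2 -> Prop) (L : R3 -> Prop) (x : R) :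
  represents F L -> L (x, 0, 0) -> exists k, inv L x k.
Proof. intros ((n & g & HP & _) & _). apply (inv_exists n g); auto. Qed.

Lemma S_changes_inv : changes_inv S_configuration (-1).
Proof.
  intros F c G L M HF HG (Phi & e & HD & Hc & Hco & HS).
  destruct (cusp_turning_arc Phi c e F L HF Hc) as (a & Ta & Hn & Ec).
  destruct (S_turning_arc Phi e G M HG HS) as (a' & Ta' & _).
  exists (px (a 0)), (px (a' 0)). split; auto.
  split; [apply (configuration_same_sides Phi F G); auto; [apply Ta|apply Ta']|].
  intros k Hk.
  destruct (link_inv_exists G M (px (a' 0)) HG) as [k' Hk'].
  { apply (arc_axis_point Phi M a'). apply Ta'. }
  pose proof (inv_change Phi e F G L M a a' (-1) 1 _ _ _ _ k k' (or_intror eq_refl)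
    (or_introl eq_refl) HF HG Hco Ta Ta' Hn Hk Hk') as [B1 B2].
  (* The open interval (0, 2) contains the single integer 1. *)
  assert (E : k' = (- k + -1)%Z).
  { assert (0 < IZR (-1 * k - 1 * k') < 2) as [I1 I2] by lra.
    apply lt_IZR in I1, I2. lia. }
  rewrite <- E; auto.
Qed.

Lemma T_changes_inv : changes_inv T_configuration 1.
Proof.
  intros F c G L M HF HG (Phi & e & HD & Hc & Hco & HT).
  destruct (cusp_turning_arc Phi c e F L HF Hc) as (a & Ta & Hn & Ec).
  destruct (T_turning_arc Phi e G M HG HT) as (a' & Ta').
  exists (px (a 0)), (px (a' 0)). split; auto.
  split; [apply (configuration_same_sides Phi F G); auto; [apply Ta|apply Ta']|].
  intros k Hk.
  destruct (link_inv_exists G M (px (a' 0)) HG) as [k' Hk'].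
  { apply (arc_axis_point Phi M a'). apply Ta'. }
  pose proof (inv_change Phi e F G L M a a' (-1) 1 _ _ _ _ k k' (or_intror eq_refl)
    (or_introl eq_refl) HF HG Hco Ta Ta' Hn Hk Hk') as [B1 B2].
  (* The open interval (-2, 0) contains the single integer -1. *)
  assert (E : k' = (- k + 1)%Z).
  { assert (-2 < IZR (-1 * k - 1 * k') < 0) as [I1 I2] by lra.
    apply lt_IZR in I1, I2. lia. }
  rewrite <- E; auto.
Qed.

Lemma S_T_not_equivalent (Phi : R2 -> R2) (e : R2) (F F' : R2 -> Prop) (L L' : R3 -> Prop) :
  symmetric_disk Phi -> coincide_outside Phi F F' ->
  S_configuration Phi e F -> T_configuration Phi e F' ->
  represents F L -> represents F' L' -> ~ equivalent L L'.
Proof.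
  intros HD Hco HS HT HF HF' Heq.
  destruct (S_turning_arc Phi e F L HF HS) as (a & Ta & Hn).
  destruct (T_turning_arc Phi e F' L' HF' HT) as (a' & Ta').
  pose proof (configuration_same_sides Phi F F' L L' a a' HD HF HF' Hco
    (proj1 Ta) (proj1 Ta')) as Sd.
  destruct (arc_axis_point Phi L a (proj1 Ta)) as (_ & _ & HL & _).
  destruct (arc_axis_point Phi L' a' (proj1 Ta')) as (_ & _ & HL' & _).
  destruct (link_inv_exists F L _ HF HL) as [k Hk].
  destruct (link_inv_exists F' L' _ HF' HL') as [k' Hk'].
  pose proof HF as ((n & g & HP & _) & _).
  destruct (nleft_exists n g L (px (a 0)) HP) as [N HN].
  destruct (equivalent_transport L L' _ k N Heq Hk HN) as (x' & Hx' & HNx').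
  (* Both points have [N] fixed points of [L'] to their left, one through the isotopy and the other
     because the disk does not change the sides. *)
  assert (x' = px (a' 0)).
  { apply (nleft_injective L' _ _ N); auto.
    - apply (inv_on_link L' x' k); auto.
    - apply (same_sides_nleft L L' (px (a 0))); auto. }
  subst x'. pose proof (inv_unique L' _ _ _ Hx' Hk'). subst k'.
  (* The difference of the invariants would be 0, but it is confined to the interval (-3, -1). *)
  pose proof (inv_change Phi e F F' L L' a a' 1 1 _ _ _ _ k k (or_introl eq_refl)
    (or_introl eq_refl) HF HF' Hco Ta Ta' Hn Hk Hk') as [B1 B2].
  rewrite Z.sub_diag in B2. simpl in B2. lra.
Qed.

(** * Left-pointing cusps *)

(** The lift of the rotation of the front plane: it commutes with [tau], keeps slopes, and changes
    the contact form only by a sign. *)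
Definition mirror (P : R3) : R3 := (- px P, py P, - pz P).
Definition mirror_link (L : R3 -> Prop) (P : R3) : Prop := L (mirror P).

Lemma mirror_mirror (P : R3) : mirror (mirror P) = P.
Proof. apply R3_ext; unfold mirror, px, py, pz; simpl; ring. Qed.

Lemma mirror_axis (x : R) : mirror (x, 0, 0) = (- x, 0, 0).
Proof. unfold mirror, px, py, pz; simpl. rewrite Ropp_0. auto. Qed.

Lemma mirror_tau (P : R3) : mirror (tau P) = tau (mirror P).
Proof. reflexivity. Qed.

Lemma mirror_eq (P Q : R3) : mirror P = Q <-> P = mirror Q.
Proof. split; [intros <-|intros ->]; rewrite mirror_mirror; auto. Qed.

Lemma mirror_near (d : R) (P Q : R3) : near d P Q -> near d (mirror P) (mirror Q).
Proof.
  unfold near, mirror, px, py, pz. simpl. intros (H1 & H2 & H3).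
  replace (- fst (fst P) - - fst (fst Q)) with (- (fst (fst P) - fst (fst Q))) by ring.
  replace (- snd P - - snd Q) with (- (snd P - snd Q)) by ring.
  rewrite !Rabs_Ropp. auto.
Qed.

Lemma mirror_dx (b : R -> R3) (s : R) : dx (fun u => mirror (b u)) s = - dx b s.
Proof. apply (Derive_opp (fun u => px (b u))). Qed.

Lemma mirror_dz (b : R -> R3) (s : R) : dz (fun u => mirror (b u)) s = - dz b s.
Proof. apply (Derive_opp (fun u => pz (b u))). Qed.

Lemma smooth_opp (f : R -> R) : smooth f -> smooth (fun s => - f s).
Proof. intros H n s. apply (ex_derive_n_opp f); auto. Qed.

Lemma mirror_legendrian (b : R -> R3) (s : R) :
  legendrian_at b s -> legendrian_at (fun u => mirror (b u)) s.
Proof.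
  unfold legendrian_at. rewrite mirror_dx, mirror_dz. intros ->.
  change (py (mirror (b s))) with (py (b s)). ring.
Qed.

Lemma mirror_circle (b : R -> R3) :
  embedded_circle b -> embedded_circle (fun u => mirror (b u)).
Proof.
  intros ((S1 & S2 & S3) & Hp & Hi & Hn). split; [|split; [|split]].
  - split; [|split; auto].
    + apply (smooth_opp (fun u => px (b u))); auto.
    + apply (smooth_opp (fun u => pz (b u))); auto.
  - intros s. rewrite Hp; auto.
  - intros s (E1 & E2 & E3). rewrite mirror_dx in E1. rewrite mirror_dz in E3.
    apply (Hi s). split; [lra|]. split; [exact E2|lra].
  - intros s t E. apply mirror_eq in E. rewrite mirror_mirror in E. auto.
Qed.

Lemma mirror_loop (L : R3 -> Prop) (b : R -> R3) :
  loop L b -> loop (mirror_link L) (fun u => mirror (b u)).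
Proof.
  intros (He & Hl & HI & HI'). split; [apply mirror_circle; auto|].
  split; [intros s; apply mirror_legendrian; auto|]. split.
  - intros s. unfold mirror_link. rewrite mirror_mirror. auto.
  - intros eps Heps. destruct (HI' eps Heps) as [d [Hd K]]. exists d. split; auto.
    intros s P HP Hne. destruct (K s (mirror P) HP) as [u [Hu Eu]].
    + rewrite <- (mirror_mirror (b s)). apply mirror_near; auto.
    + exists u. split; auto. apply mirror_eq. auto.
Qed.

(** The direction of increasing y is kept, so the orientation at the fixed point is too, while (x',
    y') is reflected and turns the other way. *)
Lemma inv_mirror (L : R3 -> Prop) (x : R) (k : Z) :
  inv L x k -> inv (mirror_link L) (- x) (- k).
Proof.
  intros (b & Hb & Eb & Yb & Rb). exists (fun u => mirror (b u)).
  split; [apply mirror_loop; auto|]. split; [rewrite Eb; apply mirror_axis|].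
  split; [exact Yb|].
  intros s th C A.
  assert (C' : continuity (fun u => / 2 - th u)).
  { apply continuity_minus with (f1 := fun _ => / 2) (f2 := th); auto.
    intros x'. apply continuity_pt_const. intros u v; auto. }
  specialize (Rb s _ C'). rewrite opp_IZR, <- Rb; [ring|].
  intros u Hu. specialize (A u Hu). rewrite mirror_dx in A.
  apply ang_reflect in A. rewrite Ropp_involutive in A. exact A.
Qed.

Lemma mirror_strongly_invertible (b : R -> R3) :
  strongly_invertible b -> strongly_invertible (fun u => mirror (b u)).
Proof.
  assert (On : forall P, on_curve (fun u => mirror (b u)) P <-> on_curve b (mirror P)).
  { intros P. split; intros [s Es]; exists s; apply mirror_eq; auto. }
  intros (Hs & P & Q & HPQ & Hf). split.
  - intros A. rewrite !On, mirror_tau. apply Hs.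
  - exists (mirror P), (mirror Q). split.
    + intros E. apply mirror_eq in E. rewrite mirror_mirror in E. auto.
    + intros A. specialize (Hf (mirror A)). rewrite On, <- mirror_tau in *.
      rewrite !mirror_eq in Hf. rewrite mirror_mirror in Hf. exact Hf.
Qed.

Lemma mirror_parametrizes (n : nat) (g : nat -> R -> R3) (L : R3 -> Prop) :
  parametrizes n g L -> parametrizes n (fun i s => mirror (g i s)) (mirror_link L).
Proof.
  intros [[Hg Hd] HL]. split; [split|].
  - intros i Hi. destruct (Hg i Hi) as (H1 & H2 & H3).
    split; [apply mirror_circle; auto|]. split.
    + intros s. apply mirror_legendrian; auto.
    + apply mirror_strongly_invertible; auto.
  - intros i j s t Hi Hj Hne E. apply mirror_eq in E. rewrite mirror_mirror in E.
    apply (Hd i j s t); auto.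
  - intros P. unfold mirror_link. rewrite HL.
    split; intros [i [Hi [s Es]]]; exists i; split; auto; exists s; apply mirror_eq; auto.
Qed.

Lemma front_proj_mirror (P : R3) : front_proj (mirror P) = rot (front_proj P).
Proof. reflexivity. Qed.

Lemma rot_rot (q : R2) : rot (rot q) = q.
Proof. destruct q as [q1 q2]. unfold rot. simpl. rewrite !Ropp_involutive. auto. Qed.

Lemma mirror_generic (n : nat) (g : nat -> R -> R3) :
  generic_front n g -> generic_front n (fun i s => mirror (g i s)).
Proof.
  intros [H1 H2].
  assert (Inj : forall P Q, mirror P = mirror Q -> P = Q).
  { intros P Q E. apply mirror_eq in E. rewrite mirror_mirror in E. auto. }
  assert (Fr : forall P Q, front_proj (mirror P) = front_proj (mirror Q) ->
    front_proj P = front_proj Q).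
  { intros P Q E. rewrite !front_proj_mirror in E. apply (f_equal rot) in E.
    rewrite !rot_rot in E. auto. }
  split.
  - intros i s Hi [E1 E2]. rewrite mirror_dx in E1. rewrite mirror_dz in E2.
    assert (Hs : singular (g i) s) by (split; lra).
    specialize (H1 i s Hi Hs). unfold semicubical in *.
    change (Derive_n (fun u => - px (g i u)) 2 s * Derive_n (fun u => - pz (g i u)) 3 s -
      Derive_n (fun u => - px (g i u)) 3 s * Derive_n (fun u => - pz (g i u)) 2 s <> 0).
    rewrite !Derive_n_opp. intros E. apply H1. rewrite <- E. ring.
  - intros i j s t Hi Hj Hne E. destruct (H2 i j s t Hi Hj) as [H3 H4]; auto.
    { congruence. }
    split.
    + unfold transverse in *. rewrite !mirror_dx, !mirror_dz. intros E'. apply H3.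
      rewrite <- E'. ring.
    + intros k u Hk Ek. destruct (H4 k u Hk) as [-> | ->]; auto.
Qed.

Lemma represents_mirror (F : R2 -> Prop) (L : R3 -> Prop) :
  represents F L -> represents (rot_front F) (mirror_link L).
Proof.
  intros ((n & g & HP & Hg) & HF). split.
  - exists n, (fun i s => mirror (g i s)). split.
    + apply mirror_parametrizes; auto.
    + apply mirror_generic; auto.
  - intros q. unfold rot_front. rewrite HF. split; intros [P [HP' E]].
    + exists (mirror P). split; [unfold mirror_link; rewrite mirror_mirror; auto|].
      rewrite front_proj_mirror, E. apply rot_rot.
    + exists (mirror P). split; [auto|]. rewrite front_proj_mirror, E. auto.
Qed.

Lemma same_sides_mirror (L L' : R3 -> Prop) (c c' : R) :
  same_sides (mirror_link L) c (mirror_link L') c' -> same_sides L (- c) L' (- c').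
Proof.
  unfold same_sides, mirror_link. intros [H1 H2].
  split; intros x; [specialize (H2 (- x))|specialize (H1 (- x))];
    rewrite mirror_axis, Ropp_involutive in *.
  - split; intros [K1 K2].
    + destruct (proj1 H2) as [K3 K4]; [split; [auto|lra]|]. split; [auto|lra].
    + destruct (proj2 H2) as [K3 K4]; [split; [auto|lra]|]. split; [auto|lra].
  - split; intros [K1 K2].
    + destruct (proj1 H1) as [K3 K4]; [split; [auto|lra]|]. split; [auto|lra].
    + destruct (proj2 H1) as [K3 K4]; [split; [auto|lra]|]. split; [auto|lra].
Qed.

(** The arc provides front points arbitrarily close to the cusp and different from it, and they
    cannot lie on both sides. This is needed to decide whether a cusp is in standard form. *)
Lemma pointing_exclusive (Phi : R2 -> R2) (c e : R2) (F : R2 -> Prop) :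
  cusp_configuration Phi c e F -> right_pointing F c -> left_pointing F c -> False.
Proof.
  intros (a & Hs & Hn & Hc & _) [d1 K1] [d2 K2].
  pose proof Hs as (Sa & _ & _ & (L & HR & HD) & _).
  destruct (cont3_near a 0 (Rmin d1 d2)) as [d [Hd K]].
  { apply smooth_curve_cont3; auto. }
  { apply Rmin_glb_lt; apply cond_pos. }
  set (s := Rmin (d / 2) 1).
  assert (Hs0 : 0 < s) by (apply Rmin_glb_lt; lra).
  assert (Hs1 : s <= 1) by apply Rmin_r. assert (Hs2 : s <= d / 2) by apply Rmin_l.
  destruct (K s) as (N1 & _ & N3); [rewrite Rminus_0_r, Rabs_right; lra|].
  pose proof (Rmin_l d1 d2). pose proof (Rmin_r d1 d2).
  assert (HF : F (front_proj (a s))).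
  { apply (proj2 HR). exists (a s). split; auto. apply (HD (a s)). exists s. split; auto. lra. }
  assert (Hne : front_proj (a s) <> c).
  { rewrite <- Hc. intros E. apply Hn in E; lra. }
  assert (B : forall r : posreal, Rmin d1 d2 <= r -> ball c r (front_proj (a s))).
  { intros r Hr. rewrite <- Hc. split; simpl.
    - change (Rabs (px (a s) - px (a 0)) < r). lra.
    - change (Rabs (pz (a s) - pz (a 0)) < r). lra. }
  specialize (K1 _ (B d1 ltac:(auto)) HF Hne). specialize (K2 _ (B d2 ltac:(auto)) HF Hne).
  lra.
Qed.

Lemma pointing_rot (F : R2 -> Prop) (c : R2) :
  (right_pointing F c -> left_pointing (rot_front F) (rot c)) /\
  (left_pointing F c -> right_pointing (rot_front F) (rot c)).
Proof.
  assert (B : forall (d : posreal) q, ball (rot c) d q -> ball c d (rot q)).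
  { intros d q [B1 B2]. split.
    - change (Rabs (fst q - - fst c) < d) in B1. change (Rabs (- fst q - fst c) < d).
      rewrite <- Rabs_Ropp. replace (- (- fst q - fst c)) with (fst q - - fst c) by ring. auto.
    - change (Rabs (snd q - - snd c) < d) in B2. change (Rabs (- snd q - snd c) < d).
      rewrite <- Rabs_Ropp. replace (- (- snd q - snd c)) with (snd q - - snd c) by ring. auto. }
  split; intros [d K]; exists d; intros q Hq HF Hne;
    assert (Hne' : rot q <> c) by (intros E; apply Hne; rewrite <- E, rot_rot; auto);
    specialize (K _ (B d q Hq) HF Hne'); unfold rot in *; simpl in *; lra.
Qed.

Lemma modify_cusp_inv (config : (R2 -> R2) -> R2 -> (R2 -> Prop) -> Prop) (eps : Z)
    (F G : R2 -> Prop) (L M : R3 -> Prop) (x : R) :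
  changes_inv config eps -> represents F L -> represents G M -> modify_cusp config F (x, 0) G ->
  exists x', same_sides L x M x' /\
    ((right_pointing F (x, 0) /\ ~ left_pointing F (x, 0) /\
      forall k, inv L x k -> inv M x' (- k + eps)) \/
     (left_pointing F (x, 0) /\ ~ right_pointing F (x, 0) /\
      forall k, inv L x k -> inv M x' (- k - eps))).
Proof.
  intros Hconf HF HG [[Hr Hrep]|[Hl Hrep]].
  - destruct (Hconf F (x, 0) G L M HF HG Hrep) as (y & x' & E & Sd & Hk).
    injection E as <-. exists x'. split; auto. left. split; auto. split; auto.
    intros Hl. destruct Hrep as (Phi & e & _ & Hc & _).
    apply (pointing_exclusive Phi (x, 0) e F); auto.
  - destruct (Hconf (rot_front F) (rot (x, 0)) (rot_front G) (mirror_link L) (mirror_link M))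
      as (y & x' & E & Sd & Hk); auto using represents_mirror.
    injection E as E. assert (y = - x) by auto. subst y. exists (- x'). split.
    + rewrite <- (Ropp_involutive x). apply same_sides_mirror; auto.
    + right. split; auto. split.
      * intros Hr. destruct Hrep as (Phi & e & _ & Hc & _).
        apply (pointing_exclusive Phi (rot (x, 0)) e (rot_front F)); auto; apply pointing_rot; auto.
      * intros k Hinv. apply inv_mirror, Hk, inv_mirror in Hinv.
        (* Conjugating k -> -k + eps with k -> -k changes the sign of [eps]. *)
        replace (- k - eps)%Z with (- (- - k + eps))%Z by ring.
        apply inv_ext with (2 := Hinv). intros P. unfold mirror_link.
        rewrite mirror_mirror. tauto.
Qed.

(** * Stabilizations of knots *)

Definition leftmost (L : R3 -> Prop) (x : R) : Prop := forall y, L (y, 0, 0) -> x <= y.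

Lemma nleft_leftmost (L : R3 -> Prop) (x : R) (N : nat) :
  nleft L x N -> (N = 0%nat <-> leftmost L x).
Proof.
  intros (l & _ & <- & H). split.
  - intros E y Hy. apply length_zero_iff_nil in E. subst l. apply Rnot_lt_le. intros Hlt.
    apply (proj2 (H y)). auto.
  - intros Hm. destruct l as [|y l]; auto. exfalso.
    destruct (proj1 (H y)) as [Hy Hlt]; [left; auto|]. specialize (Hm y Hy). lra.
Qed.

Lemma two_fixed_points (L : R3 -> Prop) (x : R) :
  enumerates 2 (fun y => L (y, 0, 0)) -> L (x, 0, 0) ->
  exists z, z <> x /\ L (z, 0, 0) /\ forall y, L (y, 0, 0) -> y = x \/ y = z.
Proof.
  intros (l & D & Hl & H) Hx.
  destruct l as [|u [|v [|w l]]]; try discriminate.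
  assert (Huv : u <> v).
  { inversion D; subst. intros ->. apply H2. left; auto. }
  assert (M : forall y, L (y, 0, 0) <-> y = u \/ y = v).
  { intros y. rewrite <- H. simpl. intuition congruence. }
  apply M in Hx. destruct Hx as [-> | ->].
  - exists v. split; auto. split; [apply M; auto|]. intros y Hy. apply M in Hy. tauto.
  - exists u. split; auto. split; [apply M; auto|]. intros y Hy. apply M in Hy. tauto.
Qed.

(** With exactly two fixed points there is one component, so being its left or right fixed point can
    be read off from the subset, and hence from the transported position. *)
Lemma knot_fixed_point_sides (n : nat) (g : nat -> R -> R3) (L : R3 -> Prop) (p : R3) :
  parametrizes n g L -> enumerates 2 (fun y => L (y, 0, 0)) -> L p -> tau p = p ->
  (left_fixed_point L p <-> leftmost L (px p)) /\
  (right_fixed_point L p <-> ~ leftmost L (px p)).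
Proof.
  intros HP HE HL HT. pose proof HT as Ep. apply tau_fixed in Ep.
  assert (HL' : L (px p, 0, 0)) by (rewrite <- Ep; auto).
  destruct (two_fixed_points L (px p) HE HL') as (z & Hz & Lz & U).
  assert (n = 1%nat).
  { pose proof (enumerates_unique _ _ _ (enumerates_all n g L HP) HE). lia. }
  subst n.
  assert (SC : same_component L p (z, 0, 0)).
  { exists 1%nat, g, 0%nat. destruct HP as [HP HLP]. split; [split; auto|]. split; [auto|].
    split.
    - apply HLP in HL. destruct HL as [i [Hi H]]. assert (i = 0%nat) by lia. subst i. auto.
    - apply HLP in Lz. destruct Lz as [i [Hi H]]. assert (i = 0%nat) by lia. subst i. auto. }
  assert (On : forall q, same_component L p q -> tau q = q -> px q = px p \/ px q = z).
  { intros q (m & h & i & [_ Hh] & Hi & _ & Hq) Tq. apply U. apply tau_fixed in Tq.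
    rewrite <- Tq. apply Hh. exists i; auto. }
  assert (Lm : leftmost L (px p) <-> px p < z).
  { split.
    - intros H. specialize (H z Lz). lra.
    - intros H y Hy. destruct (U y Hy); lra. }
  assert (Lf : left_fixed_point L p <-> px p < z).
  { split.
    - intros (_ & q & Hq & Tq & Hlt). destruct (On q Hq Tq); lra.
    - intros H. split; auto. exists (z, 0, 0). split; auto. split; [apply tau_axis|auto]. }
  assert (Rf : right_fixed_point L p <-> z < px p).
  { split.
    - intros (_ & q & Hq & Tq & Hlt). destruct (On q Hq Tq); lra.
    - intros H. split; auto. exists (z, 0, 0). split; auto. split; [apply tau_axis|auto]. }
  split; [rewrite Lf, Lm; tauto|]. rewrite Rf, Lm. split; [lra|].
  intros H. apply Rnot_le_lt. intros Hle. apply H. lra.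
Qed.

(** Counting fixed points at time 0 shows that the isotopy has a single component, so that two fixed
    points remain at time 1. *)
Lemma knot_equivalent_fixed_points (K L : R3 -> Prop) (p q : R3) :
  si_legendrian_knot K -> pointed_equivalent K p L q ->
  enumerates 2 (fun y => L (y, 0, 0)) /\ L q /\ tau q = q.
Proof.
  intros [h Hh] (n & g & r & (_ & _ & HP0 & HP1) & _ & _ & Q1 & HQ).
  pose proof (enumerates_all n _ K HP0) as E0.
  pose proof (enumerates_unique _ _ _ E0 (enumerates_all 1 h K Hh)) as En.
  pose proof (enumerates_all n _ L HP1) as E1. rewrite En in E1. split; auto.
  destruct (HQ 1 ltac:(lra)) as [T1 Hon]. rewrite Q1 in T1, Hon.
  split; auto. apply HP1. auto.
Qed.

(* The sign of the change of the invariant depends on the side of the marked point and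
   not on the chosen diagram: a cusp in non-standard form points to the other side,
   and there the roles of S and T are exchanged. *)
Lemma stabilization_inv (config config' : (R2 -> R2) -> R2 -> (R2 -> Prop) -> Prop) (eps : Z)
    (K M : R3 -> Prop) (p : R3) (k : Z) (N : nat) :
  changes_inv config eps -> changes_inv config' (- eps) -> si_legendrian_knot K ->
  inv K (px p) k -> nleft K (px p) N ->
  (exists L0 p0 F G M0,
    pointed_equivalent K p L0 p0 /\ represents F L0 /\
    ((standard_form F L0 p0 /\ modify_cusp config F (front_proj p0) G) \/
     (~ standard_form F L0 p0 /\ modify_cusp config' F (front_proj p0) G)) /\
    represents G M0 /\ equivalent M0 M) ->
  exists x, nleft M x N /\ inv M x (if Nat.eqb N 0 then - k - eps else - k + eps).
Proof.
  intros Hc Hc' HK Hk HN (L0 & p0 & F & G & M0 & Hpe & HF & Hmod & HG & Heq).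
  destruct (knot_equivalent_fixed_points K L0 p p0 HK Hpe) as (HE & HL & HT).
  destruct (pointed_equivalent_transport K L0 p p0 k N Hpe Hk HN) as [Hk0 HN0].
  pose proof HF as ((n & g & HP & _) & _).
  destruct (knot_fixed_point_sides n g L0 p0 HP HE HL HT) as [Lf Rf].
  pose proof (nleft_leftmost L0 (px p0) N HN0) as HN00. rewrite <- HN00 in Lf, Rf.
  assert (Ep : front_proj p0 = (px p0, 0)).
  { apply tau_fixed in HT. rewrite HT at 1. reflexivity. }
  assert (R : exists x', same_sides L0 (px p0) M0 x' /\
    inv M0 x' (if Nat.eqb N 0 then - k - eps else - k + eps)).
  (* In each case the form of the cusp and its direction determine whether [N] is 0; the sign from a
     left-pointing cusp and the sign from exchanging the configurations then combine to the stated
     one. *)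
  { destruct Hmod as [[Hst Hm]|[Hst Hm]]; unfold standard_form in Hst; rewrite Ep in Hst, Hm.
    - destruct (modify_cusp_inv config eps F G L0 M0 (px p0) Hc HF HG Hm) as (x' & Sd & H).
      exists x'. split; auto. destruct H as [(Hr & Hnl & H)|(Hl & Hnr & H)].
      + assert (N <> 0)%nat by tauto.
        rewrite (proj2 (Nat.eqb_neq N 0)) by auto. auto.
      + assert (N = 0)%nat by tauto.
        rewrite (proj2 (Nat.eqb_eq N 0)) by auto. auto.
    - destruct (modify_cusp_inv config' (- eps) F G L0 M0 (px p0) Hc' HF HG Hm) as (x' & Sd & H).
      exists x'. split; auto. destruct H as [(Hr & Hnl & H)|(Hl & Hnr & H)].
      + assert (N = 0)%nat by (destruct (Nat.eq_dec N 0); tauto).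
        rewrite (proj2 (Nat.eqb_eq N 0)) by auto.
        replace (- k - eps)%Z with (- k + - eps)%Z by ring. auto.
      + assert (N <> 0)%nat by tauto.
        rewrite (proj2 (Nat.eqb_neq N 0)) by auto.
        replace (- k + eps)%Z with (- k - - eps)%Z by ring. auto. }
  destruct R as (x' & Sd & Hx').
  destruct (equivalent_transport M0 M x' _ N Heq Hx' (same_sides_nleft _ _ _ _ _ Sd HN0))
    as (x & Hx & HNx).
  exists x. auto.
Qed.

Theorem corollary4p6 :
  (forall (Phi : R2 -> R2) (e : R2) (F F' : R2 -> Prop),
     symmetric_disk Phi ->
     transvergent_front F -> transvergent_front F' ->
     coincide_outside Phi F F' ->
     S_configuration Phi e F -> T_configuration Phi e F' ->
     forall L L' : R3 -> Prop,
       represents F L -> represents F' L' -> ~ equivalent L L') /\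
  (forall (K : R3 -> Prop) (p : R3),
     si_legendrian_knot K -> K p -> tau p = p ->
     forall M M' : R3 -> Prop,
       S_link K p M -> T_link K p M' -> ~ equivalent M M').
Proof.
  split.
  - intros Phi e F F' HD _ _ Hco HS HT L L' HF HF'.
    apply (S_T_not_equivalent Phi e F F'); auto.
  - intros K p HK Hp HT M M' HS HT' Heq. pose proof HK as [g HP].
    apply tau_fixed in HT. rewrite HT in Hp.
    destruct (inv_exists 1 g K (px p) HP Hp) as [k Hk].
    destruct (nleft_exists 1 g K (px p) HP) as [N HN].
    destruct (stabilization_inv S_configuration T_configuration (-1) K M p k N)
      as (x & HNx & Hx); auto using S_changes_inv, T_changes_inv.
    destruct (stabilization_inv T_configuration S_configuration 1 K M' p k N)
      as (x' & HNx' & Hx'); auto using S_changes_inv, T_changes_inv.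
    destruct (equivalent_transport M M' x _ N Heq Hx HNx) as (y & Hy & HNy).
    assert (y = x').
    { apply (nleft_injective M' _ _ N); auto; eapply inv_on_link; eauto. }
    subst y. pose proof (inv_unique M' x' _ _ Hy Hx') as E.
    (* On either side the values are -k - 1 and -k + 1, in one order or the other, and differ by
       2. *)
    destruct (Nat.eqb N 0); lia.
Qed.
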